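(* Let $\alpha\in(4/3,2)$ and $a>0$. As $n\to\infty$, $$\mathbb{P}\big(\triangle_n>(1+a)m_n\big)=(1+o(1))\,n\,\mathbb{P}\big(W>c_a(n)\big).$$
   Context: Model: let $W,W_1,W_2,\dots$ be i.i.d. non-negative random variables with continuous distribution function $F$ and $\bar F(x)=1-F(x)=\mathbb{P}(W>x)=x^{-\alpha}L(x)$ for $x>0$, where $L$ is slowly varying at infinity and $\alpha\in(1,2)$; $\mu=\mathbb{E}[W]$. The random graph has vertex set $\{1,\dots,n\}$; conditionally on the weights, each pair $i\ne j$ is connected by an edge independently with probability $\min(W_iW_j/(\mu n),1)$. $\triangle_n$ is the number of triangles in the graph and $m_n=\mathbb{E}[\triangle_n]$. Let $$f_n(u,v,w)=\min\{uv/(\mu n),1\}\,\min\{vw/(\mu n),1\}\,\min\{uw/(\mu n),1\},$$ and for $a>0$ $$c_a(n)=\inf\Big\{c:\ \tfrac12 n^2\int_0^\infty\int_0^\infty f_n(x,y,c)\,dF(x)\,dF(y)\ge a\,m_n\Big\}.$$ *)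

(* Defs.v *)
From HB Require Import structures.
From mathcomp Require Import all_boot all_order all_algebra.
From mathcomp Require Import all_classical all_reals all_analysis.

Set Implicit Arguments.
Unset Strict Implicit.
Unset Printing Implicit Defensive.

Import Order.TTheory GRing.Theory Num.Theory.
Import numFieldNormedType.Exports.

Local Open Scope classical_set_scope.
Local Open Scope ring_scope.

Definition slowly_varying (R : realType) (L : R -> R) : Prop :=
  [/\ measurable_fun (`]0, +oo[ : set R) L,
      forall x : R, 0 < x -> 0 < L x
    & forall t : R, 0 < t -> L (t * x) / L x @[x --> +oo] --> (1 : R)].

Definition mutually_independent d (T : measurableType d) (R : realType)
    (P : probability T R) (X : nat -> {RV P >-> R}) : Prop :=
  forall (s : seq nat) (B : nat -> set R), uniq s ->
    (forall k, measurable (B k)) ->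
    P (\bigcap_(k in [set` s]) X k @^-1` B k) =
      (\prod_(k <- s) fine (P (X k @^-1` B k)))%:E.

Definition iid d (T : measurableType d) (R : realType)
    (P : probability T R) (X : nat -> {RV P >-> R}) : Prop :=
  mutually_independent X /\
  forall (k : nat) (B : set R), measurable B ->
    distribution P (X k) B = distribution P (X 0%N) B.

(* [X] is a version of the conditional probability of [A] given the
   sigma-algebra [G]. *)
Definition is_cond_prob d (T : measurableType d) (R : realType)
    (P : probability T R) (G : set (set T)) (A : set T) (X : T -> R) : Prop :=
  [/\ forall B : set R, measurable B -> G (X @^-1` B),
      P.-integrable setT (EFin \o X)
    & forall D : set T, G D -> (\int[P]_(w in D) (X w)%:E = P (A `&` D))%E].

(* In a weight sequence, [W 0] is the generic weight, and the vertices
   1, ..., n are represented by 'I_n: the vertex [i : 'I_n] stands for i + 1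
   and carries the weight [W i.+1]. *)

Definition mean_weight d (T : measurableType d) (R : realType)
    (P : probability T R) (W : nat -> {RV P >-> R}) : R :=
  fine ('E_P[W 0%N])%E.

Definition connection (R : realType) (mu : R) (n : nat) (u v : R) : R :=
  Num.min (u * v / (mu * n%:R)) 1.

Definition vertex_weights_sigma_algebra d (T : measurableType d)
    (R : realType) (P : probability T R) (W : nat -> {RV P >-> R}) (n : nat) :
    set (set T) :=
  <<s \bigcup_(i in [set: 'I_n])
        preimage_set_system setT (W i.+1) measurable >>.

(* [E w] is the adjacency relation of the random graph at the outcome [w].
   Conditional independence of the edges, with the prescribed conditional
   probabilities, is the product rule over every finite set [S] of pairs
   i < j. *)
Definition weighted_random_graph d (T : measurableType d) (R : realType)
    (P : probability T R) (W : nat -> {RV P >-> R}) (n : nat)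
    (E : T -> rel 'I_n) : Prop :=
  [/\ forall w, symmetric (E w),
      forall w, irreflexive (E w),
      forall i j, measurable [set w | E w i j]
    & forall S : {set 'I_n * 'I_n},
        (forall e, e \in S -> (e.1 < e.2)%N) ->
        is_cond_prob P (vertex_weights_sigma_algebra W n)
          [set w | forall e, e \in S -> E w e.1 e.2]
          (fun w => \prod_(e in S)
             connection (mean_weight W) n (W e.1.+1 w) (W e.2.+1 w))].

Definition triangles (n : nat) (e : rel 'I_n) : nat :=
  #|[pred t : {set 'I_n} | (#|t| == 3)%N &&
      [forall i in t, forall j in t, (i != j) ==> e i j]]|.

Definition mean_triangles d (T : measurableType d) (R : realType)
    (P : probability T R) (n : nat) (E : T -> rel 'I_n) : \bar R :=
  ('E_P[fun w => (triangles (E w))%:R])%E.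

Definition triangle_fn (R : realType) (mu : R) (n : nat) (u v w : R) : R :=
  connection mu n u v * connection mu n v w * connection mu n u w.

(* The infimum ranges over c >= 0, the domain of a weight: for c < 0 two of the
   three factors of f_n would be negative and their product positive. It is
   taken in the extended reals, so that it is +oo on the empty set. *)
Definition weight_threshold d (T : measurableType d) (R : realType)
    (P : probability T R) (W : nat -> {RV P >-> R}) (n : nat)
    (E : T -> rel 'I_n) (a : R) : \bar R :=
  let dF := distribution P (W 0%N) in
  ereal_inf [set c%:E | c in [set c : R | 0 <= c /\
    (a%:E * mean_triangles P E <=
     (2^-1 * n%:R ^+ 2)%R%:E *
       \int[dF]_(y in `[0%R, +oo[) \int[dF]_(x in `[0%R, +oo[)
         (triangle_fn (mean_weight W) n x y c)%:E)%E]].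

(* Main.v *)
(* A count above (1 + a) m_n is produced by a single heavy vertex. We have
   c_a(n) = n^(gamma + o(1)) with gamma = alpha / (4 (alpha - 1)), and gamma < 1
   exactly because alpha > 4/3. Cut the weights at b = n^beta for some beta < gamma
   close to gamma. Two vertices above b cost n^2 P(W > b)^2 = o(n P(W > c_a(n))).
   The triangles whose vertices all lie below b have a variance which is
   o(n P(W > c_a(n)) m_n^2), so Chebyshev's inequality makes their number
   m_n + o(m_n) up to a negligible probability; a conditional Chebyshev bound also
   concentrates the number of triangles at the only vertex above b, given its
   weight w, around (1/2) n^2 E[f_n(X, Y, w)]. Hence the count exceeds (1 + a) m_n
   essentially when this mean exceeds a m_n, that is, when w > c_a(n). The mean
   drops by a constant factor when w is multiplied by l < 1, so all errors are
   absorbed by replacing c_a(n) by l c_a(n) or c_a(n) / l, and l -> 1 costs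
   nothing because the tail of W varies regularly. *)
Require Import Defs.
From HB Require Import structures.
From mathcomp Require Import all_boot all_order all_algebra.
From mathcomp Require Import all_classical all_reals all_analysis.
From mathcomp Require Import measurable_realfun ring lra zify.

Import Order.TTheory GRing.Theory Num.Theory.
Import numFieldNormedType.Exports.

Local Open Scope classical_set_scope.
Local Open Scope ring_scope.

Set Implicit Arguments.
Unset Strict Implicit.
Unset Printing Implicit Defensive.

(** * Bounded random variables *)

(** Errors are compared through powers of [n] only. Moments of [W] are available just below order
    [alpha], so each bound carries a slack in the exponent that is sent to 0 afterwards, and slowly
    varying factors are swallowed by the [o(1)] in the exponents. Sharp constants in the tail enter
    only through the limit of [tail F (t * c n) / tail F (c n)] for fixed [t]. No asymptotic formula
    for the threshold is used: a strict drop of the star mean under scaling takes its place. The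
    tight comparison concerns two light triangles with exactly one common vertex. The bound for
    their share of the variance has the same exponent as [n * tail F (c n) * m n ^+ 2] when the cut
    is made at [gamma], by the equation that defines [gamma]; hence the cut at [n^beta] with
    [beta < gamma]. The other conditions on [beta] bound it from below and are strict at [gamma], so
    some [beta] meets them all. Joint moments of edges are computed in two steps: given the weights,
    edge indicators become connection probabilities; then the weights are integrated out one at a
    time as fresh coordinates. *)

Definition mean d (T : measurableType d) (R : realType) (P : probability T R)
    (f : T -> R) : R := \int[P]_w f w.

(** Edge indicators, connection probabilities and truncations are all of this kind, and the class is
    closed under products and partial means, so integrability needs a separate argument only for
    power moments of the weights. *)
Definition bounded_meas d (T : measurableType d) (R : realType) (f : T -> R) :=
  measurable_fun setT f /\ exists M : R, forall w, `|f w| <= M.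

Section bounded_meas.
Context d (T : measurableType d) (R : realType).
Implicit Types f g : T -> R.

Lemma bounded_meas_cst (r : R) : bounded_meas (fun _ : T => r).
Proof. by split; [exact: measurable_cst | exists `|r|]. Qed.

Lemma bounded_measD f g : bounded_meas f -> bounded_meas g ->
  bounded_meas (fun w => f w + g w).
Proof.
move=> [mf [M fM]] [mg [N gN]]; split; first exact: measurable_funD.
by exists (M + N) => w; rewrite (le_trans (ler_normD _ _))// lerD.
Qed.

Lemma bounded_measM f g : bounded_meas f -> bounded_meas g ->
  bounded_meas (fun w => f w * g w).
Proof.
move=> [mf [M fM]] [mg [N gN]]; split; first exact: measurable_funM.
by exists (M * N) => w; rewrite normrM ler_pM.
Qed.

Lemma bounded_measN f : bounded_meas f -> bounded_meas (fun w => - f w).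
Proof.
move=> [mf [M fM]]; split; first exact: measurableT_comp.
by exists M => w; rewrite normrN.
Qed.

Lemma bounded_measB f g : bounded_meas f -> bounded_meas g ->
  bounded_meas (fun w => f w - g w).
Proof. by move=> bf bg; apply: bounded_measD => //; exact: bounded_measN. Qed.

Lemma bounded_meas_sum (I : Type) (s : seq I) (A : pred I) (f : I -> T -> R) :
  (forall i, bounded_meas (f i)) ->
  bounded_meas (fun w => \sum_(i <- s | A i) f i w).
Proof.
move=> bf; elim: s => [|i s IH].
  rewrite (_ : (fun w => _) = fun=> 0); first exact: bounded_meas_cst.
  by apply/funext => w; rewrite big_nil.
case: (boolP (A i)) => Ai; last first.
  by rewrite (_ : (fun w => _) = fun w => \sum_(i <- s | A i) f i w)//;
    apply/funext => w; rewrite big_cons (negbTE Ai).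
rewrite (_ : (fun w => _) = fun w => f i w + \sum_(i <- s | A i) f i w).
  exact: bounded_measD.
by apply/funext => w; rewrite big_cons Ai.
Qed.

Lemma bounded_meas_indic (A : set T) : measurable A ->
  bounded_meas (\1_A : T -> R).
Proof.
move=> mA; split; first exact: measurable_indic.
by exists 1 => w; rewrite indicE normr_nat; case: (_ \in _).
Qed.

Lemma bounded_meas_comp d' (S : measurableType d') (g : S -> T) f :
  bounded_meas f -> measurable_fun setT g -> bounded_meas (fun s => f (g s)).
Proof.
move=> [mf [M fM]] mg; split; first exact: measurableT_comp.
by exists M => s.
Qed.

End bounded_meas.

Section mean.
Context d (T : measurableType d) (R : realType) (P : probability T R).
Implicit Types f g : T -> R.

Definition integ f := P.-integrable setT (EFin \o f).

Lemma bounded_integ f : bounded_meas f -> integ f.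
Proof.
move=> [mf [M fM]]; apply: measurable_bounded_integrable => //.
  by rewrite (le_lt_trans (probability_le1 _ _))// ltry.
exists M; split; first exact: num_real.
by move=> x Mx w _; apply: (le_trans (fM w)); exact: ltW.
Qed.

Lemma mean_EFin f : integ f -> (\int[P]_w (f w)%:E)%E = (mean P f)%:E.
Proof. by move=> fi; rewrite /mean /Rintegral fineK//; exact: integrable_fin_num. Qed.

Lemma eq_mean f g : f =1 g -> mean P f = mean P g.
Proof. by move=> fg; apply: eq_Rintegral => w _. Qed.

Lemma mean_le f g : integ f -> integ g -> (forall w, f w <= g w) ->
  mean P f <= mean P g.
Proof. by move=> fi gi fg; apply: le_Rintegral. Qed.

Lemma mean_ge0 f : (forall w, 0 <= f w) -> 0 <= mean P f.
Proof. by move=> f0; apply: Rintegral_ge0. Qed.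

Lemma mean_cst (r : R) : mean P (fun _ => r) = r.
Proof.
rewrite /mean Rintegral_cst// -[RHS]mulr1; congr (_ * _).
by rewrite -[RHS]/(fine 1%E); congr fine; exact: probability_setT.
Qed.

Lemma mean_indic (A : set T) : measurable A -> mean P (\1_A) = fine (P A).
Proof. by move=> mA; rewrite /mean /Rintegral integral_indic// setIT. Qed.

Lemma integZ (r : R) f : integ f -> integ (fun w => r * f w).
Proof.
move=> fi; rewrite /integ (_ : _ \o _ = (fun w => r%:E * (EFin \o f) w)%E).
  exact: integrableZl.
by apply/funext => w /=; rewrite EFinM.
Qed.

Lemma integD f g : integ f -> integ g -> integ (fun w => f w + g w).
Proof.
move=> fi gi; rewrite /integ (_ : _ \o _ = ((EFin \o f) \+ (EFin \o g))%E)//.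
exact: integrableD.
Qed.

Lemma meanD f g : integ f -> integ g ->
  mean P (fun w => f w + g w) = mean P f + mean P g.
Proof. by move=> fi gi; rewrite /mean RintegralD. Qed.

Lemma meanB f g : integ f -> integ g ->
  mean P (fun w => f w - g w) = mean P f - mean P g.
Proof. by move=> fi gi; rewrite /mean RintegralB. Qed.

Lemma meanZ (r : R) f : integ f -> mean P (fun w => r * f w) = r * mean P f.
Proof. by move=> fi; rewrite /mean RintegralZl. Qed.

Lemma mean_sum (I : Type) (s : seq I) (A : pred I) (f : I -> T -> R) :
  (forall i, bounded_meas (f i)) ->
  mean P (fun w => \sum_(i <- s | A i) f i w) =
    \sum_(i <- s | A i) mean P (f i).
Proof.
move=> bf; elim: s => [|i s IH].
  rewrite big_nil -[RHS](mean_cst 0); apply: eq_mean => w.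
  by rewrite big_nil.
rewrite big_cons; case: ifPn => Ai; last first.
  by rewrite -IH; apply: eq_mean => w; rewrite big_cons (negbTE Ai).
rewrite -IH -meanD; last 2 first.
- exact: bounded_integ.
- by apply: bounded_integ; exact: bounded_meas_sum.
by apply: eq_mean => w; rewrite big_cons Ai.
Qed.

Lemma mean_le_bound f (M : R) : bounded_meas f -> (forall w, f w <= M) ->
  mean P f <= M.
Proof.
move=> bf fM; rewrite -[leRHS](mean_cst M); apply: mean_le => //.
  exact: bounded_integ.
by apply: bounded_integ; exact: bounded_meas_cst.
Qed.

Lemma fine_prob_ge0 (A : set T) : 0 <= fine (P A).
Proof. exact/fine_ge0/measure_ge0. Qed.

Lemma fine_probK (A : set T) : measurable A -> (fine (P A))%:E = P A.
Proof. by move=> mA; rewrite fineK// fin_num_measure. Qed.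

Lemma fine_prob_le (A B : set T) : measurable A -> measurable B ->
  A `<=` B -> fine (P A) <= fine (P B).
Proof.
by move=> mA mB AB; apply: fine_le; rewrite ?fin_num_measure//;
  apply: le_measure => //; rewrite inE.
Qed.

Lemma fine_probU (A B : set T) : measurable A -> measurable B ->
  fine (P (A `|` B)) <= fine (P A) + fine (P B).
Proof.
move=> mA mB; have mAB := measurableU _ _ mA mB.
by rewrite -lee_fin EFinD !fine_probK//; exact: measureU2.
Qed.

Lemma fine_prob_bigU (I : Type) (s : seq I) (A : I -> set T) :
  (forall i, measurable (A i)) ->
  fine (P (\big[setU/set0]_(i <- s) A i)) <= \sum_(i <- s) fine (P (A i)).
Proof.
move=> mA; elim: s => [|i s IH]; first by rewrite !big_nil measure0.
rewrite !big_cons (le_trans (fine_probU _ _))// ?lerD2l//.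
by apply: bigsetU_measurable.
Qed.

Lemma mean_markov (A : set T) f (c : R) : measurable A -> bounded_meas f ->
  0 < c -> (forall w, 0 <= f w) -> (forall w, A w -> c <= f w) ->
  fine (P A) <= mean P f / c.
Proof.
move=> mA bf c0 f0 Af; rewrite ler_pdivlMr// -mean_indic// mulrC -meanZ.
  apply: mean_le.
  - by apply: bounded_integ; apply: bounded_measM;
      [exact: bounded_meas_cst | exact: bounded_meas_indic].
  - exact: bounded_integ.
  - move=> w; rewrite indicE; have [/set_mem Aw|_] := boolP (w \in A).
      by rewrite mulr1 Af.
    by rewrite mulr0.
by apply: bounded_integ; exact: bounded_meas_indic.
Qed.

End mean.

(** * Integrating out independent weights *)

Section independence.
Context d (T : measurableType d) (R : realType) (P : probability T R).
Variable W : nat -> {RV P >-> R}.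
Hypothesis W_iid : iid W.

Local Notation F := (distribution P (W 0%N)).
Local Notation box l B := (\bigcap_(k in [set` l]) W k @^-1` B k).

Lemma measurable_weight k : measurable_fun setT (W k).
Proof. exact: measurable_funP. Qed.

Lemma measurable_weight_preimage k B : measurable B -> measurable (W k @^-1` B).
Proof. by move=> mB; rewrite -[X in measurable X]setTI; exact: measurable_weight. Qed.

Lemma measurable_box (l : seq nat) (B : nat -> set R) :
  (forall k, measurable (B k)) -> measurable (box l B).
Proof.
move=> mB; apply: fin_bigcap_measurable; first exact: finite_seq.
by move=> k _; exact: measurable_weight_preimage.
Qed.

(** [s] lists the indices that [V] has already consumed. Independence is tested against finite boxes
    of the remaining weights only; this is enough for an induction that moves one weight at a time
    into [V]. *)
Definition indep_from d' (S : measurableType d') (V : T -> S) (s : seq nat) :=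
  measurable_fun setT V /\
  forall A l B, measurable A -> uniq l -> {in l, forall k, k \notin s} ->
    (forall k, measurable (B k)) ->
    P (V @^-1` A `&` box l B) = (P (V @^-1` A) * P (box l B))%E.

Lemma box_cons j l B : box (j :: l) B = W j @^-1` B j `&` box l B.
Proof.
apply/seteqP; split => w /=.
  move=> H; split; first by apply: (H j); rewrite /= mem_head.
  by move=> k kl; apply: (H k); rewrite /= inE kl orbT.
move=> [Hj H] k /=; rewrite inE => /predU1P[->//|kl].
exact: H.
Qed.

Lemma prob_box_cons j l B : uniq (j :: l) -> (forall k, measurable (B k)) ->
  P (box (j :: l) B) = (F (B j) * P (box l B))%E.
Proof.
move=> ul mB; have [indW idW] := W_iid.
rewrite !indW//; last by case/andP: ul.
rewrite big_cons EFinM fineK; last first.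
  by apply: fin_num_measure; exact: measurable_weight_preimage.
by congr (_ * _)%E; rewrite -(idW j).
Qed.

Lemma indep_from_unit : indep_from (fun=> tt) [::].
Proof.
split; first exact: measurable_cst.
move=> A l B mA ul ls mB; rewrite preimage_cst.
case: ifPn => _; first by rewrite setTI [P setT]probability_setT mul1e.
by rewrite set0I measure0 mul0e.
Qed.

Section step.
Context d' (S : measurableType d') (V : T -> S) (s : seq nat) (j : nat).
Hypotheses (indV : indep_from V s) (js : j \notin s).

Let mV : measurable_fun setT V := proj1 indV.

HB.instance Definition _ := isMeasurableFun.Build _ _ _ _ V mV.

Let law : probability S R := distribution P (V : {mfun T >-> S}).

Let pair_weight (w : T) : S * R := (V w, W j w).

Let mpair : measurable_fun setT pair_weight.
Proof. by apply: measurable_fun_pair => //; exact: measurable_weight. Qed.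

HB.instance Definition _ := isMeasurableFun.Build _ _ _ _ pair_weight mpair.

(** As functions of [A] both sides are measures that agree on rectangles, so uniqueness of the
    product measure identifies them. The box stays inside the statement because it hands the
    independence from the remaining weights on to the pair; its probability is absorbed as a scalar
    factor of [F]. *)
Lemma prob_pair_weight A l B : measurable A -> uniq l ->
    {in l, forall k, k \notin j :: s} -> (forall k, measurable (B k)) ->
  P (pair_weight @^-1` A `&` box l B) = (((law \x F)%E A) * P (box l B))%E.
Proof.
move=> mA ul ls mB; have mC := measurable_box l mB.
have cK : (fine (P (box l B)))%:E = P (box l B) by rewrite fine_probK.
pose c : {nonneg R} := NngNum (fine_prob_ge0 P (box l B)).
have mX X : measurable X -> measurable (pair_weight @^-1` X).
  by move=> mX; rewrite -[Y in measurable Y]setTI; exact: mpair.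
pose m' : {measure set (S * R) -> \bar R} :=
  measure_function_pushforward__canonical__measure_function_Measure
    (mrestr P mC) mpair.
have m'E X : m' X = P (pair_weight @^-1` X `&` box l B) by [].
pose m'' : {measure set (S * R) -> \bar R} := mscale c (law \x F)%E.
rewrite -m'E muleC -cK -[RHS]/(m'' A).
have rect X Y : measurable X -> measurable Y ->
    m' (X `*` Y) = (law X * mscale c F Y)%E.
  move=> mX' mY; rewrite m'E.
  have jl : j \notin l by apply/negP => /ls; rewrite mem_head.
  (* The side [Y] of the rectangle becomes the [j]-th side of a larger box, to which the
     independence of [V] applies directly. *)
  pose B' k := if k == j then Y else B k.
  have mB' k : measurable (B' k) by rewrite /B'; case: ifP.
  have lB' : box l B' = box l B.
    apply: eq_bigcapr => k /= kl; rewrite /B'; case: eqP => // kj.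
    by move: jl; rewrite -kj kl.
  have -> : pair_weight @^-1` (X `*` Y) `&` box l B =
      V @^-1` X `&` box (j :: l) B'.
    by rewrite box_cons lB' setIA /B' eqxx.
  rewrite (proj2 indV)//; last 2 first.
  - by rewrite /= jl.
  - move=> k; rewrite inE => /predU1P[->//|/ls].
    by rewrite inE negb_or => /andP[].
  rewrite prob_box_cons//; last by rewrite /= jl.
  by rewrite lB' /B' eqxx /mscale /= cK; congr (_ * _)%E; rewrite muleC.
rewrite -(@product_measure_unique _ _ _ _ _ law (mscale c F) m' rect)//.
apply: (@product_measure_unique _ _ _ _ _ law (mscale c F) m'') => //.
move=> X Y mX' mY.
transitivity (c%:num%:E * (law \x F) (X `*` Y))%E; first by [].
by rewrite product_measure1E// muleCA.
Qed.

Lemma prob_pair_weightT A : measurable A ->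
  P (pair_weight @^-1` A) = (law \x F)%E A.
Proof.
move=> mA.
have := @prob_pair_weight A [::] (fun=> setT) mA isT (fun _ => _) (fun=> measurableT).
rewrite (_ : box _ _ = setT); last first.
  by apply/seteqP; split => // w _ k.
by rewrite setIT [P setT]probability_setT mule1; apply.
Qed.

Lemma indep_from_pair : indep_from (fun w => (V w, W j w)) (j :: s).
Proof.
split; first exact: mpair.
move=> A l B mA ul ls mB; rewrite prob_pair_weight//.
by congr (_ * _)%E; rewrite -prob_pair_weightT.
Qed.

(** Tonelli's theorem for the law of the pair, which is a product because the index [j] is fresh. *)
Lemma integral_peel (f : S * R -> \bar R) : measurable_fun setT f ->
  (forall z, 0 <= f z)%E ->
  (\int[P]_w f (V w, W j w) = \int[P]_w \int[F]_y f (V w, y))%E.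
Proof.
move=> mf f0.
transitivity (\int[distribution P (pair_weight : {mfun T >-> (S * R)%type})]_z f z)%E.
  by rewrite ge0_integral_pushforward.
transitivity (\int[(law \x F)%E]_z f z)%E.
  apply: eq_measure_integral => A mA _.
  exact: prob_pair_weightT.
rewrite fubini_tonelli1// /law ge0_integral_pushforward//.
  exact: measurable_fun_fubini_tonelli_F.
by move=> v _; apply: integral_ge0.
Qed.

End step.

End independence.

Lemma bounded_meas_fin d d' (S : measurableType d) (T : measurableType d')
    (R : realType) (f : S * T -> R) (s : S) :
  bounded_meas f -> bounded_meas (fun y => f (s, y)).
Proof.
move=> [mf [M fM]]; split; last by exists M => y.
exact: measurable_fun_pair2.
Qed.

Lemma bounded_meas_mean d d' (S : measurableType d) (T : measurableType d')
    (R : realType) (Q : probability T R) (f : S * T -> R) :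
  bounded_meas f -> (forall z, 0 <= f z) ->
  bounded_meas (fun s => mean Q (fun y => f (s, y))).
Proof.
move=> bf f0; have [mf [M fM]] := bf; split.
  apply/measurable_EFinP.
  rewrite (_ : _ \o _ = fubini_F Q (EFin \o f)); last first.
    apply/funext => s /=; rewrite -mean_EFin//.
    by apply: bounded_integ; exact: bounded_meas_fin.
  apply: measurable_fun_fubini_tonelli_F => //.
  exact/measurable_EFinP.
exists M => s; rewrite ger0_norm ?mean_ge0//; apply: mean_le_bound.
  exact: bounded_meas_fin.
by move=> y; rewrite (le_trans _ (fM (s, y)))// ler_norm.
Qed.

Lemma mean_peel d (T : measurableType d) (R : realType) (P : probability T R)
    (W : nat -> {RV P >-> R}) (W_iid : iid W) d' (S : measurableType d')
    (V : T -> S) (s : seq nat) (j : nat) (f : S * R -> R) :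
  indep_from W V s -> j \notin s -> bounded_meas f -> (forall z, 0 <= f z) ->
  mean P (fun w => f (V w, W j w)) =
    mean P (fun w => mean (distribution P (W 0%N)) (fun y => f (V w, y))).
Proof.
move=> indV js bf f0; apply: EFin_inj.
have [mV _] := indV; have [mp _] := indep_from_pair W_iid indV js.
have i1 := bounded_integ P (bounded_meas_comp bf mp).
have i2 := bounded_integ P
  (bounded_meas_comp (bounded_meas_mean (distribution P (W 0%N)) bf f0) mV).
rewrite -(mean_EFin i1) -(mean_EFin i2).
rewrite (integral_peel W_iid indV js (f := EFin \o f)).
- apply: eq_integral => w _; rewrite -mean_EFin//.
  by apply: bounded_integ; exact: bounded_meas_fin.
- by apply/measurable_EFinP; case: bf.
- by move=> z; rewrite lee_fin.
Qed.

(** * Conditional probabilities tested against bounded functions *)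

Lemma sum_ltn_indicator (N t : nat) : (t <= N)%N ->
  (\sum_(j < N) (j < t) = t)%N.
Proof.
move=> tN; rewrite -(subnK tN) addnC; elim: (N - t)%N => [|k IH].
  rewrite addn0 -[RHS]card_ord -sum1_card; apply: eq_bigr => j _.
  by rewrite ltn_ord.
by rewrite addnS big_ord_recr /= IH ltnNge leq_addr addn0.
Qed.

(** The sum counts the levels [j.+1 <= x * k], so it equals the integer part of [x * k] divided by
    [k]; [N] only has to be large enough to miss no level. *)
Lemma layer_sum_bounds (R : realType) (x : R) (k N : nat) :
  0 <= x -> (0 < k)%N -> x * k%:R <= N%:R ->
  x - k%:R^-1 <= \sum_(j < N) k%:R^-1 * (j.+1%:R / k%:R <= x)%R%:R <= x.
Proof.
move=> x0 k0 xN; have k0' : 0 < k%:R :> R by rewrite ltr0n.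
have xk0 : 0 <= x * k%:R by rewrite mulr_ge0.
have tN : (Num.truncn (x * k%:R) <= N)%N.
  by rewrite -(ler_nat R) (le_trans _ xN)// truncn_le.
rewrite -mulr_sumr.
have -> : \sum_(j < N) (j.+1%:R / k%:R <= x)%R%:R = (Num.truncn (x * k%:R))%:R :> R.
  rewrite -[in RHS](sum_ltn_indicator tN) natr_sum; apply: eq_bigr => j _.
  by rewrite ler_pdivrMr// -truncn_ge_nat.
have := truncn_itv xk0 => /andP[t1 t2].
apply/andP; split.
  rewrite mulrC ler_pdivlMr// mulrBl mulVf ?gt_eqF// lerBlDr.
  by rewrite ltW// -[X in _ < _ + X]/(1%:R) -natrD addn1.
by rewrite mulrC ler_pdivrMr.
Qed.

Lemma squeeze_eq (R : realType) (x y c : R) :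
  (forall k : nat, (0 < k)%N -> `|x - y| <= c / k%:R) -> x = y.
Proof.
move=> H; apply/eqP; rewrite -subr_eq0 -normr_eq0; apply/negPn/negP => n0.
have n0' : 0 < `|x - y| by rewrite lt_def n0 normr_ge0.
have c0 : 0 <= c by have := H 1%N isT; rewrite divr1; apply: le_trans.
pose k := (Num.truncn (c / `|x - y|)).+1.
have := H k isT; apply/negP; rewrite -ltNge ltr_pdivrMr ?ltr0n//.
rewrite mulrC -ltr_pdivrMr//.
by have /andP[_] := truncn_itv (divr_ge0 c0 (ltW n0')).
Qed.

Section cond_prob.
Context d (T : measurableType d) (R : realType) (P : probability T R).
Variables (gen : set (set T)) (A : set T) (X h : T -> R).
Hypothesis condX : is_cond_prob P <<s gen>> A X.
Hypotheses (mA : measurable A) (bX : bounded_meas X) (X0 : forall w, 0 <= X w).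
Hypotheses (bh : bounded_meas h) (h0 : forall w, 0 <= h w).
Hypothesis mh :
  measurable_fun setT (h : g_sigma_algebraType gen -> R).

(** [is_cond_prob] compares the two sides on events of the sigma-algebra only. A bounded [h] lies
    within [1 / k] of a finite combination [hk] of indicators of events [t <= h], on which the two
    sides agree; replacing [h] by [hk] costs at most [1 / k] on one side and [mean P X / k] on the
    other. *)
Lemma mean_cond_prob :
  mean P (fun w => \1_A w * h w) = mean P (fun w => X w * h w).
Proof.
have [_ [M hM]] := bh.
have bA : bounded_meas (\1_A : T -> R) by exact: bounded_meas_indic.
apply: (@squeeze_eq _ _ _ (1 + mean P X)) => k k0.
pose N := (Num.truncn (M * k%:R)).+1.
pose D t := [set w | t <= h w].
have GD t : <<s gen>> (D t).
  have := mh measurableT (measurable_itv `[t, +oo[).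
  rewrite setTI; congr (<<s _ >> _).
  by apply/seteqP; split => w /=; rewrite in_itv /= andbT.
have mD t : measurable (D t).
  have [mh' _] := bh; have := mh' measurableT _ (measurable_itv `[t, +oo[).
  rewrite setTI; congr measurable.
  by apply/seteqP; split => w /=; rewrite in_itv /= andbT.
pose hk w := \sum_(j < N) k%:R^-1 * \1_(D (j.+1%:R / k%:R)) w : R.
have bhk : bounded_meas hk.
  apply: bounded_meas_sum => j; apply: bounded_measM.
    exact: bounded_meas_cst.
  exact: bounded_meas_indic.
have hkb w : h w - k%:R^-1 <= hk w <= h w.
  have -> : hk w = \sum_(j < N) k%:R^-1 * (j.+1%:R / k%:R <= h w)%R%:R.
    apply: eq_bigr => j _; congr (_ * _); rewrite indicE.
    by congr (nat_of_bool _)%:R; apply/idP/idP => [/set_mem//|?]; apply/mem_set.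
  apply: layer_sum_bounds => //.
  have M0 : 0 <= M by rewrite (le_trans _ (hM w)).
  have M1 : h w * k%:R <= M * k%:R.
    by rewrite ler_wpM2r// (le_trans _ (hM w))// ler_norm.
  rewrite (le_trans M1)//.
  have /andP[_ M2] := truncn_itv (mulr_ge0 M0 (ler0n R k)).
  exact: ltW.
have eqD t : mean P (fun w => \1_A w * \1_(D t) w) =
             mean P (fun w => X w * \1_(D t) w).
  apply: EFin_inj; have [_ _ cX] := condX.
  rewrite -!mean_EFin; last 2 first.
  - by apply: bounded_integ; apply: bounded_measM => //; exact: bounded_meas_indic.
  - by apply: bounded_integ; apply: bounded_measM => //; exact: bounded_meas_indic.
  transitivity (P (A `&` D t)).
    have mAD := measurableI _ _ mA (mD t).
    transitivity (\int[P]_w (\1_(A `&` D t) w)%:E)%E.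
      by apply: eq_integral => w _; rewrite indicI.
    by rewrite integral_indic// setIT.
  rewrite -cX//; rewrite integral_mkcond; apply: eq_integral => w _.
  by rewrite patchE indicE; case: ifP => _; rewrite ?mulr1 ?mulr0.
have eqk : mean P (fun w => \1_A w * hk w) = mean P (fun w => X w * hk w).
  have exch f : bounded_meas f -> mean P (fun w => f w * hk w) =
      \sum_(j < N) k%:R^-1 * mean P (fun w => f w * \1_(D (j.+1%:R / k%:R)) w).
    move=> bf.
    transitivity (mean P (fun w =>
        \sum_(j < N) k%:R^-1 * (f w * \1_(D (j.+1%:R / k%:R)) w))).
      apply: eq_mean => w; rewrite /hk mulr_sumr; apply: eq_bigr => j _.
      by rewrite mulrCA.
    rewrite mean_sum => [|j]; last first.
      apply: bounded_measM; first exact: bounded_meas_cst.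
      by apply: bounded_measM => //; exact: bounded_meas_indic.
    apply: eq_bigr => j _; rewrite meanZ//.
    by apply: bounded_integ; apply: bounded_measM => //; exact: bounded_meas_indic.
  by rewrite !exch//; apply: eq_bigr => j _; rewrite eqD.
have close f : bounded_meas f -> (forall w, 0 <= f w) ->
    mean P (fun w => f w * hk w) <= mean P (fun w => f w * h w) /\
    mean P (fun w => f w * h w) <= mean P (fun w => f w * hk w) + mean P f / k%:R.
  move=> bf f0.
  have i1 : integ P (fun w => f w * hk w) by apply: bounded_integ; exact: bounded_measM.
  have i2 : integ P (fun w => f w * h w) by apply: bounded_integ; exact: bounded_measM.
  have i3 : integ P (fun w => k%:R^-1 * f w).
    by apply: bounded_integ; apply: bounded_measM => //; exact: bounded_meas_cst.
  split.
    apply: mean_le => // w; apply: ler_wpM2l => //.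
    by have /andP[] := hkb w.
  rewrite [mean P f / _]mulrC -meanZ; last exact: bounded_integ.
  rewrite -meanD//; apply: mean_le => //.
    apply: bounded_integ; apply: bounded_measD; apply: bounded_measM => //.
    exact: bounded_meas_cst.
  move=> w; rewrite mulrC [_^-1 * _]mulrC -mulrDr mulrC ler_wpM2l//.
  by have /andP[+ _] := hkb w; rewrite lerBlDr.
have A0 w : 0 <= \1_A w :> R by rewrite indicE.
have [a1 a2] := close _ bA A0; have [b1 b2] := close _ bX X0.
have A1 : mean P (\1_A) <= 1.
  by apply: mean_le_bound => // w; rewrite indicE; case: (_ \in _).
have Y0 : 0 <= mean P X by exact: mean_ge0.
have ki0 : 0 <= k%:R^-1 :> R by rewrite invr_ge0.
have A1k : mean P (\1_A) / k%:R <= 1 / k%:R by rewrite ler_wpM2r.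
have Y0k : 0 <= mean P X / k%:R by rewrite mulr_ge0.
rewrite mulrDl ler_norml; lra.
Qed.

End cond_prob.

(* The connection probability extended by 0 to negative weights, so that it is
   nonnegative everywhere; [s] stands for mu n. *)
Definition kernel (R : realType) (s u v : R) : R :=
  Num.min (Num.max u 0 * Num.max v 0 / s) 1.

Ltac meas := repeat match goal with
  | |- measurable_fun _ (fun p => p) => exact: measurable_id
  | |- measurable_fun _ (fun p => fst (@?g p)) =>
      apply: (@measurableT_comp _ _ _ _ _ _ fst _ g measurable_fst)
  | |- measurable_fun _ (fun p => snd (@?g p)) =>
      apply: (@measurableT_comp _ _ _ _ _ _ snd _ g measurable_snd)
  | |- measurable_fun _ fst => exact: measurable_fst
  | |- measurable_fun _ snd => exact: measurable_snd
  | |- measurable_fun _ _ => done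
  end.

Section kernel.
Context (R : realType).
Implicit Types s u v : R.

Lemma kernel_ge0 s u v : 0 < s -> 0 <= kernel s u v.
Proof.
move=> s0; rewrite /kernel le_min ler01 andbT divr_ge0 ?(ltW s0)//.
by rewrite mulr_ge0// le_max lexx orbT.
Qed.

Lemma kernel_le1 s u v : kernel s u v <= 1.
Proof. by rewrite /kernel ge_min lexx orbT. Qed.

Lemma kernelC s u v : kernel s u v = kernel s v u.
Proof. by rewrite /kernel [Num.max u 0 * _]mulrC. Qed.

Lemma bounded_meas_kernel s d (T : measurableType d) (f g : T -> R) : 0 < s ->
  measurable_fun setT f -> measurable_fun setT g ->
  bounded_meas (fun w => kernel s (f w) (g w)).
Proof.
move=> s0 mf mg; split; last first.
  by exists 1 => w; rewrite ger0_norm ?kernel_ge0 ?kernel_le1.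
apply: measurable_minr; last exact: measurable_cst.
apply: measurable_funM; last exact: measurable_cst.
by apply: measurable_funM; apply: measurable_maxr => //; exact: measurable_cst.
Qed.

End kernel.

Section peel.
Context d (T : measurableType d) (R : realType) (P : probability T R).
Variables (W : nat -> {RV P >-> R}) (W_iid : iid W).
Local Notation F := (distribution P (W 0%N)).
Context d' (S : measurableType d') (V : T -> S) (s : seq nat).
Hypothesis indV : indep_from W V s.
Variable A : S -> R.
Hypotheses (bA : bounded_meas A) (A0 : forall v, 0 <= A v).

Lemma mean_peel1 (g : R -> R) j : j \notin s -> bounded_meas g ->
  (forall x, 0 <= g x) ->
  mean P (fun w => A (V w) * g (W j w)) = mean P (fun w => A (V w)) * mean F g.
Proof.
move=> js bg g0.
rewrite (mean_peel W_iid (f := fun p => A p.1 * g p.2) indV js).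
- transitivity (mean P (fun w => mean F g * A (V w))).
    apply: eq_mean => w /=; rewrite meanZ; first exact: mulrC.
    exact: bounded_integ.
  rewrite meanZ; first exact: mulrC.
  by apply: bounded_integ; apply: bounded_meas_comp => //; case: indV.
- by apply: bounded_measM; apply: bounded_meas_comp => //; meas.
- by move=> z; rewrite mulr_ge0.
Qed.

Variable r : S -> R.
Hypothesis mr : measurable_fun setT r.

(** [r] reads from [V] the weight of the base vertex of a triangle; it stays as a parameter while
    the two fresh weights are integrated. *)
Lemma mean_peel2 (k : R -> R -> R -> R) i j : uniq [:: i; j] ->
    i \notin s -> j \notin s ->
    bounded_meas (fun p : R * R * R => k p.1.1 p.1.2 p.2) ->
    (forall x y z, 0 <= k x y z) ->
  mean P (fun w => A (V w) * k (r (V w)) (W i w) (W j w)) =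
  mean P (fun w => A (V w) * mean F (fun y => mean F (fun z => k (r (V w)) y z))).
Proof.
rewrite /= inE andbT => ij si sj bk k0.
have ind' := indep_from_pair W_iid indV si.
have mp3 : measurable_fun setT (fun p : S * R * R => (r p.1.1, p.1.2, p.2)).
  apply: measurable_fun_pair; first apply: measurable_fun_pair; meas.
  by apply: (@measurableT_comp _ _ _ _ _ _ r _ (fun p => p.1.1)); meas.
have bk3 : bounded_meas (fun p : S * R * R => k (r p.1.1) p.1.2 p.2).
  exact: (bounded_meas_comp bk mp3).
have mp2 : measurable_fun setT (fun p : S * R => (r p.1, p.2)).
  apply: measurable_fun_pair; meas.
  by apply: (@measurableT_comp _ _ _ _ _ _ r _ (fun p => p.1)); meas.
have bk2 : bounded_meas (fun p : R * R => mean F (fun z => k p.1 p.2 z)).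
  exact: (@bounded_meas_mean _ _ _ _ _ F (fun p => k p.1.1 p.1.2 p.2)).
have bA' : bounded_meas (fun p : S * R => A p.1).
  by apply: bounded_meas_comp => //; meas.
rewrite (mean_peel W_iid (f := fun p => A p.1.1 * k (r p.1.1) p.1.2 p.2) ind').
- transitivity (mean P (fun w => A (V w) * mean F (fun z => k (r (V w)) (W i w) z))).
    apply: eq_mean => w; rewrite /= meanZ//; apply: bounded_integ.
    exact: (@bounded_meas_fin _ _ _ _ _ (fun p => k p.1.1 p.1.2 p.2) (r (V w), W i w)).
  rewrite (mean_peel W_iid
    (f := fun p => A p.1 * mean F (fun z => k (r p.1) p.2 z)) indV si).
  + apply: eq_mean => w; rewrite /= meanZ//; apply: bounded_integ.
    exact: (@bounded_meas_fin _ _ _ _ _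
      (fun p => mean F (fun z => k p.1 p.2 z)) (r (V w))).
  + by apply: bounded_measM => //; exact: (bounded_meas_comp bk2 mp2).
  + by move=> z; rewrite mulr_ge0// mean_ge0.
- by rewrite inE negb_or eq_sym ij.
- apply: bounded_measM => //; apply: bounded_meas_comp => //.
  by meas.
- by move=> z; rewrite mulr_ge0.
Qed.

End peel.

Lemma mean_peel3 d (T : measurableType d) (R : realType) (P : probability T R)
    (W : nat -> {RV P >-> R}) (W_iid : iid W) d' (S : measurableType d')
    (V : T -> S) (s : seq nat) (A : S -> R) (r : S -> R)
    (k : R -> R -> R -> R -> R) (a b c : nat) :
  indep_from W V s -> bounded_meas A -> (forall v, 0 <= A v) ->
  measurable_fun setT r -> uniq [:: a, b, c & s] ->
  bounded_meas (fun p : R * R * R * R => k p.1.1.1 p.1.1.2 p.1.2 p.2) ->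
  (forall x y z t, 0 <= k x y z t) ->
  mean P (fun w => A (V w) * k (r (V w)) (W a w) (W b w) (W c w)) =
  mean P (fun w => A (V w) *
    mean (distribution P (W 0%N)) (fun y =>
    mean (distribution P (W 0%N)) (fun z =>
    mean (distribution P (W 0%N)) (fun t => k (r (V w)) y z t)))).
Proof.
move=> indV bA A0 mr.
rewrite /= !inE !negb_or => /and4P[/and3P[ab ac sa] /andP[bc sb] sc us] bk k0.
set F := distribution P (W 0%N).
have ind1 := indep_from_pair W_iid indV sa.
have b_as : b \notin a :: s by rewrite inE negb_or eq_sym ab.
have ind2 := indep_from_pair W_iid ind1 b_as.
have c_bas : c \notin [:: b, a & s].
  by rewrite !inE !negb_or eq_sym bc eq_sym ac.
have bk3 : bounded_meas (fun p : R * R * R => mean F (fun t => k p.1.1 p.1.2 p.2 t)).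
  exact: (@bounded_meas_mean _ _ _ _ _ F (fun p => k p.1.1.1 p.1.1.2 p.1.2 p.2)).
have mp4 : measurable_fun setT
    (fun p : S * R * R * R => (r p.1.1.1, p.1.1.2, p.1.2, p.2)).
  do 3 (apply: measurable_fun_pair; meas).
  by apply: (@measurableT_comp _ _ _ _ _ _ r _ (fun p => p.1.1.1)); meas.
rewrite (mean_peel W_iid
  (f := fun p => A p.1.1.1 * k (r p.1.1.1) p.1.1.2 p.1.2 p.2) ind2 c_bas).
- transitivity (mean P (fun w => A (V w) *
      mean F (fun t => k (r (V w)) (W a w) (W b w) t))).
    apply: eq_mean => w; rewrite /= meanZ//; apply: bounded_integ.
    exact: (@bounded_meas_fin _ _ _ _ _ (fun p => k p.1.1.1 p.1.1.2 p.1.2 p.2)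
      (r (V w), W a w, W b w)).
  rewrite (mean_peel2 W_iid indV bA A0 mr
    (k := fun x y z => mean F (fun t => k x y z t)))//.
    by rewrite /= inE ab.
  by move=> x y z; exact: mean_ge0.
- apply: bounded_measM.
    by apply: (@bounded_meas_comp _ _ _ _ _ (fun p => p.1.1.1) A) => //; meas.
  exact: (bounded_meas_comp bk mp4).
- by move=> z; rewrite mulr_ge0.
Qed.

(** * Edge indicators and connection probabilities *)

Definition sort_pair n (e : 'I_n * 'I_n) := if (e.1 < e.2)%N then e else (e.2, e.1).

Lemma sort_pair_eq n (e e' : 'I_n * 'I_n) :
  (sort_pair e == sort_pair e') = (e == e') || (e == (e'.2, e'.1)).
Proof.
case: e e' => a b [a' b']; rewrite /sort_pair /=.
by case: ltnP => ab; case: ltnP => ab'; rewrite !xpair_eqE -!val_eqE /=; lia.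
Qed.

Section edges.
Context d (T : measurableType d) (R : realType) (P : probability T R).
Variables (W : nat -> {RV P >-> R}) (n : nat) (E : T -> rel 'I_n).
Hypothesis W_ge0 : forall k w, 0 <= W k w.
Hypothesis E_graph : weighted_random_graph W E.
Local Notation s := (mean_weight W * n%:R).
Hypothesis s_gt0 : 0 < s.

Definition vertex_preimages : set (set T) :=
  \bigcup_(i in [set: 'I_n]) preimage_set_system setT (W i.+1) measurable.

(** These are the factors that may be carried through the conditional law of the edges given the
    weights of the [n] vertices. The generic weight [W 0] is not among these weights. *)
Definition vertex_measurable (h : T -> R) :=
  measurable_fun setT (h : g_sigma_algebraType vertex_preimages -> R).

Lemma vertex_measurable_cst r : vertex_measurable (fun=> r).
Proof. exact: measurable_cst. Qed.

Lemma vertex_measurableM f g : vertex_measurable f -> vertex_measurable g ->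
  vertex_measurable (fun w => f w * g w).
Proof. exact: measurable_funM. Qed.

Lemma vertex_measurable_weight (i : 'I_n) (g : R -> R) :
  measurable_fun setT g -> vertex_measurable (fun w => g (W i.+1 w)).
Proof.
move=> mg _ B mB; apply: sub_sigma_algebra; exists i => //.
exists (g @^-1` B) => //.
by rewrite -[X in measurable X]setTI; exact: mg.
Qed.

Lemma bounded_meas_edge i j : bounded_meas (fun w => (E w i j)%:R : R).
Proof.
have [_ _ mE _] := E_graph.
rewrite (_ : (fun w => _) = \1_[set w | E w i j]).
  exact: bounded_meas_indic.
apply/funext => w; rewrite indicE; congr (nat_of_bool _)%:R.
by apply/idP/idP => [?|/set_mem//]; apply/mem_set.
Qed.

Lemma edge_sort e w : E w (sort_pair e).1 (sort_pair e).2 = E w e.1 e.2.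
Proof. by have [sE _ _ _] := E_graph; rewrite /sort_pair; case: ifP => // _ /=; rewrite sE. Qed.

Lemma kernel_weight i j w :
  connection (mean_weight W) n (W i w) (W j w) = kernel s (W i w) (W j w).
Proof. by rewrite /kernel !max_l. Qed.

Lemma prod_nat_bool (I : Type) (l : seq I) (b : I -> bool) :
  \prod_(e <- l) (b e)%:R = (all b l)%:R :> R.
Proof.
elim: l => [|e l IH]; first by rewrite big_nil.
by rewrite big_cons IH /=; case: (b e); rewrite ?mul1r ?mul0r.
Qed.

Lemma bounded_meas_prod d' (S : measurableType d') (I : Type) (l : seq I)
    (f : I -> S -> R) :
  (forall i, bounded_meas (f i)) -> bounded_meas (fun x => \prod_(i <- l) f i x).
Proof.
move=> bf; elim: l => [|i l IH].
  rewrite (_ : (fun x => _) = fun=> 1); first exact: bounded_meas_cst.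
  by apply/funext => x; rewrite big_nil.
rewrite (_ : (fun x => _) = fun x => f i x * \prod_(i <- l) f i x).
  exact: bounded_measM.
by apply/funext => x; rewrite big_cons.
Qed.

(** This is the only passage from the random graph to its weights: after it, every expectation is an
    integral over independent weights. *)
Lemma mean_edges (l : seq ('I_n * 'I_n)) (h : T -> R) :
    all (fun e => e.1 != e.2) l -> uniq [seq sort_pair e | e <- l] ->
    bounded_meas h -> (forall w, 0 <= h w) -> vertex_measurable h ->
  mean P (fun w => \prod_(e <- l) (E w e.1 e.2)%:R * h w) =
  mean P (fun w => \prod_(e <- l) kernel s (W e.1.+1 w) (W e.2.+1 w) * h w).
Proof.
move=> l_ne l_uniq bh h0 vh; have [sE _ mE cE] := E_graph.
(* The model prescribes joint probabilities for sets of increasing pairs only. Sorting is harmless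
   because both the adjacency relation and [kernel] are symmetric, and distinctness of the sorted
   pairs turns the product over the list into a product over the set. *)
pose S := [set e in [seq sort_pair e | e <- l]]%SET.
have S_lt e : e \in S -> (e.1 < e.2)%N.
  rewrite inE => /mapP[e' el ->]; have := allP l_ne _ el.
  rewrite /sort_pair; case: ifPn => //=; rewrite -leqNgt leq_eqVlt.
  by move=> /predU1P[/val_inj ->|//]; rewrite eqxx.
have condS := cE S S_lt.
set A := [set w | forall e, e \in S -> E w e.1 e.2] in condS.
have mA : measurable A.
  rewrite (_ : A = \bigcap_(e in [set` S]) [set w | E w e.1 e.2]).
    by apply: fin_bigcap_measurable => //; exact: finite_finset.
  by apply/seteqP; split => w Hw e eS; exact: Hw.
have prodS (f : 'I_n * 'I_n -> R) : (forall e, f (sort_pair e) = f e) ->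
    \prod_(e in S) f e = \prod_(e <- l) f e.
  move=> fs; transitivity (\prod_(e <- l) f (sort_pair e)); last exact: eq_bigr.
  rewrite -(big_map (@sort_pair n) xpredT f) big_uniq//=.
  by apply: eq_bigl => e; rewrite inE.
have indA w : \1_A w = \prod_(e <- l) (E w e.1 e.2)%:R :> R.
  rewrite prod_nat_bool indicE; congr (nat_of_bool _)%:R; apply/idP/allP.
    move=> /set_mem Aw e el; rewrite -edge_sort; apply: Aw.
    by rewrite inE map_f.
  move=> H; apply/mem_set => e; rewrite inE => /mapP[e' el ->].
  by rewrite edge_sort; exact: H.
have prodX w : \prod_(e in S) connection (mean_weight W) n (W e.1.+1 w) (W e.2.+1 w)
    = \prod_(e <- l) kernel s (W e.1.+1 w) (W e.2.+1 w).
  pose f (e : 'I_n * 'I_n) := kernel s (W e.1.+1 w) (W e.2.+1 w).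
  transitivity (\prod_(e in S) f e).
    by apply: eq_bigr => e _; exact: kernel_weight.
  rewrite prodS// => e; rewrite /f.
  by rewrite /sort_pair; case: ifP => // _ /=; rewrite kernelC.
have := mean_cond_prob condS mA _ _ bh h0 vh.
rewrite (eq_mean P (f := fun w => \1_A w * h w)
  (g := fun w => \prod_(e <- l) (E w e.1 e.2)%:R * h w)); last first.
  by move=> w; rewrite indA.
rewrite (eq_mean P (f := fun w => (\prod_(e in S) _) * h w)
  (g := fun w => \prod_(e <- l) kernel s (W e.1.+1 w) (W e.2.+1 w) * h w));
  last first.
  by move=> w; rewrite prodX.
apply.
  rewrite (_ : (fun w => _) = fun w => \prod_(e <- l) kernel s (W e.1.+1 w) (W e.2.+1 w)).
    apply: bounded_meas_prod => e.
    by apply: bounded_meas_kernel => //; exact: measurable_weight.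
  by apply/funext => w; exact: prodX.
by move=> w; rewrite prodX; apply: prodr_ge0 => e _; exact: kernel_ge0.
Qed.

End edges.

(** * Moments of triangle indicators *)

Section moments.
Context (R : realType) (F : probability R R) (s : R).
Implicit Types hb : R -> R.

Definition tri (x y z : R) : R := kernel s x y * kernel s y z * kernel s x z.

(** [hb] is either 1 or the indicator of the weights at most [b]. For [hb = 1] and [x >= 0] this is
    the double integral in the definition of the threshold. *)
Definition tri_mean hb (x : R) : R :=
  mean F (fun y => mean F (fun z => hb y * hb z * tri x y z)).

Definition tri_total hb : R := mean F (fun x => hb x * tri_mean hb x).

(* Two triangles x y t and z y t sharing the edge y t contain this 4-cycle; the
   shared edge is dropped from second-moment bounds. *)
Definition cycle4 (x y z t : R) : R :=
  kernel s x y * kernel s y z * kernel s z t * kernel s t x.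

Definition cycle4_mean (x : R) : R :=
  mean F (fun y => mean F (fun z => mean F (fun t => cycle4 x y z t))).

Hypothesis s0 : 0 < s.

Lemma tri_ge0 x y z : 0 <= tri x y z.
Proof. by rewrite !mulr_ge0// kernel_ge0. Qed.

Lemma cycle4_ge0 x y z t : 0 <= cycle4 x y z t.
Proof. by rewrite !mulr_ge0// kernel_ge0. Qed.

Lemma bounded_meas_tri d (T : measurableType d) (f g h : T -> R) :
  measurable_fun setT f -> measurable_fun setT g -> measurable_fun setT h ->
  bounded_meas (fun w => tri (f w) (g w) (h w)).
Proof.
by move=> mf mg mh; do 2?[apply: bounded_measM]; exact: bounded_meas_kernel.
Qed.

Lemma bounded_meas_cycle4 d (T : measurableType d) (f g h k : T -> R) :
  measurable_fun setT f -> measurable_fun setT g -> measurable_fun setT h ->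
  measurable_fun setT k ->
  bounded_meas (fun w => cycle4 (f w) (g w) (h w) (k w)).
Proof.
by move=> mf mg mh mk; do 3?[apply: bounded_measM]; exact: bounded_meas_kernel.
Qed.

Variable hb : R -> R.
Hypotheses (bhb : bounded_meas hb) (hb0 : forall x, 0 <= hb x).

Lemma bounded_meas_hbtri :
  bounded_meas (fun p : R * R * R => hb p.1.2 * hb p.2 * tri p.1.1 p.1.2 p.2).
Proof.
apply: bounded_measM; last by apply: bounded_meas_tri; meas.
by apply: bounded_measM; apply: bounded_meas_comp => //; meas.
Qed.

Lemma hbtri_ge0 x y z : 0 <= hb y * hb z * tri x y z.
Proof. by apply: mulr_ge0; [exact: mulr_ge0 | exact: tri_ge0]. Qed.

Lemma bounded_meas_tri_mean1 :
  bounded_meas (fun p : R * R => mean F (fun z => hb p.2 * hb z * tri p.1 p.2 z)).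
Proof.
apply: (@bounded_meas_mean _ _ _ _ _ F
  (fun p : R * R * R => hb p.1.2 * hb p.2 * tri p.1.1 p.1.2 p.2)).
  exact: bounded_meas_hbtri.
by move=> z; exact: hbtri_ge0.
Qed.

Lemma bounded_meas_tri_mean : bounded_meas (tri_mean hb).
Proof.
apply: (@bounded_meas_mean _ _ _ _ _ F
  (fun p : R * R => mean F (fun z => hb p.2 * hb z * tri p.1 p.2 z))).
  exact: bounded_meas_tri_mean1.
by move=> z; apply: mean_ge0 => y; exact: hbtri_ge0.
Qed.

Lemma tri_mean_ge0 x : 0 <= tri_mean hb x.
Proof. by apply: mean_ge0 => y; apply: mean_ge0 => z; exact: hbtri_ge0. Qed.

Lemma bounded_meas_cycle4_full : bounded_meas
  (fun p : R * R * R * R => cycle4 p.1.1.1 p.1.1.2 p.1.2 p.2).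
Proof. by apply: bounded_meas_cycle4; meas. Qed.

Lemma bounded_meas_cycle4_mean : bounded_meas cycle4_mean.
Proof.
apply: (@bounded_meas_mean _ _ _ _ _ F
  (fun p => mean F (fun z => mean F (fun t => cycle4 p.1 p.2 z t)))).
  apply: (@bounded_meas_mean _ _ _ _ _ F
    (fun p : R * R * R => mean F (fun t => cycle4 p.1.1 p.1.2 p.2 t))).
    apply: (@bounded_meas_mean _ _ _ _ _ F
      (fun p : R * R * R * R => cycle4 p.1.1.1 p.1.1.2 p.1.2 p.2)).
      exact: bounded_meas_cycle4_full.
    by move=> z; exact: cycle4_ge0.
  by move=> z; apply: mean_ge0 => t; exact: cycle4_ge0.
by move=> z; do 2!apply: mean_ge0 => ?; exact: cycle4_ge0.
Qed.

Lemma cycle4_mean_ge0 x : 0 <= cycle4_mean x.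
Proof. by do 3!apply: mean_ge0 => ?; exact: cycle4_ge0. Qed.

End moments.

(** Both orientations are supplied as rewrite rules, so that the many distinctness goals below close
    by rewriting alone. *)
Lemma neq_rewrite (I : eqType) (x y : I) : x != y ->
  ((x == y) = false) * ((y == x) = false).
Proof. by move=> H; rewrite [y == x]eq_sym (negbTE H). Qed.

Lemma uniq_sort_bowtie n (u a b c e : 'I_n) : uniq [:: u; a; b; c; e] ->
  uniq [seq sort_pair x | x <- [:: (u, a); (a, b); (u, b); (u, c); (c, e); (u, e)]].
Proof.
rewrite /= !inE !sort_pair_eq !xpair_eqE /= !negb_or !andbT.
move=> /and4P[/and4P[ua ub uc ue] /and3P[ab ac ae] /andP[bc be] ce].
by rewrite ?eqxx !(neq_rewrite ua, neq_rewrite ub, neq_rewrite uc, neq_rewrite ue,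
  neq_rewrite ab, neq_rewrite ac, neq_rewrite ae, neq_rewrite bc,
  neq_rewrite be, neq_rewrite ce).
Qed.

Lemma uniq_sort_disjoint n (u a b v c e : 'I_n) : uniq [:: u; a; b; v; c; e] ->
  uniq [seq sort_pair x | x <- [:: (u, a); (a, b); (u, b); (v, c); (c, e); (v, e)]].
Proof.
rewrite /= !inE !sort_pair_eq !xpair_eqE /= !negb_or !andbT.
move=> /and5P[/and5P[ua ub uv uc ue] /and4P[ab av ac ae] /and3P[bv bc be]
  /andP[vc ve] ce].
by rewrite ?eqxx !(neq_rewrite ua, neq_rewrite ub, neq_rewrite uc, neq_rewrite ue,
  neq_rewrite ab, neq_rewrite ac, neq_rewrite ae, neq_rewrite bc,
  neq_rewrite be, neq_rewrite ce, neq_rewrite uv, neq_rewrite av,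
  neq_rewrite bv, neq_rewrite vc, neq_rewrite ve).
Qed.

Lemma uniq_sort_triangle n (u a b : 'I_n) : uniq [:: u; a; b] ->
  uniq [seq sort_pair x | x <- [:: (u, a); (a, b); (u, b)]].
Proof.
rewrite /= !inE !sort_pair_eq !xpair_eqE /= !negb_or !andbT.
move=> /andP[/andP[ua ub] ab].
by rewrite ?eqxx !(neq_rewrite ua, neq_rewrite ub, neq_rewrite ab).
Qed.

Lemma uniq_sort_cycle4 n (u a b c : 'I_n) : uniq [:: u; a; b; c] ->
  uniq [seq sort_pair x | x <- [:: (u, a); (a, b); (b, c); (c, u)]].
Proof.
rewrite /= !inE !sort_pair_eq !xpair_eqE /= !negb_or !andbT.
move=> /and3P[/and3P[ua ub uc] /andP[ab ac] bc].
by rewrite ?eqxx !(neq_rewrite ua, neq_rewrite ub, neq_rewrite uc,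
  neq_rewrite ab, neq_rewrite ac, neq_rewrite bc).
Qed.

Ltac bm1 := match goal with
  | |- bounded_meas (fun v => _ * _) => apply: bounded_measM
  | |- bounded_meas (fun v => tri _ _ _ _) => apply: bounded_meas_tri
  | |- bounded_meas (fun v => ?f (@?g v)) =>
      apply: (@bounded_meas_comp _ _ _ _ _ g f); [assumption | by meas]
  | |- measurable_fun _ _ => by meas
  | |- is_true (0 < _) => assumption
  end.

Section identities.
Context d (T : measurableType d) (R : realType) (P : probability T R).
Variables (W : nat -> {RV P >-> R}) (n : nat) (E : T -> rel 'I_n).
Hypothesis W_iid : iid W.
Hypothesis W_ge0 : forall k w, 0 <= W k w.
Hypothesis E_graph : weighted_random_graph W E.
Local Notation s := (mean_weight W * n%:R).
Hypothesis s_gt0 : 0 < s.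
Local Notation F := (distribution P (W 0%N) : probability R R).

Definition tri_ind w (u a b : 'I_n) : R :=
  (E w u a)%:R * (E w a b)%:R * (E w u b)%:R.

Variables (h g hb : R -> R) (j : nat).
Hypotheses (bh : bounded_meas h) (h0 : forall x, 0 <= h x).
Hypotheses (bg : bounded_meas g) (g0 : forall x, 0 <= g x).
Hypotheses (bhb : bounded_meas hb) (hb0 : forall x, 0 <= hb x).
Hypothesis vh : vertex_measurable W n (fun w => h (W j w)).

Let bW k (f : R -> R) : bounded_meas f -> bounded_meas (fun w => f (W k w)).
Proof. by move=> bf; apply: bounded_meas_comp => //; exact: measurable_weight. Qed.

Let vW (i : 'I_n) (f : R -> R) : bounded_meas f ->
  vertex_measurable W n (fun w => f (W i.+1 w)).
Proof. by move=> [mf _]; exact: vertex_measurable_weight. Qed.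

Lemma mean_weight_fun k (f : R -> R) : bounded_meas f -> (forall x, 0 <= f x) ->
  mean P (fun w => f (W k w)) = mean F f.
Proof.
move=> bf f0.
have := mean_peel1 W_iid (indep_from_unit W) (@bounded_meas_cst _ unit R 1)
  (fun=> ler01) (j := k) isT bf f0.
rewrite mean_cst mul1r => <-; apply: eq_mean => w.
by rewrite mul1r.
Qed.

Let ind1 := indep_from_pair W_iid (indep_from_unit W) (j := j) isT.

Let mean_final (f : R -> R) k : k != j -> bounded_meas f -> (forall x, 0 <= f x) ->
  mean P (fun w => h (W j w) * f (W k w)) = mean F h * mean F f.
Proof.
move=> kj bf f0.
rewrite -(mean_weight_fun j bh h0).
apply: (mean_peel1 W_iid ind1 (A := fun v => h v.2)) => //.
- by apply: bounded_meas_comp => //; meas.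
- by rewrite inE.
Qed.

(** The factor [h (W j w)] belongs to a vertex outside the triangle, through which the event that
    this vertex is heavy is carried along; a constant [h] with [j = 0] removes it. The factor [g]
    sits on the distinguished vertex [u], and [hb] truncates the two others. *)
Lemma mean_triangle (u a b : 'I_n) : uniq [:: j; u.+1; a.+1; b.+1] ->
  mean P (fun w => tri_ind w u a b *
    (h (W j w) * g (W u.+1 w) * (hb (W a.+1 w) * hb (W b.+1 w)))) =
  mean F h * mean F (fun x => g x * tri_mean F s hb x).
Proof.
move=> U; have := U.
rewrite /= !inE !negb_or !eqSS => /and4P[/and3P[ju ja jb] /andP[ua ub] ab _].
pose H w := h (W j w) * g (W u.+1 w) * (hb (W a.+1 w) * hb (W b.+1 w)).
pose l := [:: (u, a); (a, b); (u, b)].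
transitivity (mean P (fun w => \prod_(e <- l) (E w e.1 e.2)%:R * H w)).
  by apply: eq_mean => w; rewrite !big_cons big_nil mulr1 !mulrA.
rewrite (mean_edges W_ge0 E_graph s_gt0); last 5 first.
- by rewrite /= ua ab ub.
- by apply: uniq_sort_triangle; rewrite /= !inE negb_or ua ub ab.
- by do 2!apply: bounded_measM; try exact: bW; apply: bounded_measM; exact: bW.
- by move=> w; rewrite !mulr_ge0.
- by do 2!apply: vertex_measurableM => //; try exact: vW;
    apply: vertex_measurableM; exact: vW.
have ind2 : indep_from W (fun w => (tt, W j w, W u.+1 w)) [:: u.+1; j].
  by apply: (indep_from_pair W_iid ind1); rewrite inE eq_sym.
transitivity (mean P (fun w => h (W j w) * g (W u.+1 w) *
    (hb (W a.+1 w) * hb (W b.+1 w) * tri s (W u.+1 w) (W a.+1 w) (W b.+1 w)))).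
  apply: eq_mean => w; rewrite !big_cons big_nil /H /tri /=; ring.
rewrite (mean_peel2 W_iid ind2 (A := fun v => h v.1.2 * g v.2)
  _ _ measurable_snd (k := fun x y z => hb y * hb z * tri s x y z)).
- rewrite -(mean_final (k := u.+1)) => [|||x]; last 1 first.
  + by rewrite mulr_ge0// tri_mean_ge0.
  + by apply: eq_mean => w; rewrite mulrA.
  + by rewrite eq_sym.
  + by apply: bounded_measM => //; exact: bounded_meas_tri_mean.
- by apply: bounded_measM; apply: bounded_meas_comp => //; meas.
- by move=> v; rewrite mulr_ge0.
- by rewrite /= inE andbT eqSS.
- by rewrite !inE ?eqSS !(neq_rewrite ua, neq_rewrite ja).
- by rewrite !inE ?eqSS !(neq_rewrite ub, neq_rewrite jb).
- exact: bounded_meas_hbtri.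
- by move=> x y z; exact: hbtri_ge0.
Qed.

(** Given the weight of the common vertex [u] the two triangles are independent, hence the
    square. *)
Lemma mean_bowtie (u a b c e : 'I_n) :
    uniq [:: j; u.+1; a.+1; b.+1; c.+1; e.+1] ->
  mean P (fun w => tri_ind w u a b * tri_ind w u c e *
    (h (W j w) * g (W u.+1 w) * (hb (W a.+1 w) * hb (W b.+1 w)) *
      (hb (W c.+1 w) * hb (W e.+1 w)))) =
  mean F h * mean F (fun x => g x * tri_mean F s hb x ^+ 2).
Proof.
move=> U; have := U; rewrite /= !inE !negb_or !eqSS.
move=> /and5P[/and5P[ju ja jb jc je] /and4P[ua ub uc ue] /and3P[ab ac ae]
  /andP[bc be] /andP[ce _]].
pose H w := h (W j w) * g (W u.+1 w) * (hb (W a.+1 w) * hb (W b.+1 w)) *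
      (hb (W c.+1 w) * hb (W e.+1 w)).
pose l := [:: (u, a); (a, b); (u, b); (u, c); (c, e); (u, e)].
transitivity (mean P (fun w => \prod_(e <- l) (E w e.1 e.2)%:R * H w)).
  by apply: eq_mean => w; rewrite !big_cons big_nil /H /tri_ind /=; ring.
rewrite (mean_edges W_ge0 E_graph s_gt0); last 5 first.
- by rewrite /= ua ab ub uc ce ue.
- by apply: uniq_sort_bowtie; rewrite /= !inE !negb_or ua ub uc ue ab ac ae bc be ce.
- by do 2!(apply: bounded_measM; last by apply: bounded_measM; exact: bW);
    apply: bounded_measM; exact: bW.
- by move=> w; rewrite !mulr_ge0.
- by do 2!(apply: vertex_measurableM; last by apply: vertex_measurableM; exact: vW);
    apply: vertex_measurableM => //; exact: vW.
have ind2 : indep_from W (fun w => (tt, W j w, W u.+1 w)) [:: u.+1; j].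
  by apply: (indep_from_pair W_iid ind1); rewrite inE eq_sym.
have ind3 : indep_from W (fun w => (tt, W j w, W u.+1 w, W a.+1 w))
    [:: a.+1; u.+1; j].
  apply: (indep_from_pair W_iid ind2).
  by rewrite !inE ?eqSS !(neq_rewrite ua, neq_rewrite ja).
have ind4 : indep_from W (fun w => (tt, W j w, W u.+1 w, W a.+1 w, W b.+1 w))
    [:: b.+1; a.+1; u.+1; j].
  apply: (indep_from_pair W_iid ind3).
  by rewrite !inE ?eqSS !(neq_rewrite ab, neq_rewrite ub, neq_rewrite jb).
transitivity (mean P (fun w => h (W j w) * g (W u.+1 w) *
    (hb (W a.+1 w) * hb (W b.+1 w) * tri s (W u.+1 w) (W a.+1 w) (W b.+1 w)) *
    (hb (W c.+1 w) * hb (W e.+1 w) * tri s (W u.+1 w) (W c.+1 w) (W e.+1 w)))).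
  apply: eq_mean => w; rewrite !big_cons big_nil /H /tri /=; ring.
rewrite (mean_peel2 W_iid ind4 (A := fun v => h v.1.1.1.2 * g v.1.1.2 *
    (hb v.1.2 * hb v.2 * tri s v.1.1.2 v.1.2 v.2)) (r := fun v => v.1.1.2)
  _ _ _ (k := fun x y z => hb y * hb z * tri s x y z)).
- transitivity (mean P (fun w => (h (W j w) *
      (g (W u.+1 w) * tri_mean F s hb (W u.+1 w))) *
      (hb (W a.+1 w) * hb (W b.+1 w) * tri s (W u.+1 w) (W a.+1 w) (W b.+1 w)))).
    by apply: eq_mean => w; rewrite /tri_mean /=; ring.
  rewrite (mean_peel2 W_iid ind2
    (A := fun v => h v.1.2 * (g v.2 * tri_mean F s hb v.2))
    _ _ measurable_snd (k := fun x y z => hb y * hb z * tri s x y z)).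
  + rewrite -(mean_final (k := u.+1)) => [|||x]; last 1 first.
    * by rewrite mulr_ge0// exprn_ge0// tri_mean_ge0.
    * by apply: eq_mean => w; rewrite -/(tri_mean F s hb _) /=; ring.
    * by rewrite eq_sym.
    * rewrite (_ : (fun x => _) = fun x => g x * (tri_mean F s hb x * tri_mean F s hb x)).
        by do 2!apply: bounded_measM => //; exact: bounded_meas_tri_mean.
      by apply/funext => x; rewrite expr2.
  + do 2?[apply: bounded_measM].
    * by apply: bounded_meas_comp => //; meas.
    * by apply: bounded_meas_comp => //; meas.
    * apply: (@bounded_meas_comp _ _ _ _ _ snd (tri_mean F s hb)); last by meas.
      exact: bounded_meas_tri_mean.
  + by move=> v; do 2!apply: mulr_ge0 => //; exact: tri_mean_ge0.
  + by rewrite /= inE andbT eqSS.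
  + by rewrite !inE ?eqSS !(neq_rewrite ua, neq_rewrite ja).
  + by rewrite !inE ?eqSS !(neq_rewrite ub, neq_rewrite jb).
  + exact: bounded_meas_hbtri.
  + by move=> x y z; exact: hbtri_ge0.
- by repeat bm1.
- by move=> v; repeat first [exact: tri_ge0 | apply: mulr_ge0 | done].
- by meas.
- by rewrite /= inE andbT eqSS.
- by rewrite !inE ?eqSS !(neq_rewrite bc, neq_rewrite ac, neq_rewrite uc, neq_rewrite jc).
- by rewrite !inE ?eqSS !(neq_rewrite be, neq_rewrite ae, neq_rewrite ue, neq_rewrite je).
- exact: bounded_meas_hbtri.
- by move=> x y z; exact: hbtri_ge0.
Qed.

(** Vertex-disjoint triangles share no weight, so the expectation factors completely and such pairs
    have no covariance. *)
Lemma mean_disjoint (u a b v c e : 'I_n) :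
    uniq [:: j; u.+1; a.+1; b.+1; v.+1; c.+1; e.+1] ->
  mean P (fun w => tri_ind w u a b * tri_ind w v c e *
    (h (W j w) * (hb (W u.+1 w) * (hb (W a.+1 w) * hb (W b.+1 w))) *
      (hb (W v.+1 w) * (hb (W c.+1 w) * hb (W e.+1 w))))) =
  mean F h * tri_total F s hb ^+ 2.
Proof.
move=> U; have := U; rewrite /= !inE !negb_or !eqSS.
move=> /and5P[/and5P[ju ja jb jv /andP[jc je]] /and5P[ua ub uv uc ue]
  /and4P[ab av ac ae] /and3P[bv bc be] /and3P[/andP[vc ve] ce _]].
pose H w := h (W j w) * (hb (W u.+1 w) * (hb (W a.+1 w) * hb (W b.+1 w))) *
      (hb (W v.+1 w) * (hb (W c.+1 w) * hb (W e.+1 w))).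
pose l := [:: (u, a); (a, b); (u, b); (v, c); (c, e); (v, e)].
transitivity (mean P (fun w => \prod_(e <- l) (E w e.1 e.2)%:R * H w)).
  by apply: eq_mean => w; rewrite !big_cons big_nil /H /tri_ind /=; ring.
rewrite (mean_edges W_ge0 E_graph s_gt0); last 5 first.
- by rewrite /= ua ab ub vc ce ve.
- apply: uniq_sort_disjoint.
  by rewrite /= !inE !negb_or ua ub uv uc ue ab av ac ae bv bc be vc ve ce.
- do 2!(apply: bounded_measM; last by
    apply: bounded_measM; [exact: bW | apply: bounded_measM; exact: bW]).
  exact: bW.
- by move=> w; rewrite !mulr_ge0.
- do 2!(apply: vertex_measurableM; last by apply: vertex_measurableM;
    [exact: vW | apply: vertex_measurableM; exact: vW]).
  exact: vh.
have ind2 : indep_from W (fun w => (tt, W j w, W u.+1 w)) [:: u.+1; j].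
  by apply: (indep_from_pair W_iid ind1); rewrite inE eq_sym.
have ind3 : indep_from W (fun w => (tt, W j w, W u.+1 w, W a.+1 w))
    [:: a.+1; u.+1; j].
  apply: (indep_from_pair W_iid ind2).
  by rewrite !inE ?eqSS !(neq_rewrite ua, neq_rewrite ja).
have ind4 : indep_from W (fun w => (tt, W j w, W u.+1 w, W a.+1 w, W b.+1 w))
    [:: b.+1; a.+1; u.+1; j].
  apply: (indep_from_pair W_iid ind3).
  by rewrite !inE ?eqSS !(neq_rewrite ab, neq_rewrite ub, neq_rewrite jb).
transitivity (mean P (fun w => h (W j w) * (hb (W u.+1 w) *
    (hb (W a.+1 w) * hb (W b.+1 w) * tri s (W u.+1 w) (W a.+1 w) (W b.+1 w))) *
    (hb (W v.+1 w) * (hb (W c.+1 w) * hb (W e.+1 w) *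
      tri s (W v.+1 w) (W c.+1 w) (W e.+1 w))))).
  apply: eq_mean => w; rewrite !big_cons big_nil /H /tri /=; ring.
rewrite (mean_peel3 W_iid (A := fun v => h v.1.1.1.2 * (hb v.1.1.2 *
    (hb v.1.2 * hb v.2 * tri s v.1.1.2 v.1.2 v.2))) (r := fun v => v.1.1.2)
  (k := fun _ x y z => hb x * (hb y * hb z * tri s x y z)) ind4).
- have innerE : mean F (fun x => mean F (fun y => mean F (fun z =>
      hb x * (hb y * hb z * tri s x y z)))) = tri_total F s hb.
    apply: eq_mean => x; rewrite /tri_mean -meanZ.
      apply: eq_mean => y; rewrite -meanZ//; apply: bounded_integ.
      exact: (bounded_meas_fin (x, y) (bounded_meas_hbtri s_gt0 bhb)).
    apply: bounded_integ.
    exact: (bounded_meas_fin x (bounded_meas_tri_mean1 F s_gt0 bhb hb0)).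
  transitivity (mean P (fun w => tri_total F s hb * (h (W j w) * hb (W u.+1 w) *
      (hb (W a.+1 w) * hb (W b.+1 w) * tri s (W u.+1 w) (W a.+1 w) (W b.+1 w))))).
    by apply: eq_mean => w; rewrite [X in _ * X]innerE /=; ring.
  rewrite meanZ; last first.
    by apply: bounded_integ; repeat first [bm1 | exact: bW | exact: measurable_weight].
  rewrite (mean_peel2 W_iid ind2 (A := fun v => h v.1.2 * hb v.2)
    _ _ measurable_snd (k := fun x y z => hb y * hb z * tri s x y z)).
  + rewrite expr2 mulrCA; congr (_ * _).
    rewrite -(mean_final (k := u.+1)) => [|||x]; last 1 first.
    * by rewrite mulr_ge0// tri_mean_ge0.
    * by apply: eq_mean => w; rewrite -/(tri_mean F s hb _) /=; ring.
    * by rewrite eq_sym.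
    * by apply: bounded_measM => //; exact: bounded_meas_tri_mean.
  + by apply: bounded_measM; apply: bounded_meas_comp => //; meas.
  + by move=> z; rewrite mulr_ge0.
  + by rewrite /= inE andbT eqSS.
  + by rewrite !inE ?eqSS !(neq_rewrite ua, neq_rewrite ja).
  + by rewrite !inE ?eqSS !(neq_rewrite ub, neq_rewrite jb).
  + exact: bounded_meas_hbtri.
  + by move=> x y z; exact: hbtri_ge0.
- by repeat bm1.
- by move=> z; repeat first [exact: tri_ge0 | apply: mulr_ge0 | done].
- by meas.
- by rewrite /= !inE !eqSS !(neq_rewrite ju, neq_rewrite ja, neq_rewrite jb,
    neq_rewrite jv, neq_rewrite jc, neq_rewrite je, neq_rewrite ua,
    neq_rewrite ub, neq_rewrite uc, neq_rewrite ue, neq_rewrite ab,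
    neq_rewrite ac, neq_rewrite ae, neq_rewrite bc, neq_rewrite be,
    neq_rewrite ce, neq_rewrite uv, neq_rewrite av, neq_rewrite bv,
    neq_rewrite vc, neq_rewrite ve).
- by repeat bm1.
- by move=> ? x y z; repeat first [exact: tri_ge0 | apply: mulr_ge0 | done].
Qed.

(** This serves the pairs of triangles with a common edge, of which only the four outer edges will
    be kept. *)
Lemma mean_cycle4 (u a b c : 'I_n) : uniq [:: j; u.+1; a.+1; b.+1; c.+1] ->
  mean P (fun w => (E w u a)%:R * (E w a b)%:R * (E w b c)%:R * (E w c u)%:R *
    (h (W j w) * g (W u.+1 w))) =
  mean F h * mean F (fun x => g x * cycle4_mean F s x).
Proof.
move=> U; have := U; rewrite /= !inE !negb_or !eqSS.
move=> /and5P[/and4P[ju ja jb jc] /and3P[ua ub uc] /andP[ab ac] bc _].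
pose H w := h (W j w) * g (W u.+1 w).
pose l := [:: (u, a); (a, b); (b, c); (c, u)].
transitivity (mean P (fun w => \prod_(e <- l) (E w e.1 e.2)%:R * H w)).
  by apply: eq_mean => w; rewrite !big_cons big_nil /H /=; ring.
rewrite (mean_edges W_ge0 E_graph s_gt0); last 5 first.
- by rewrite /= ua ab bc eq_sym uc.
- by apply: uniq_sort_cycle4; rewrite /= !inE !negb_or ua ub uc ab ac bc.
- by apply: bounded_measM; exact: bW.
- by move=> w; rewrite !mulr_ge0.
- by apply: vertex_measurableM => //; exact: vW.
have ind2 : indep_from W (fun w => (tt, W j w, W u.+1 w)) [:: u.+1; j].
  by apply: (indep_from_pair W_iid ind1); rewrite inE eq_sym.
transitivity (mean P (fun w => h (W j w) * g (W u.+1 w) *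
    cycle4 s (W u.+1 w) (W a.+1 w) (W b.+1 w) (W c.+1 w))).
  apply: eq_mean => w; rewrite !big_cons big_nil /H /cycle4 /=; ring.
rewrite (mean_peel3 W_iid (A := fun v => h v.1.2 * g v.2) (r := snd)
  (k := fun x y z t => cycle4 s x y z t) ind2).
- rewrite -(mean_final (k := u.+1)) => [|||x]; last 1 first.
  + by rewrite mulr_ge0// cycle4_mean_ge0.
  + by apply: eq_mean => w; rewrite -/(cycle4_mean F s _) /=; ring.
  + by rewrite eq_sym.
  + by apply: bounded_measM => //; exact: bounded_meas_cycle4_mean.
- by apply: bounded_measM; apply: bounded_meas_comp => //; meas.
- by move=> z; rewrite mulr_ge0.
- by meas.
- by rewrite /= !inE !eqSS !(neq_rewrite ju, neq_rewrite ja, neq_rewrite jb,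
    neq_rewrite jc, neq_rewrite ua, neq_rewrite ub, neq_rewrite uc,
    neq_rewrite ab, neq_rewrite ac, neq_rewrite bc).
- exact: bounded_meas_cycle4_full.
- by move=> ? x y z; exact: cycle4_ge0.
Qed.

End identities.

(** * Pairs of three-element sets of vertices, by the size of their intersection *)

Section finite_sets.
Local Open Scope set_scope.

Section sets_of_card3.
Variable n : nat.
Implicit Types (t : {set 'I_n}) (u : 'I_n).

Lemma card3_mem t u : #|t| = 3%N -> u \in t ->
  exists a b, uniq [:: u; a; b] /\ t = [set u; a; b].
Proof.
move=> t3 ut.
have /cards2P[a [b [ab tE]]] : #|t :\ u| == 2%N.
  by move/eqP: t3; rewrite (cardsD1 u) ut add1n eqSS.
exists a, b.
have : a \in t :\ u by rewrite tE !inE eqxx.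
have : b \in t :\ u by rewrite tE !inE eqxx orbT.
rewrite !inE => /andP[bu _] /andP[au _]; split.
  by rewrite /= !inE negb_or eq_sym au eq_sym bu ab.
by rewrite -(finset.setD1K ut) tE finset.setUA.
Qed.

(** The labelling starts at the common vertex, whose weight is the one conditioned on in the moment
    computation. It also parametrises these pairs by five vertices. *)
Lemma inter1_card3 t t' u : #|t| = 3%N -> #|t'| = 3%N -> #|t :&: t'| = 1%N ->
    u \in t -> u \in t' ->
  exists a b c e, [/\ uniq [:: u; a; b; c; e], t = [set u; a; b] &
    t' = [set u; c; e]].
Proof.
move=> t3 t3' i1 ut ut'.
have [a [b [uab tE]]] := card3_mem t3 ut.
have [c [e [uce tE']]] := card3_mem t3' ut'.
exists a, b, c, e; split => //.
have iE : t :&: t' = [set u].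
  apply/eqP; rewrite eq_sym eqEcard i1 cards1 andbT.
  by apply/fintype.subsetP => x; rewrite !inE => /eqP ->; rewrite ut ut'.
have only x : x \in t -> x \in t' -> x = u.
  by move=> xt xt'; apply/set1P; rewrite -iE inE xt.
move: uab uce; rewrite /= !inE !negb_or !andbT.
move=> /andP[/andP[ua ub] ab] /andP[/andP[uc ue] ce].
rewrite ua ub uc ue ab ce /= !andbT.
have ne x y : x \in t -> u != x -> y \in t' -> x != y.
  move=> xt ux yt'; apply/eqP => xy; move: ux; rewrite (only x) ?eqxx//.
  by rewrite xy.
have at_ : a \in t by rewrite tE !inE eqxx orbT.
have bt : b \in t by rewrite tE !inE eqxx orbT.
have ct' : c \in t' by rewrite tE' !inE eqxx orbT.
have et' : e \in t' by rewrite tE' !inE eqxx orbT.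
by rewrite (ne a c) ?(ne a e) ?(ne b c) ?(ne b e).
Qed.

Lemma inter2_card3 t t' u : #|t| = 3%N -> #|t'| = 3%N -> #|t :&: t'| = 2%N ->
    u \in t -> u \in t' ->
  exists a x y, [/\ uniq [:: u; a; x; y], t = [set u; a; x] &
    t' = [set u; a; y]].
Proof.
move=> t3 t3' i2 ut ut'.
have uI : u \in t :&: t' by rewrite inE ut.
have : #|(t :&: t') :\ u| == 1%N by move/eqP: i2; rewrite (cardsD1 u) uI add1n eqSS.
move=> /cards1P[a aE].
have : a \in (t :&: t') :\ u by rewrite aE inE.
rewrite !inE => /and3P[au at_ at'].
have part (r : {set 'I_n}) : #|r| = 3%N -> u \in r -> a \in r ->
    exists x, uniq [:: u; a; x] /\ r = [set u; a; x].
  move=> r3 ur ar; have [b [c [ubc rE]]] := card3_mem r3 ur.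
  move: ubc; rewrite /= !inE negb_or !andbT => /andP[/andP[ub uc] bc].
  move: ar; rewrite rE !inE (negbTE au) /= => /orP[] /eqP ab.
    by exists c; subst b; rewrite /= !inE negb_or ub uc bc.
  exists b; subst c; split; first by rewrite /= !inE negb_or ub uc eq_sym bc.
  by rewrite finset.setUAC.
have [x [Ux tE]] := part t t3 ut at_.
have [y [Uy tE']] := part t' t3' ut' at'.
have U : uniq [:: u; a; x; y].
  move: Ux Uy; rewrite /= !inE !negb_or !andbT.
  move=> /andP[/andP[ua ux] ax] /andP[/andP[_ uy] ay]; rewrite ua ux ax uy ay /=.
  apply/eqP => xy; move: t3 i2; rewrite tE' -xy -tE finset.setIid => ->.
  by [].
by exists a, x, y.
Qed.

Lemma set3_mem u a b x : (x \in [set u; a; b]) = (x \in [:: u; a; b]).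
Proof. by rewrite !inE orbA. Qed.

End sets_of_card3.

Definition card3_sets n : {set {set 'I_n}} := [set t : {set 'I_n} | #|t| == 3%N].

Definition is_triangle n (e : rel 'I_n) (t : {set 'I_n}) :=
  [forall i in t, forall j in t, (i != j) ==> e i j].

Lemma triangles_sum (R : realType) n (e : rel 'I_n) :
  (triangles e)%:R = \sum_(t in card3_sets n) (is_triangle e t)%:R :> R.
Proof.
rewrite -natr_sum -big_mkcondr /= sum1_card; congr (_%:R).
by apply: eq_card => t; rewrite !inE /is_triangle unfold_in /= inE.
Qed.

(** Every such pair is the image of a list of five vertices that begins with the common one. The
    other cardinality bounds follow the same pattern. *)
Lemma card_pairs_inter1 n :
  (#|[set p : {set 'I_n} * {set 'I_n} | [&& #|p.1| == 3%N, #|p.2| == 3%N &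
     #|p.1 :&: p.2| == 1%N]]| <= n ^ 5)%N.
Proof.
pose f (v : 'I_n * 'I_n * 'I_n * 'I_n * 'I_n) :=
  ([set v.1.1.1.1; v.1.1.1.2; v.1.1.2], [set v.1.1.1.1; v.1.2; v.2]).
have -> : (n ^ 5 = #|{: 'I_n * 'I_n * 'I_n * 'I_n * 'I_n}|)%N.
  by rewrite !card_prod !card_ord !expnS expn0 muln1 !mulnA.
rewrite -finset.cardsT (leq_trans _ (leq_imset_card f _))// subset_leq_card//.
apply/fintype.subsetP => -[t t']; rewrite inE /= => /and3P[/eqP t3 /eqP t3' /eqP i1].
have /card_gt0P[u] : (0 < #|t :&: t'|)%N by rewrite i1.
rewrite inE => /andP[ut ut'].
have [a [b [c [e [_ -> ->]]]]] := inter1_card3 t3 t3' i1 ut ut'.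
by apply/imsetP; exists (u, a, b, c, e).
Qed.

Lemma card_pairs_inter2 n :
  (#|[set p : {set 'I_n} * {set 'I_n} | [&& #|p.1| == 3%N, #|p.2| == 3%N &
     #|p.1 :&: p.2| == 2%N]]| <= n ^ 4)%N.
Proof.
pose f (v : 'I_n * 'I_n * 'I_n * 'I_n) :=
  ([set v.1.1.1; v.1.1.2; v.1.2], [set v.1.1.1; v.1.1.2; v.2]).
have -> : (n ^ 4 = #|{: 'I_n * 'I_n * 'I_n * 'I_n}|)%N.
  by rewrite !card_prod !card_ord !expnS expn0 muln1 !mulnA.
rewrite -finset.cardsT (leq_trans _ (leq_imset_card f _))// subset_leq_card//.
apply/fintype.subsetP => -[t t']; rewrite inE /= => /and3P[/eqP t3 /eqP t3' /eqP i2].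
have /card_gt0P[u] : (0 < #|t :&: t'|)%N by rewrite i2.
rewrite inE => /andP[ut ut'].
have [a [x [y [_ -> ->]]]] := inter2_card3 t3 t3' i2 ut ut'.
by apply/imsetP; exists (u, a, x, y).
Qed.

Lemma card_pairs_inter2_at n (u : 'I_n) :
  (#|[set p : {set 'I_n} * {set 'I_n} | [&& u \in p.1, u \in p.2, #|p.1| == 3%N,
     #|p.2| == 3%N & #|p.1 :&: p.2| == 2%N]]| <= n ^ 3)%N.
Proof.
pose f (v : 'I_n * 'I_n * 'I_n) := ([set u; v.1.1; v.1.2], [set u; v.1.1; v.2]).
have -> : (n ^ 3 = #|{: 'I_n * 'I_n * 'I_n}|)%N.
  by rewrite !card_prod !card_ord !expnS expn0 muln1 !mulnA.
rewrite -finset.cardsT (leq_trans _ (leq_imset_card f _))// subset_leq_card//.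
apply/fintype.subsetP => -[t t']; rewrite inE /= => /and5P[ut ut' /eqP t3 /eqP t3' /eqP i2].
have [a [x [y [_ -> ->]]]] := inter2_card3 t3 t3' i2 ut ut'.
by apply/imsetP; exists (a, x, y).
Qed.

Lemma inter3_card3 n (t t' : {set 'I_n}) :
  #|t| = 3%N -> #|t'| = 3%N -> #|t :&: t'| = 3%N -> t = t'.
Proof.
move=> t3 t3' i3.
have e1 : t :&: t' = t by apply/eqP; rewrite eqEcard finset.subsetIl t3 i3.
have e2 : t :&: t' = t' by apply/eqP; rewrite eqEcard finset.subsetIr t3' i3.
by rewrite -e1 e2.
Qed.

Lemma card_card3_sets n : (#|card3_sets n| <= n ^ 3)%N.
Proof.
pose f (v : 'I_n * 'I_n * 'I_n) := [set v.1.1; v.1.2; v.2].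
have -> : (n ^ 3 = #|{: 'I_n * 'I_n * 'I_n}|)%N.
  by rewrite !card_prod !card_ord !expnS expn0 muln1 !mulnA.
rewrite -finset.cardsT (leq_trans _ (leq_imset_card f _))// subset_leq_card//.
apply/fintype.subsetP => t; rewrite inE => /eqP t3.
have /card_gt0P[u ut] : (0 < #|t|)%N by rewrite t3.
have [a [b [_ ->]]] := card3_mem t3 ut.
by apply/imsetP; exists (u, a, b).
Qed.

Lemma card_card3_sets_at n (u : 'I_n) :
  (#|[set t in card3_sets n | u \in t]| <= n ^ 2)%N.
Proof.
pose f (v : 'I_n * 'I_n) := [set u; v.1; v.2].
have -> : (n ^ 2 = #|{: 'I_n * 'I_n}|)%N by rewrite !card_prod !card_ord.
rewrite -finset.cardsT (leq_trans _ (leq_imset_card f _))// subset_leq_card//.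
apply/fintype.subsetP => t; rewrite !inE => /andP[/eqP t3 ut].
have [a [b [_ ->]]] := card3_mem t3 ut.
by apply/imsetP; exists (a, b).
Qed.

End finite_sets.

Section second_moments.
Context d (T : measurableType d) (R : realType) (P : probability T R).
Variables (W : nat -> {RV P >-> R}) (n : nat) (E : T -> rel 'I_n).
Hypothesis W_iid : iid W.
Hypothesis W_ge0 : forall k w, 0 <= W k w.
Hypothesis E_graph : weighted_random_graph W E.
Local Notation s := (mean_weight W * n%:R).
Hypothesis s_gt0 : 0 < s.
Local Notation F := (distribution P (W 0%N) : probability R R).

(** With [hb = 1] this is the indicator of a triangle on [t]; with [hb = trunc b] it also requires
    the three weights to be at most [b]. *)
Definition tri_wt (hb : R -> R) (t : {set 'I_n}) (w : T) : R :=
  (is_triangle (E w) t)%:R * \prod_(i in t) hb (W i.+1 w).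

Lemma is_triangle3 w u a b : uniq [:: u; a; b] ->
  (is_triangle (E w) [set u; a; b]%SET)%:R = tri_ind R E w u a b.
Proof.
rewrite /= !inE negb_or andbT => /andP[/andP[ua ub] ab].
have [sE _ _ _] := E_graph.
rewrite /tri_ind -!natrM !mulnb; congr (nat_of_bool _)%:R.
apply/forall_inP/andP => [H|[/andP[Eua Eab] Eub] i].
  have mem (x : 'I_n) : x \in [:: u; a; b] -> x \in [set u; a; b]%SET.
    by rewrite set3_mem.
  have edge x y : x \in [:: u; a; b] -> y \in [:: u; a; b] -> x != y -> E w x y.
    by move=> xt yt; apply/implyP; have /forall_inP := H x (mem _ xt); apply; exact: mem.
  by rewrite !edge// !inE eqxx ?orbT.
rewrite set3_mem !inE => it; apply/forall_inP => k.
rewrite set3_mem !inE => kt; apply/implyP.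
case/or3P: it => /eqP->; case/or3P: kt => /eqP->; rewrite ?eqxx//= => _;
  by rewrite // sE.
Qed.

Lemma tri_wt3 hb w u a b : uniq [:: u; a; b] ->
  tri_wt hb [set u; a; b]%SET w =
  tri_ind R E w u a b * (hb (W u.+1 w) * (hb (W a.+1 w) * hb (W b.+1 w))).
Proof.
move=> U; rewrite /tri_wt is_triangle3//; congr (_ * _).
rewrite (eq_bigl (mem [:: u; a; b])); last by move=> x; exact: set3_mem.
by rewrite -big_uniq//= !big_cons big_nil mulr1.
Qed.

Lemma bounded_meas_tri_ind u a b : bounded_meas (fun w => tri_ind R E w u a b).
Proof.
have bE x y := bounded_meas_edge E_graph x y.
by apply: bounded_measM => //; exact: bounded_measM.
Qed.

Lemma bounded_meas_weight (f : R -> R) k : bounded_meas f ->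
  bounded_meas (fun w => f (W k w)).
Proof. by move=> bf; apply: bounded_meas_comp => //; exact: measurable_weight. Qed.

Implicit Types t : {set 'I_n}.

Variables (h g hb : R -> R) (j : nat).
Hypotheses (bh : bounded_meas h) (h0 : forall x, 0 <= h x).
Hypotheses (bg : bounded_meas g) (g0 : forall x, 0 <= g x).
Hypotheses (bhb : bounded_meas hb) (hb0 : forall x, 0 <= hb x).
Hypothesis hb1 : forall x, hb x <= 1.
Hypothesis vh : vertex_measurable W n (fun w => h (W j w)).

Lemma tri_wt_ge0 t w : 0 <= tri_wt hb t w.
Proof. by rewrite mulr_ge0// prodr_ge0. Qed.

Lemma tri_wt_le1 t w : tri_wt hb t w <= 1.
Proof.
rewrite mulr_ile1 ?prodr_ge0//; last by rewrite prodr_ile1// => i _; rewrite hb0 hb1.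
by rewrite lern1 leq_b1.
Qed.

Lemma bounded_meas_tri_wt t : #|t| = 3%N -> bounded_meas (tri_wt hb t).
Proof.
move=> t3; have /card_gt0P[u ut] : (0 < #|t|)%N by rewrite t3.
have [a [b [U ->]]] := card3_mem t3 ut.
rewrite (_ : tri_wt _ _ = fun w => tri_ind R E w u a b *
  (hb (W u.+1 w) * (hb (W a.+1 w) * hb (W b.+1 w)))); last first.
  by apply/funext => w; exact: tri_wt3.
apply: bounded_measM; first exact: bounded_meas_tri_ind.
by do 2?[apply: bounded_measM]; exact: bounded_meas_weight.
Qed.

Lemma mean_tri_wt t u : #|t| = 3%N -> u \in t ->
    (forall i : 'I_n, i \in t -> j != i.+1) ->
  mean P (fun w => h (W j w) * g (W u.+1 w) * tri_wt hb t w) =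
  mean F h * mean F (fun x => g x * hb x * tri_mean F s hb x).
Proof.
move=> t3 ut jt; have [a [b [U tE]]] := card3_mem t3 ut.
rewrite -(mean_triangle W_iid W_ge0 E_graph s_gt0 bh h0 (g := fun x => g x * hb x)
  _ _ bhb hb0 vh (u := u) (a := a) (b := b)).
- by apply: eq_mean => w; rewrite tE tri_wt3//; ring.
- exact: bounded_measM.
- by move=> x; rewrite mulr_ge0.
- move: U; rewrite /= !inE !negb_or !eqSS => ->.
  by rewrite !jt// tE set3_mem !inE eqxx ?orbT.
Qed.

Lemma mean_pair_inter1 t t' u : #|t| = 3%N -> #|t'| = 3%N -> #|t :&: t'|%SET = 1%N ->
    u \in t -> u \in t' -> (forall i : 'I_n, i \in (t :|: t')%SET -> j != i.+1) ->
  mean P (fun w => h (W j w) * g (W u.+1 w) * (tri_wt hb t w * tri_wt hb t' w)) =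
  mean F h * mean F (fun x => g x * (hb x * hb x) * tri_mean F s hb x ^+ 2).
Proof.
move=> t3 t3' i1 ut ut' jt.
have [a [b [c [e [U tE tE']]]]] := inter1_card3 t3 t3' i1 ut ut'.
have [Uab Uce] : uniq [:: u; a; b] /\ uniq [:: u; c; e].
  move: U; rewrite /= !inE !negb_or !andbT.
  by move=> /and4P[/and4P[-> -> -> ->] /and3P[-> _ _] /andP[_ _] ->].
rewrite -(mean_bowtie W_iid W_ge0 E_graph s_gt0 bh h0
  (g := fun x => g x * (hb x * hb x)) _ _ bhb hb0 vh (u := u) (a := a) (b := b)
  (c := c) (e := e)).
- by apply: eq_mean => w; rewrite tE tE' !tri_wt3//; ring.
- by apply: bounded_measM => //; exact: bounded_measM.
- by move=> x; rewrite !mulr_ge0.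
- move: U; rewrite /= !inE !negb_or !eqSS => ->; rewrite andbT.
  by rewrite !jt// tE tE' finset.in_setU !set3_mem !inE eqxx ?orbT.
Qed.

Lemma mean_pair_inter0 t t' : #|t| = 3%N -> #|t'| = 3%N -> #|t :&: t'|%SET = 0%N ->
    (forall i : 'I_n, i \in (t :|: t')%SET -> j != i.+1) ->
  mean P (fun w => h (W j w) * (tri_wt hb t w * tri_wt hb t' w)) =
  mean F h * tri_total F s hb ^+ 2.
Proof.
move=> t3 t3' i0 jt.
have /card_gt0P[u ut] : (0 < #|t|)%N by rewrite t3.
have /card_gt0P[v vt] : (0 < #|t'|)%N by rewrite t3'.
have [a [b [U tE]]] := card3_mem t3 ut.
have [c [e [V tE']]] := card3_mem t3' vt.
have dis x y : x \in t -> y \in t' -> x != y.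
  move=> xt yt; apply/eqP => xy; move/eqP: i0; rewrite finset.cards_eq0.
  by apply/negP/finset.set0Pn; exists x; rewrite finset.in_setI xt xy.
rewrite -(mean_disjoint W_iid W_ge0 E_graph s_gt0 bh h0 bhb hb0 vh (u := u)
  (a := a) (b := b) (v := v) (c := c) (e := e)).
- by apply: eq_mean => w; rewrite tE tE' !tri_wt3//; ring.
- have mt x : x \in [:: u; a; b] -> x \in t by rewrite tE set3_mem.
  have mt' x : x \in [:: v; c; e] -> x \in t' by rewrite tE' set3_mem.
  have [u_ a_ b_] : [/\ u \in t, a \in t & b \in t].
    by rewrite !mt// !inE eqxx ?orbT.
  have [v_ c_ e_] : [/\ v \in t', c \in t' & e \in t'].
    by rewrite !mt'// !inE eqxx ?orbT.
  move: U V; rewrite /= !inE !negb_or !eqSS !andbT.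
  move=> /andP[/andP[-> ->] ->] /andP[/andP[-> ->] ->].
  rewrite (dis u v)// (dis u c)// (dis u e)// (dis a v)// (dis a c)// (dis a e)//.
  rewrite (dis b v)// (dis b c)// (dis b e)//.
  by rewrite !jt// finset.in_setU ?u_ ?a_ ?b_ ?v_ ?c_ ?e_ ?orbT.
Qed.

(** Discarding the common edge [u a] and the factors [hb <= 1] leaves the 4-cycle through [u], [x],
    [a], [y]. *)
Lemma mean_pair_inter2 t t' u : #|t| = 3%N -> #|t'| = 3%N -> #|t :&: t'|%SET = 2%N ->
    u \in t -> u \in t' -> (forall i : 'I_n, i \in (t :|: t')%SET -> j != i.+1) ->
  mean P (fun w => h (W j w) * g (W u.+1 w) * (tri_wt hb t w * tri_wt hb t' w)) <=
  mean F h * mean F (fun x => g x * cycle4_mean F s x).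
Proof.
move=> t3 t3' i2 ut ut' jt.
have [a [x [y [U tE tE']]]] := inter2_card3 t3 t3' i2 ut ut'.
have [Uax Uay] : uniq [:: u; a; x] /\ uniq [:: u; a; y].
  move: U; rewrite /= !inE !negb_or !andbT.
  by move=> /and3P[/and3P[-> -> ->] /andP[-> ->] _].
have U' : uniq [:: u; x; a; y].
  move: U; rewrite /= !inE !negb_or !andbT [x == a]eq_sym.
  by move=> /and3P[/and3P[-> -> ->] /andP[-> ->] ->].
rewrite -(mean_cycle4 W_iid W_ge0 E_graph s_gt0 bh h0 bg g0 vh (u := u)
  (a := x) (b := a) (c := y)); last first.
  move: U'; rewrite /= !inE !negb_or !eqSS => ->; rewrite andbT.
  by rewrite !jt// tE tE' finset.in_setU !set3_mem !inE eqxx ?orbT.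
apply: mean_le.
- apply: bounded_integ; apply: bounded_measM.
    by apply: bounded_measM; exact: bounded_meas_weight.
  by apply: bounded_measM; exact: bounded_meas_tri_wt.
- apply: bounded_integ; apply: bounded_measM.
    have bE k l := bounded_meas_edge E_graph k l.
    by do 2!apply: bounded_measM => //; exact: bounded_measM.
  by apply: bounded_measM; exact: bounded_meas_weight.
move=> w; rewrite mulrC; apply: ler_wpM2r; first by rewrite mulr_ge0.
have [sE _ _ _] := E_graph.
rewrite tE tE' /tri_wt !is_triangle3// /tri_ind [E w a x]sE [E w y u]sE.
set A := \prod_(i in _) _; set B := \prod_(i in _) _.
have A01 : 0 <= A <= 1.
  by rewrite /A prodr_ge0//= prodr_ile1// => i _; rewrite hb0 hb1.
have B01 : 0 <= B <= 1.
  by rewrite /B prodr_ge0//= prodr_ile1// => i _; rewrite hb0 hb1.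
case: (E w u x); rewrite ?(mul0r, mulr0) ?lexx//.
case: (E w x a); rewrite ?(mul0r, mulr0) ?lexx//.
case: (E w a y); rewrite ?(mul0r, mulr0) ?lexx//.
case: (E w u y); rewrite ?(mul0r, mulr0) ?lexx//.
rewrite !mulr1; case: (E w u a); rewrite ?(mul0r, mulr0) ?ler01//.
by rewrite !mul1r; move/andP: A01 => [? ?]; move/andP: B01 => [? ?]; exact: mulr_ile1.
Qed.

End second_moments.

(** * Second moments of triangle counts *)

(** The centring [c] may be random: a constant for the light triangles, the conditional mean given
    the weight of the centre for a star. When the square is expanded, the two mixed terms and the
    term in [c] leave [- m2], which cancels the [m2] in the bound for products, so only the excesses
    [r] survive. The weight [H] restricts to an event without being divided out. *)
Lemma mean_sqr_sum_le d (T : measurableType d) (R : realType)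
    (P : probability T R) (I : finType) (K : {set I}) (H c : T -> R)
    (X : I -> T -> R) (m2 : R) (r : I -> I -> R) :
  bounded_meas H -> bounded_meas c ->
  (forall t, t \in K -> bounded_meas (X t)) ->
  mean P (fun w => H w * (c w * c w)) = m2 ->
  (forall t, t \in K -> mean P (fun w => H w * (c w * X t w)) = m2) ->
  (forall t t', t \in K -> t' \in K ->
    mean P (fun w => H w * (X t w * X t' w)) <= m2 + r t t') ->
  mean P (fun w => H w * (\sum_(t in K) X t w - #|K|%:R * c w) ^+ 2) <=
    \sum_(t in K) \sum_(t' in K) r t t'.
Proof.
move=> bH bc bX0 mc mX mr.
(* Boundedness is assumed only on [K], while the sum rules ask for it at every index. *)
pose X' t := if t \in K then X t else fun=> 0.
have bX t : bounded_meas (X' t).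
  rewrite /X'; case: ifP => [/bX0//|_]; exact: bounded_meas_cst.
have X'E t w : t \in K -> X' t w = X t w by rewrite /X' => ->.
have -> : mean P (fun w => H w * (\sum_(t in K) X t w - #|K|%:R * c w) ^+ 2) =
    mean P (fun w => \sum_(t in K) \sum_(t' in K)
      H w * ((X' t w - c w) * (X' t' w - c w))).
  apply: eq_mean => w.
  have -> : \sum_(t in K) X t w - #|K|%:R * c w = \sum_(t in K) (X' t w - c w).
    rewrite sumrB sumr_const mulr_natl; congr (_ - _).
    by apply: eq_bigr => t tK; rewrite X'E.
  rewrite expr2 mulr_suml mulr_sumr; apply: eq_bigr => t _.
  by rewrite mulr_sumr mulr_sumr.
have bXc t : bounded_meas (fun w => X' t w - c w) by exact: bounded_measB.
have bt t t' : bounded_meas (fun w => H w * ((X' t w - c w) * (X' t' w - c w))).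
  by apply: bounded_measM => //; exact: bounded_measM.
rewrite mean_sum => [|t]; last exact: bounded_meas_sum.
apply: ler_sum => t tK; rewrite mean_sum//; apply: ler_sum => t' tK'.
have i1 : integ P (fun w => H w * (X' t w * X' t' w)).
  by apply: bounded_integ; apply: bounded_measM => //; exact: bounded_measM.
have i2 : integ P (fun w => H w * (c w * X' t w)).
  by apply: bounded_integ; apply: bounded_measM => //; exact: bounded_measM.
have i3 : integ P (fun w => H w * (c w * X' t' w)).
  by apply: bounded_integ; apply: bounded_measM => //; exact: bounded_measM.
have i4 : integ P (fun w => H w * (c w * c w)).
  by apply: bounded_integ; apply: bounded_measM => //; exact: bounded_measM.
have -> : mean P (fun w => H w * ((X' t w - c w) * (X' t' w - c w))) =
    mean P (fun w => H w * (X' t w * X' t' w)) - mean P (fun w => H w * (c w * X' t w))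
    - (mean P (fun w => H w * (c w * X' t' w)) - mean P (fun w => H w * (c w * c w))).
  rewrite -meanB// -meanB// -meanB.
  - by apply: eq_mean => w; ring.
  - apply: bounded_integ; apply: bounded_measB.
      by apply: bounded_measM => //; exact: bounded_measM.
    by apply: bounded_measM => //; exact: bounded_measM.
  - apply: bounded_integ; apply: bounded_measB.
      by apply: bounded_measM => //; exact: bounded_measM.
    by apply: bounded_measM => //; exact: bounded_measM.
have e1 : mean P (fun w => H w * (X' t w * X' t' w)) =
    mean P (fun w => H w * (X t w * X t' w)).
  by apply: eq_mean => w; rewrite !X'E.
have e2 u : u \in K -> mean P (fun w => H w * (c w * X' u w)) = m2.
  by move=> uK; rewrite -(mX u uK); apply: eq_mean => w; rewrite X'E.
by rewrite e1 !e2// mc subrr subr0 lerBlDl; exact: mr.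
Qed.

Lemma sum_pairs_indicator (R : realType) (I : finType) (K : {set I}) (A : R)
    (b : rel I) :
  \sum_(t in K) \sum_(t' in K) A * (b t t')%:R =
  A * #|[set p : I * I | [&& p.1 \in K, p.2 \in K & b p.1 p.2]]%SET|%:R.
Proof.
rewrite pair_big /= -sum1_card natr_sum mulr_sumr.
rewrite [RHS](eq_bigl (fun p => (p.1 \in K) && (p.2 \in K) && b p.1 p.2)).
  rewrite [RHS]big_mkcondr; apply: eq_bigr => p _.
  by case: (b _ _); rewrite ?mulr0.
by move=> p; rewrite inE andbA.
Qed.

Definition triples_in n (U : {set 'I_n}) : {set {set 'I_n}} :=
  [set t in card3_sets n | t \subset U]%SET.

Definition triples_at n (u : 'I_n) : {set {set 'I_n}} :=
  [set t in card3_sets n | u \in t]%SET.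

Section variances.
Context d (T : measurableType d) (R : realType) (P : probability T R).
Variables (W : nat -> {RV P >-> R}) (n : nat) (E : T -> rel 'I_n).
Hypothesis W_iid : iid W.
Hypothesis W_ge0 : forall k w, 0 <= W k w.
Hypothesis E_graph : weighted_random_graph W E.
Local Notation s := (mean_weight W * n%:R).
Hypothesis s_gt0 : 0 < s.
Local Notation F := (distribution P (W 0%N) : probability R R).

Let b01 := @bounded_meas_cst _ R R 1.
Let ge01 := fun _ : R => @ler01 R.

(** Disjoint triples contribute nothing. A single common vertex gives the first term (at most [n^5]
    pairs), a common edge the second (at most [n^4]), and equal triples the third. The factor
    [mean F h] comes out because [j] is not the index of a vertex of [U]. *)
Lemma variance_le (h hb : R -> R) (j : nat) (U : {set 'I_n}) :
    bounded_meas h -> (forall x, 0 <= h x) ->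
    bounded_meas hb -> (forall x, 0 <= hb x <= 1) ->
    vertex_measurable W n (fun w => h (W j w)) ->
    (forall i : 'I_n, i \in U -> j != i.+1) ->
  mean P (fun w => h (W j w) *
    (\sum_(t in triples_in U) tri_wt W E hb t w - #|triples_in U|%:R * tri_total F s hb) ^+ 2) <=
  mean F h * (n%:R ^+ 5 * mean F (fun x => hb x * tri_mean F s hb x ^+ 2) +
    n%:R ^+ 4 * mean F (cycle4_mean F s) + n%:R ^+ 3 * tri_total F s hb).
Proof.
move=> bh h0 bhb hb01 vh jU; set K := triples_in U.
have hb0 x : 0 <= hb x by case/andP: (hb01 x).
have hb1 x : hb x <= 1 by case/andP: (hb01 x).
have bhW : bounded_meas (fun w => h (W j w)).
  exact: (bounded_meas_weight _ j bh).
have EH0 : 0 <= mean F h by exact: mean_ge0.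
have bD : bounded_meas (tri_mean F s hb) by exact: bounded_meas_tri_mean.
have D0 x : 0 <= tri_mean F s hb x by exact: tri_mean_ge0.
have tau0 : 0 <= tri_total F s hb by apply: mean_ge0 => x; rewrite mulr_ge0.
have bD2 : bounded_meas (fun x => tri_mean F s hb x ^+ 2).
  by apply: bounded_measM.
pose A1 := mean F h * mean F (fun x => hb x * tri_mean F s hb x ^+ 2).
pose A2 := mean F h * mean F (cycle4_mean F s).
pose A3 := mean F h * tri_total F s hb.
have A10 : 0 <= A1.
  by apply: mulr_ge0 => //; apply: mean_ge0 => x; rewrite mulr_ge0// exprn_ge0.
have A20 : 0 <= A2.
  by apply: mulr_ge0 => //; apply: mean_ge0 => x; exact: cycle4_mean_ge0.
have A30 : 0 <= A3 by apply: mulr_ge0.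
pose r (t t' : {set 'I_n}) := A1 * (#|t :&: t'|%SET == 1%N)%:R +
  (A2 * (#|t :&: t'|%SET == 2%N)%:R + A3 * (#|t :&: t'|%SET == 3%N)%:R).
have KE t : t \in K -> [/\ #|t| = 3%N, t \subset U &
    forall i : 'I_n, i \in t -> j != i.+1].
  rewrite !inE => /andP[/eqP t3 tU]; split => // i it.
  by apply: jU; exact: (fintype.subsetP tU).
have KU t t' : t \in K -> t' \in K ->
    forall i : 'I_n, i \in (t :|: t')%SET -> j != i.+1.
  by move=> /KE[_ _ jt] /KE[_ _ jt'] i; rewrite finset.in_setU => /orP[/jt|/jt'].
have mt t : t \in K -> mean P (fun w => h (W j w) * tri_wt W E hb t w) =
    mean F h * tri_total F s hb.
  move=> /KE[t3 _ jt]; have /card_gt0P[u ut] : (0 < #|t|)%N by rewrite t3.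
  have := mean_tri_wt W_iid W_ge0 E_graph s_gt0 bh h0 b01 ge01 bhb hb0 vh t3 ut jt.
  have -> : mean F (fun x => 1 * hb x * tri_mean F s hb x) = tri_total F s hb.
    by apply: eq_mean => x /=; rewrite mul1r.
  by move=> <-; apply: eq_mean => w; rewrite mulr1.
apply: (@le_trans _ _ (\sum_(t in K) \sum_(t' in K) r t t')).
  apply: (@mean_sqr_sum_le _ _ _ _ _ _ (fun w => h (W j w))
    (fun=> tri_total F s hb) (tri_wt W E hb)
    (mean F h * (tri_total F s hb * tri_total F s hb))).
  - exact: bhW.
  - exact: bounded_meas_cst.
  - by move=> t /KE[t3 _ _]; exact: bounded_meas_tri_wt.
  - pose tt := tri_total F s hb * tri_total F s hb.
    transitivity (mean P (fun w => tt * h (W j w))).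
      by apply: eq_mean => w; rewrite mulrC.
    rewrite meanZ; last by apply: bounded_integ; exact: bhW.
    by rewrite (mean_weight_fun W_iid j bh h0) mulrC.
  - move=> t tK.
    transitivity (mean P (fun w => tri_total F s hb * (h (W j w) * tri_wt W E hb t w))).
      by apply: eq_mean => w; rewrite mulrCA.
    have [t3 _ _] := KE _ tK; rewrite meanZ ?mt//; first by rewrite mulrCA.
    apply: bounded_integ.
    by apply: bounded_measM; [exact: bhW|exact: bounded_meas_tri_wt].
  move=> t t' tK tK'; have [t3 _ jt] := KE _ tK; have [t3' _ jt'] := KE _ tK'.
  have jtt := KU _ _ tK tK'.
  have r0 : 0 <= r t t'.
    by apply: addr_ge0; [|apply: addr_ge0]; exact: mulr_ge0.
  have m0 : 0 <= mean F h * (tri_total F s hb * tri_total F s hb).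
    by apply: mulr_ge0 => //; exact: mulr_ge0.
  have mul1 (G : T -> R) :
      mean P (fun w => h (W j w) * G w) = mean P (fun w => h (W j w) * 1 * G w).
    by apply: eq_mean => w; rewrite mulr1.
  have [i0|i0] := eqVneq #|t :&: t'|%SET 0%N.
    rewrite (mean_pair_inter0 W_iid W_ge0 E_graph s_gt0 bh h0 bhb hb0 vh)//.
    by rewrite -expr2 lerDl.
  have /card_gt0P[u] : (0 < #|t :&: t'|%SET)%N by rewrite lt0n i0.
  rewrite finset.in_setI => /andP[ut ut'].
  (* For overlapping triples the product of the means is nonnegative and is given away; only
     disjoint triples need the exact cancellation. *)
  suff : mean P (fun w => h (W j w) * (tri_wt W E hb t w * tri_wt W E hb t' w)) <= r t t'.
    by move=> /le_trans; apply; rewrite lerDr.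
  have [i1|i1] := eqVneq #|t :&: t'|%SET 1%N.
    rewrite mul1 (mean_pair_inter1 W_iid W_ge0 E_graph s_gt0 bh h0 b01 ge01 bhb hb0
      vh t3 t3' i1 ut ut' jtt).
    rewrite /r i1 /= !mulr0 !addr0 mulr1 ler_wpM2l//; apply: mean_le.
    - apply: bounded_integ; apply: bounded_measM => //.
      by apply: bounded_measM => //; exact: bounded_measM.
    - by apply: bounded_integ; exact: bounded_measM.
    move=> x /=; rewrite mul1r ler_wpM2r ?exprn_ge0//.
    by rewrite ler_piMr.
  have [i2|i2] := eqVneq #|t :&: t'|%SET 2%N.
    rewrite mul1 (le_trans (mean_pair_inter2 W_iid W_ge0 E_graph s_gt0 bh h0 b01 ge01
      bhb hb0 hb1 vh t3 t3' i2 ut ut' jtt))//.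
    rewrite /r i2 /= !mulr0 !addr0 add0r mulr1 ler_wpM2l//.
    rewrite le_eqVlt; apply/orP; left; apply/eqP.
    by apply: eq_mean => x /=; rewrite mul1r.
  have i3 : #|t :&: t'|%SET = 3%N.
    have : (#|t :&: t'|%SET <= 3)%N.
      by rewrite -t3 subset_leq_card// finset.subsetIl.
    by move: i0 i1 i2; case: #|_|%SET => [|[|[|[|]]]].
  rewrite -(inter3_card3 t3 t3' i3) /r finset.setIid t3 /= !mulr0 !add0r mulr1.
  rewrite -[leRHS](mt t tK); apply: mean_le.
  - apply: bounded_integ; apply: bounded_measM; first exact: bhW.
    by apply: bounded_measM; exact: bounded_meas_tri_wt.
  - apply: bounded_integ; apply: bounded_measM; first exact: bhW.
    exact: bounded_meas_tri_wt.
  move=> w; rewrite ler_wpM2l// ler_piMr//; first exact: tri_wt_ge0.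
  exact: tri_wt_le1.
have -> : \sum_(t in K) \sum_(t' in K) r t t' =
    \sum_(t in K) \sum_(t' in K) A1 * (#|t :&: t'|%SET == 1%N)%:R +
    (\sum_(t in K) \sum_(t' in K) A2 * (#|t :&: t'|%SET == 2%N)%:R +
     \sum_(t in K) \sum_(t' in K) A3 * (#|t :&: t'|%SET == 3%N)%:R).
  rewrite -!big_split /=; apply: eq_bigr => t _.
  by rewrite -!big_split.
rewrite !sum_pairs_indicator.
have c1 := card_pairs_inter1 n; have c2 := card_pairs_inter2 n.
have c3 := card_card3_sets n.
rewrite 2!mulrDr -addrA; apply: lerD; last apply: lerD.
- rewrite mulrCA mulrC ler_wpM2r// -natrX ler_nat (leq_trans _ c1)//.
  apply: subset_leq_card; apply/fintype.subsetP => p; rewrite !inE.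
  by move=> /and3P[/andP[-> _] /andP[-> _] ->].
- rewrite mulrCA mulrC ler_wpM2r// -natrX ler_nat (leq_trans _ c2)//.
  apply: subset_leq_card; apply/fintype.subsetP => p; rewrite !inE.
  by move=> /and3P[/andP[-> _] /andP[-> _] ->].
- rewrite mulrCA mulrC ler_wpM2r// -natrX ler_nat (leq_trans _ c3)//.
  rewrite -(card_imset (mem (card3_sets n)) (f := fun t => (t, t))); last first.
    by move=> x y [].
  apply: subset_leq_card; apply/fintype.subsetP => -[p q]; rewrite !inE /=.
  move=> /and3P[/andP[/eqP p3 _] /andP[/eqP q3 _] /eqP i3].
  apply/imsetP; exists p; first by rewrite !inE p3.
  by rewrite (inter3_card3 p3 q3 i3).
Qed.

(** Two triangles at [u] with no other common vertex are independent given the weight of [u].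
    Centring at the conditional mean therefore removes all of these pairs, the most numerous ones,
    and leaves those that share an edge or coincide. *)
Lemma variance_at_le (g : R -> R) (u : 'I_n) :
    bounded_meas g -> (forall x, 0 <= g x) ->
  mean P (fun w => g (W u.+1 w) *
    (\sum_(t in triples_at u) tri_wt W E (fun=> 1) t w -
      #|triples_at u|%:R * tri_mean F s (fun=> 1) (W u.+1 w)) ^+ 2) <=
  n%:R ^+ 3 * mean F (fun x => g x * cycle4_mean F s x) +
  n%:R ^+ 2 * mean F (fun x => g x * tri_mean F s (fun=> 1) x).
Proof.
move=> bg g0; set K := triples_at u.
have bD : bounded_meas (tri_mean F s (fun=> 1)) by exact: bounded_meas_tri_mean.
have bgW : bounded_meas (fun w => g (W u.+1 w)).
  exact: (bounded_meas_weight _ u.+1 bg).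
have bDW : bounded_meas (fun w => tri_mean F s (fun=> 1) (W u.+1 w)).
  exact: (bounded_meas_weight _ u.+1 bD).
have D0 x : 0 <= tri_mean F s (fun=> 1) x by exact: tri_mean_ge0.
pose A2 := mean F (fun x => g x * cycle4_mean F s x).
pose A3 := mean F (fun x => g x * tri_mean F s (fun=> 1) x).
have A20 : 0 <= A2.
  by apply: mean_ge0 => x; rewrite mulr_ge0// cycle4_mean_ge0.
have A30 : 0 <= A3 by apply: mean_ge0 => x; rewrite mulr_ge0.
pose r (t t' : {set 'I_n}) :=
  A2 * (#|t :&: t'|%SET == 2%N)%:R + A3 * (#|t :&: t'|%SET == 3%N)%:R.
(* No outside vertex occurs here: the constant factor at index 0, which is not the index of any
   vertex, fills its place. *)
have v1 : vertex_measurable W n (fun w => (fun=> 1) (W 0%N w)).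
  exact: vertex_measurable_cst.
have KE t : t \in K -> #|t| = 3%N /\ u \in t by rewrite !inE => /andP[/eqP].
pose m2 := mean F (fun x => g x * (tri_mean F s (fun=> 1) x) ^+ 2).
have EH1 : mean F (fun=> 1) = 1 by exact: mean_cst.
have mt t (k : R -> R) : t \in K -> bounded_meas k -> (forall x, 0 <= k x) ->
    mean P (fun w => k (W u.+1 w) * tri_wt W E (fun=> 1) t w) =
    mean F (fun x => k x * tri_mean F s (fun=> 1) x).
  move=> /KE[t3 ut] bk k0.
  have := @mean_tri_wt _ _ _ _ _ _ _ W_iid W_ge0 E_graph s_gt0 _ _ _ 0%N
    b01 ge01 bk k0 b01 ge01 v1 _ _ t3 ut (fun _ _ => isT).
  rewrite EH1 mul1r => H.
  transitivity (mean F (fun x => k x * 1 * tri_mean F s (fun=> 1) x)).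
    by rewrite -H; apply: eq_mean => w /=; rewrite mul1r.
  by apply: eq_mean => x /=; rewrite mulr1.
apply: (@le_trans _ _ (\sum_(t in K) \sum_(t' in K) r t t')).
  apply: (@mean_sqr_sum_le _ _ _ _ _ _ (fun w => g (W u.+1 w))
    (fun w => tri_mean F s (fun=> 1) (W u.+1 w)) (tri_wt W E (fun=> 1)) m2).
  - exact: bgW.
  - exact: bDW.
  - by move=> t /KE[t3 _]; exact: bounded_meas_tri_wt.
  - rewrite /m2 -(mean_weight_fun W_iid u.+1 (f := fun x => g x * (tri_mean F s (fun=> 1) x) ^+ 2)).
    + by apply: eq_mean => w; rewrite expr2.
    + by apply: bounded_measM => //; apply: bounded_measM.
    + by move=> x; rewrite mulr_ge0// exprn_ge0.
  - move=> t tK; rewrite /m2.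
    transitivity (mean F (fun x => (g x * tri_mean F s (fun=> 1) x) * tri_mean F s (fun=> 1) x)).
      rewrite -(mt t (fun x => g x * tri_mean F s (fun=> 1) x))//.
      + by apply: eq_mean => w; rewrite mulrA.
      + exact: bounded_measM.
      + by move=> x; rewrite mulr_ge0.
    by apply: eq_mean => x; rewrite expr2 mulrA.
  move=> t t' tK tK'; have [t3 ut] := KE _ tK; have [t3' ut'] := KE _ tK'.
  have r0 : 0 <= r t t'.
    exact: (addr_ge0 (mulr_ge0 A20 (ler0n _ _)) (mulr_ge0 A30 (ler0n _ _))).
  have m0 : 0 <= m2 by apply: mean_ge0 => x; rewrite mulr_ge0// exprn_ge0.
  have mul1 (G : T -> R) :
      mean P (fun w => g (W u.+1 w) * G w) = mean P (fun w => 1 * g (W u.+1 w) * G w).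
    by apply: eq_mean => w /=; rewrite mul1r.
  have ij : (forall i : 'I_n, i \in (t :|: t')%SET -> 0%N != i.+1) by [].
  (* The triples meet in [u] alone: the mean equals [m2] exactly, so the excess may be any
     nonnegative number. An empty intersection cannot occur, since both triples contain [u]. *)
  have [i1|i1] := eqVneq #|t :&: t'|%SET 1%N.
    rewrite mul1 (@mean_pair_inter1 _ _ _ _ _ _ _ W_iid W_ge0 E_graph s_gt0 _ _ _ 0%N b01 ge01 bg g0 b01 ge01
      v1 _ _ _ t3 t3' i1 ut ut' ij) EH1 mul1r.
    have -> : mean F (fun x => g x * (1 * 1) * tri_mean F s (fun=> 1) x ^+ 2) = m2;
      last by rewrite lerDl.
    by apply: eq_mean => x /=; rewrite mulr1 mulr1.
  suff : mean P (fun w => g (W u.+1 w) *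
      (tri_wt W E (fun=> 1) t w * tri_wt W E (fun=> 1) t' w)) <= r t t'.
    by move=> /le_trans; apply; rewrite lerDr.
  have [i2|i2] := eqVneq #|t :&: t'|%SET 2%N.
    rewrite mul1 (le_trans (@mean_pair_inter2 _ _ _ _ _ _ _ W_iid W_ge0 E_graph s_gt0 _ _ _ 0%N b01 ge01 bg g0
      b01 ge01 (fun=> lexx 1) v1 _ _ _ t3 t3' i2 ut ut' ij))//.
    have -> : r t t' = A2.
      by rewrite /r i2; move: A2 A3 {A20 A30 r r0} => {}A2 {}A3 /=;
        rewrite mulr1 mulr0 addr0.
    by rewrite /A2; move: (mean F (fun x => g x * cycle4_mean F s x)) => z;
      rewrite EH1 mul1r.
  have i3 : #|t :&: t'|%SET = 3%N.
    have i0 : (0 < #|t :&: t'|%SET)%N.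
      by apply/card_gt0P; exists u; rewrite finset.in_setI ut.
    have : (#|t :&: t'|%SET <= 3)%N.
      by rewrite -t3 subset_leq_card// finset.subsetIl.
    by move: i0 i1 i2; case: #|_|%SET => [|[|[|[|]]]].
  rewrite -(inter3_card3 t3 t3' i3).
  have -> : r t t = A3.
    by rewrite /r finset.setIid t3; move: A2 A3 {A20 A30 r r0} => {}A2 {}A3 /=;
      rewrite mulr1 mulr0 add0r.
  rewrite /A3 -[leRHS](mt t g tK bg g0); apply: mean_le.
  - apply: bounded_integ; apply: bounded_measM; first exact: bgW.
    by apply: bounded_measM; exact: bounded_meas_tri_wt.
  - apply: bounded_integ; apply: bounded_measM; first exact: bgW.
    exact: bounded_meas_tri_wt.
  move=> w; rewrite ler_wpM2l// ler_piMr//; first exact: tri_wt_ge0.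
  exact: tri_wt_le1.
have -> : \sum_(t in K) \sum_(t' in K) r t t' =
    \sum_(t in K) \sum_(t' in K) A2 * (#|t :&: t'|%SET == 2%N)%:R +
    \sum_(t in K) \sum_(t' in K) A3 * (#|t :&: t'|%SET == 3%N)%:R.
  rewrite -!big_split /=; apply: eq_bigr => t _.
  by rewrite -!big_split.
rewrite !sum_pairs_indicator -/A2 -/A3.
move: A2 A3 A20 A30 {r} => B2 B3 B20 B30.
have c2 := card_pairs_inter2_at u; have c3 := card_card3_sets_at u.
apply: lerD.
- rewrite mulrC ler_wpM2r// -natrX ler_nat (leq_trans _ c2)//.
  apply: subset_leq_card; apply/fintype.subsetP => p; rewrite !inE.
  by move=> /and3P[/andP[-> ->] /andP[-> ->] ->].
- rewrite mulrC ler_wpM2r// -natrX ler_nat (leq_trans _ c3)//.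
  rewrite -(card_imset (mem [set t in card3_sets n | u \in t]%SET) (f := fun t => (t, t)));
    last by move=> x y [].
  apply: subset_leq_card; apply/fintype.subsetP => -[p q]; rewrite !inE /=.
  move=> /and3P[/andP[/eqP p3 up] /andP[/eqP q3 _] /eqP i3].
  apply/imsetP; exists p; first by rewrite !inE p3.
  by rewrite (inter3_card3 p3 q3 i3).
Qed.

End variances.

(** * Regularly varying tails *)

(** [powR] does not vanish at negative arguments; cutting at 0 makes the power of positive order
    vanish there. *)
Definition pos_pow (R : realType) (p y : R) : R := (Num.max y 0) `^ p.

Definition tail (R : realType) (F : probability R R) (x : R) : R :=
  fine (F `]x, +oo[%classic).

Lemma gt1_ltr_powR (R : realType) (a p r : R) : 1 < a -> p < r -> a `^ p < a `^ r.
Proof.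
move=> a1 pr; rewrite /powR gt_eqF ?(lt_trans ltr01)// ltr_expR ltr_pM2r//.
exact: ln_gt0.
Qed.

Section tail.
Context (R : realType) (F : probability R R).
Local Notation G := (tail F).

Lemma tail_ge0 x : 0 <= G x.
Proof. exact: fine_prob_ge0. Qed.

Lemma tail_nincr x y : x <= y -> G y <= G x.
Proof.
move=> xy; apply: fine_prob_le => // z /=; rewrite !in_itv/= !andbT.
exact: le_lt_trans.
Qed.

Lemma measurable_pos_pow p : measurable_fun setT (@pos_pow R p).
Proof.
apply: (@measurableT_comp _ _ _ _ _ _ (@powR R ^~ p)).
  exact: measurable_powR.
apply: measurable_maxr; [exact: measurable_id|exact: measurable_cst].
Qed.

Lemma pos_pow_ge0 p (y : R) : 0 <= pos_pow p y.
Proof. exact: powR_ge0. Qed.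

Variable alpha : R.
Hypothesis G_gt0 : forall x : R, 0 < x -> 0 < G x.
Hypothesis G_regular : forall t : R, 0 < t ->
  G (t * x) / G x @[x --> +oo] --> t `^ (- alpha).

(** A single doubling step in the spirit of Potter's bounds. Iterated along the dyadic scales, it
    and its lower counterpart give all the power bounds on the tail that are needed. *)
Lemma tail_double_upper p : p < alpha ->
  exists2 x0, 1 <= x0 & forall x, x0 <= x -> G (2 * x) <= 2 `^ (- p) * G x.
Proof.
move=> pa; have := G_regular (ltr0n R 2).
have lt2 : 2 `^ (- alpha) < 2 `^ (- p) :> R by apply: gt1_ltr_powR; rewrite ?ltr1n ?ltrN2.
move=> /(cvgr_lt _)/(_ _ lt2) [M [_ HM]].
exists (Num.max 1 (M + 1)); first by rewrite le_max lexx.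
move=> x; rewrite ge_max => /andP[x1 Mx].
have x0 : 0 < x by rewrite (lt_le_trans ltr01).
have := HM x; rewrite ltr_pdivrMr ?G_gt0// => H; apply/ltW/H.
by rewrite (lt_le_trans _ Mx)// ltrDl.
Qed.

Lemma tail_double_lower p : alpha < p ->
  exists2 x0, 1 <= x0 & forall x, x0 <= x -> 2 `^ (- p) * G x <= G (2 * x).
Proof.
move=> pa; have := G_regular (ltr0n R 2).
have lt2 : 2 `^ (- p) < 2 `^ (- alpha) :> R by apply: gt1_ltr_powR; rewrite ?ltr1n ?ltrN2.
move=> /(cvgr_gt _)/(_ _ lt2) [M [_ HM]].
exists (Num.max 1 (M + 1)); first by rewrite le_max lexx.
move=> x; rewrite ge_max => /andP[x1 Mx].
have x0 : 0 < x by rewrite (lt_le_trans ltr01).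
have := HM x; rewrite ltr_pdivlMr ?G_gt0// => H; apply/ltW/H.
by rewrite (lt_le_trans _ Mx)// ltrDl.
Qed.

Lemma tail_iter_upper p x0 : 1 <= x0 ->
  (forall x, x0 <= x -> G (2 * x) <= 2 `^ (- p) * G x) ->
  forall k x, x0 <= x -> G (2 ^+ k * x) <= (2 `^ (- p)) ^+ k * G x.
Proof.
move=> x01 H k x xx; elim: k => [|k IH]; first by rewrite !expr0 !mul1r.
have x1 : 0 <= x by rewrite (le_trans _ xx)// (le_trans _ x01).
rewrite exprS -mulrA (le_trans (H _ _))//.
  by rewrite (le_trans xx)// ler_peMl// exprn_ege1// ler1n.
by rewrite exprS -mulrA ler_wpM2l// powR_ge0.
Qed.

Lemma tail_iter_lower p x0 : 1 <= x0 ->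
  (forall x, x0 <= x -> 2 `^ (- p) * G x <= G (2 * x)) ->
  forall k x, x0 <= x -> (2 `^ (- p)) ^+ k * G x <= G (2 ^+ k * x).
Proof.
move=> x01 H k x xx; elim: k => [|k IH]; first by rewrite !expr0 !mul1r.
have x1 : 0 <= x by rewrite (le_trans _ xx)// (le_trans _ x01).
rewrite [in leRHS]exprS -mulrA (le_trans _ (H _ _))//.
  by rewrite exprS -mulrA ler_wpM2l// powR_ge0.
by rewrite (le_trans xx)// ler_peMl// exprn_ege1// ler1n.
Qed.

Lemma expr2_unbounded (y : R) : exists k, y <= 2 ^+ k.
Proof.
exists (Num.truncn `|y|).+1.
have /andP[_ H] := truncn_itv (normr_ge0 y).
rewrite (le_trans (ler_norm y))// (le_trans (ltW H))//.
by rewrite -natrX ler_nat ltnW// ltn_expl.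
Qed.

Lemma dyadic_piece (x y : R) : 0 < x -> x < y ->
  exists k, 2 ^+ k * x < y <= 2 ^+ k.+1 * x.
Proof.
move=> x0 xy; have ex : exists k, y <= 2 ^+ k.+1 * x.
  have [k Hk] := expr2_unbounded (y / x); exists k.
  rewrite -ler_pdivrMr// (le_trans Hk)// exprS ler_peMl ?exprn_ge0//.
  by rewrite ler1n.
have := ex_minnP ex => -[k yk mink]; exists k; rewrite yk andbT.
case: k yk mink => [|k] yk mink; first by rewrite expr0 mul1r.
by rewrite ltNge; apply/negP => /mink; rewrite ltnn.
Qed.

(** The upper half of a Karamata estimate. Over the dyadic pieces of the half-line above [x] the
    power grows by [2]^ p[per piece while the tail shrinks by]2 [^ (- p')], so the contributions
    form a geometric series. *)
Lemma tail_moment p : 0 < p -> p < alpha ->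
  exists C x0, [/\ 0 < C, 1 <= x0 & forall x, x0 <= x ->
    (\int[F]_y (pos_pow p y * \1_(`]x, +oo[%classic) y)%:E <=
      (C * (x `^ p * G x))%:E)%E].
Proof.
(* Any exponent strictly between [p] and [alpha] makes the ratio [q] below smaller than 1. *)
move=> p0 pa; pose p' := (p + alpha) / 2.
have [pp' p'a] : p < p' /\ p' < alpha by rewrite /p'; split; lra.
have [x0 x01 Hx0] := tail_double_upper p'a.
have iter := tail_iter_upper x01 Hx0.
pose q : R := 2 `^ p * 2 `^ (- p').
have q0 : 0 <= q by rewrite mulr_ge0 ?powR_ge0.
have q1 : q < 1.
  rewrite /q -powRD; last by rewrite pnatr_eq0 implybT.
  by rewrite -[ltRHS](powRr0 2); apply: gt1_ltr_powR; rewrite ?ltr1n ?subr_lt0.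
exists (2 `^ p / (1 - q)), x0; split => //.
  by rewrite divr_gt0 ?powR_gt0// subr_gt0.
move=> x xx; have xgt0 : 0 < x by rewrite (lt_le_trans _ xx)// (lt_le_trans _ x01).
(* [u k] dominates the power on the piece from [2 ^+ k * x] to [2 ^+ k.+1 * x], and it is spread
   over the whole half-line so that its integral is a value of the tail. *)
pose u k y : \bar R := (((2 ^+ k.+1 * x) `^ p)%:E * (\1_(`]2 ^+ k * x, +oo[%classic) y)%:E)%E.
have u0 k y : (0 <= u k y)%E by rewrite mule_ge0// lee_fin ?powR_ge0.
have mu k : measurable_fun setT (u k).
  apply: emeasurable_funM; first exact: measurable_cst.
  by apply/measurable_EFinP; exact: measurable_indic.
apply: (@le_trans _ _ (\int[F]_y (\sum_(k <oo) u k y))%E).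
  apply: ge0_le_integral => //.
  - by move=> y _; rewrite lee_fin mulr_ge0// pos_pow_ge0.
  - apply/measurable_EFinP; apply: measurable_funM; first exact: measurable_pos_pow.
    exact: measurable_indic.
  - by apply: (@ge0_emeasurable_sum _ _ _ setT u xpredT).
  move=> y _; rewrite indicE; have [|] := boolP (y \in _); last first.
    by move=> _; rewrite mulr0; apply: nneseries_ge0.
  move=> /set_mem /=; rewrite in_itv/= andbT => xy; rewrite mulr1.
  have [k /andP[ky yk]] := dyadic_piece xgt0 xy.
  apply: (@le_trans _ _ (u k y)).
    rewrite /u indicE mem_set ?mule1; last by rewrite /= in_itv/= andbT.
    have y0 : 0 <= y by rewrite ltW// (lt_trans xgt0).
    by rewrite lee_fin /pos_pow max_l// ge0_ler_powR ?nnegrE// ?(ltW p0)// (le_trans y0).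
  apply: (@le_trans _ _ (\sum_(0 <= i < k.+1) u i y)%E); last first.
    by apply: nneseries_lim_ge.
  by rewrite big_nat_recr//= leeDr// sume_ge0.
rewrite integral_nneseries//.
have uE k : (\int[F]_y u k y = ((2 ^+ k.+1 * x) `^ p * G (2 ^+ k * x))%:E)%E.
  rewrite ge0_integralZl_EFin//; last 2 first.
  - by apply/measurable_EFinP; exact: measurable_indic.
  - exact: powR_ge0.
  by rewrite integral_indic// setIT EFinM /tail fine_probK.
have xp0 : 0 <= x `^ p * G x by rewrite mulr_ge0 ?powR_ge0 ?tail_ge0.
have uk k : (2 ^+ k.+1 * x) `^ p * G (2 ^+ k * x) <=
    2 `^ p * (x `^ p * G x) * q ^+ k.
  rewrite powRM ?exprn_ge0 ?(ltW xgt0)//.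
  rewrite (le_trans (ler_wpM2l _ (iter k x xx)))//.
    by rewrite mulr_ge0// powR_ge0.
  have -> : (2 ^+ k.+1 : R) `^ p = 2 `^ p * (2 `^ p) ^+ k.
    rewrite -(powR_mulrn k (powR_ge0 2 p)) -powRrM -powR_mulrn// -powRrM.
    rewrite -powRD; last by rewrite pnatr_eq0 implybT.
    by congr (_ `^ _); rewrite -natr1; ring.
  rewrite le_eqVlt; apply/orP; left; apply/eqP.
  by rewrite /q exprMn; ring.
apply: lime_le.
  by apply: is_cvg_nneseries => k _ _; apply: integral_ge0.
apply: nearW => N.
under eq_bigr do rewrite uE.
rewrite sumEFin lee_fin.
apply: (@le_trans _ _ (\sum_(0 <= k < N) 2 `^ p * (x `^ p * G x) * q ^+ k)).
  by apply: ler_sum => k _; exact: uk.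
rewrite -mulr_sumr big_mkord.
have gs : \sum_(i < N) q ^+ i <= (1 - q)^-1.
  rewrite -[leRHS]mul1r ler_pdivlMr ?subr_gt0// mulrC.
  have -> : (1 - q) * \sum_(i < N) q ^+ i = 1 - q ^+ N.
    by apply: oppr_inj; rewrite opprB subrX1 -mulNr opprB.
  by rewrite lerBlDr lerDl exprn_ge0.
rewrite [leRHS]mulrAC.
by rewrite ler_wpM2l// mulr_ge0// powR_ge0.
Qed.
End tail.

Section tail_powers.
Context (R : realType) (F : probability R R) (alpha : R).
Local Notation G := (tail F).
Hypothesis alpha_gt0 : 0 < alpha.
Hypothesis G_gt0 : forall x : R, 0 < x -> 0 < G x.
Hypothesis G_regular : forall t : R, 0 < t ->
  G (t * x) / G x @[x --> +oo] --> t `^ (- alpha).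

Lemma measurable_pos_pow_above p x :
  measurable_fun setT (fun y : R => pos_pow p y * \1_(`]x, +oo[%classic) y).
Proof.
by apply: measurable_funM; [exact: measurable_pos_pow | exact: measurable_indic].
Qed.

Lemma integ_pos_pow p : 0 < p -> p < alpha -> integ F (@pos_pow R p).
Proof.
move=> p0 pa.
have [C [x0 [C0 x01 HC]]] := tail_moment G_gt0 G_regular p0 pa.
have x00 : 0 <= x0 by rewrite (le_trans _ x01).
apply/integrableP; split; first by
  apply/measurable_EFinP; exact: measurable_pos_pow.
apply: (@le_lt_trans _ _ (\int[F]_y ((x0 `^ p)%:E +
    (pos_pow p y * \1_(`]x0, +oo[%classic) y)%:E))%E).
  apply: ge0_le_integral => //.
  - by apply: measurableT_comp => //; apply/measurable_EFinP; exact: measurable_pos_pow.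
  - apply/measurable_EFinP; apply: measurable_funD; first exact: measurable_cst.
    exact: measurable_pos_pow_above.
  move=> y _; rewrite /= lee_fin ger0_norm ?pos_pow_ge0// indicE.
  have [|/negP] := boolP (y \in _); first by rewrite mulr1 lerDr powR_ge0.
  rewrite mulr0 addr0 => yx0; rewrite /pos_pow ge0_ler_powR ?nnegrE//.
  - exact: ltW.
  - by rewrite le_max lexx orbT.
  rewrite ge_max x00 andbT leNgt; apply/negP => xy; apply: yx0; apply/mem_set.
  by rewrite /= in_itv/= andbT.
have i0 (y : R) : setT y -> (0 <= (x0 `^ p)%:E)%E by rewrite lee_fin powR_ge0.
have i1 (y : R) : setT y ->
    (0 <= (pos_pow p y * \1_(`]x0, +oo[%classic) y)%:E)%E.
  by rewrite lee_fin mulr_ge0// pos_pow_ge0.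
have i2 : measurable_fun setT
    (fun y : R => (pos_pow p y * \1_(`]x0, +oo[%classic) y)%:E).
  by apply/measurable_EFinP; exact: measurable_pos_pow_above.
have i3 : measurable_fun setT (fun _ : R => (x0 `^ p)%:E).
  exact: measurable_cst.
rewrite (ge0_integralD F measurableT i0 i3 i1 i2).
have F1 : F setT = 1%E by exact: probability_setT.
rewrite integral_cst// [X in (_ * X)%E]F1 mule1 lte_add_pinfty ?ltry//.
by rewrite (le_lt_trans (HC x0 (lexx _)))// ltry.
Qed.

Lemma integ_pos_pow_above p x : 0 < p -> p < alpha ->
  integ F (fun y => pos_pow p y * \1_(`]x, +oo[%classic) y).
Proof.
move=> p0 pa; apply: le_integrable (integ_pos_pow p0 pa) => //.
  by apply/measurable_EFinP; exact: measurable_pos_pow_above.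
move=> y _; rewrite /= lee_fin !ger0_norm ?pos_pow_ge0// ?mulr_ge0 ?pos_pow_ge0//.
by rewrite ler_piMr ?pos_pow_ge0// indicE lern1 leq_b1.
Qed.

Lemma mean_above p : 0 < p -> p < alpha ->
  exists C x0, [/\ 0 < C, 1 <= x0 & forall x, x0 <= x ->
    mean F (fun y => pos_pow p y * \1_(`]x, +oo[%classic) y) <= C * (x `^ p * G x)].
Proof.
move=> p0 pa.
have [C [x0 [C0 x01 HC]]] := tail_moment G_gt0 G_regular p0 pa.
exists C, x0; split => // x xx.
by rewrite -lee_fin -mean_EFin; [exact: HC | exact: integ_pos_pow_above].
Qed.

(** Markov's inequality for the moment of order [p]. *)
Lemma tail_le_power p x : 0 < p -> p < alpha -> 0 < x ->
  G x <= mean F (@pos_pow R p) * x `^ (- p).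
Proof.
move=> p0 pa x0; rewrite powRN ler_pdivlMr ?powR_gt0//.
rewrite /tail -mean_indic// mulrC -meanZ.
  apply: mean_le.
  - apply: bounded_integ; apply: bounded_measM; first exact: bounded_meas_cst.
    exact: bounded_meas_indic.
  - exact: integ_pos_pow.
  move=> y; rewrite indicE; have [|_] := boolP (y \in _); last first.
    by rewrite mulr0 pos_pow_ge0.
  move=> /set_mem /=; rewrite in_itv/= andbT mulr1 => xy.
  have y0 : 0 <= y by rewrite ltW// (lt_trans x0).
  by rewrite /pos_pow max_l// ge0_ler_powR ?nnegrE// ltW.
by apply: bounded_integ; exact: bounded_meas_indic.
Qed.

Lemma tail_ge_power p : alpha < p ->
  exists2 c, 0 < c & forall x, 1 <= x -> c * x `^ (- p) <= G x.
Proof.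
move=> ap; have p0 : 0 < p by rewrite (lt_trans alpha_gt0).
have [x0 x01 H] := tail_double_lower G_gt0 G_regular ap.
have iter := tail_iter_lower x01 H.
have x0gt0 : 0 < x0 by rewrite (lt_le_trans ltr01).
exists (2 `^ (- p) * G x0); first by rewrite mulr_gt0 ?powR_gt0// G_gt0.
move=> x x1; have xgt0 : 0 < x by rewrite (lt_le_trans ltr01).
have xp1 : x `^ (- p) <= 1.
  by rewrite -[leRHS](powRr0 x) ler_powR// oppr_le0 ltW.
have [xx0|x0x] := leP x x0.
  apply: (le_trans _ (tail_nincr F xx0)); rewrite mulrC mulrA ler_piMl ?tail_ge0//.
  rewrite mulr_ile1 ?powR_ge0//.
  by rewrite -[leRHS](powRr0 2) ler_powR ?ler1n// oppr_le0 ltW.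
have [k /andP[kx xk]] := dyadic_piece x0gt0 x0x.
apply: (le_trans _ (tail_nincr F xk)); apply: (le_trans _ (iter k.+1 x0 (lexx _))).
rewrite exprS mulrAC ler_wpM2r ?tail_ge0// ler_wpM2l ?powR_ge0//.
rewrite -powR_mulrn ?powR_ge0// -powRrM mulrC powRrM powR_mulrn//.
have kx' : 2 ^+ k <= x.
  by rewrite (le_trans _ (ltW kx))// ler_peMr// exprn_ge0.
by rewrite !powRN lef_pV2 ?posrE ?powR_gt0// ?exprn_gt0// ge0_ler_powR ?nnegrE ?exprn_ge0// ltW.
Qed.

(** The mass in []x / 2, x]] is at least a fixed multiple of the mass beyond [x]. Any positive
    exponent below [alpha] would do in the doubling bound; [alpha / 2] is taken. *)
Lemma tail_gap : exists k x0, [/\ 0 < k, 1 <= x0 & forall x, x0 <= x ->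
  k * G x <= G (x / 2) - G x].
Proof.
have a2 : alpha / 2 < alpha by rewrite ltr_pdivrMr// ltr_pMr// ltr1n.
have [x0 x01 H] := tail_double_upper G_gt0 G_regular a2.
exists (2 `^ (alpha / 2) - 1), (2 * x0); split.
- rewrite subr_gt0 -[ltLHS](powRr0 2); apply: gt1_ltr_powR; first by rewrite ltr1n.
  by rewrite divr_gt0.
- by rewrite (le_trans x01)// ler_peMl ?ler1n// (le_trans _ x01).
move=> x xx; rewrite mulrBl mul1r lerD2r.
have h : x0 <= x / 2 by rewrite ler_pdivlMr// mulrC.
have := H _ h; rewrite [2 * _]mulrC divfK ?pnatr_eq0// powRN.
by rewrite ler_pdivlMl ?powR_gt0.
Qed.

End tail_powers.

(** * Bounds on triangle means *)

Section iterated_means.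
Context (R : realType) (F : probability R R).

Definition mean3 (f : R -> R -> R -> R) : R :=
  mean F (fun x => mean F (fun y => mean F (fun z => f x y z))).

Definition bounded3 (f : R -> R -> R -> R) :=
  bounded_meas (fun p : R * R * R => f p.1.1 p.1.2 p.2) /\
  forall x y z, 0 <= f x y z.

Definition bounded2 (f : R -> R -> R) :=
  bounded_meas (fun p : R * R => f p.1 p.2) /\ forall x y, 0 <= f x y.

Lemma bounded3_at f x : bounded3 f -> bounded2 (f x).
Proof.
move=> [bf f0]; split => //.
have m : measurable_fun setT (fun p : R * R => (x, p.1, p.2)).
  by apply: measurable_fun_pair; meas; apply: measurable_fun_pair; meas;
    exact: measurable_cst.
exact: (bounded_meas_comp bf m).
Qed.

Lemma bounded2_at f x : bounded2 f -> bounded_meas (f x).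
Proof. by move=> [bf _]; exact: (bounded_meas_fin x bf). Qed.

Lemma bounded3_mean f : bounded3 f -> bounded2 (fun x y => mean F (f x y)).
Proof.
move=> [bf f0]; split; last by move=> x y; exact: mean_ge0.
exact: (@bounded_meas_mean _ _ _ _ _ F (fun p => f p.1.1 p.1.2 p.2)).
Qed.

Lemma bounded2_mean f : bounded2 f -> bounded_meas (fun x => mean F (f x)).
Proof.
move=> [bf f0].
exact: (@bounded_meas_mean _ _ _ _ _ F (fun p => f p.1 p.2)).
Qed.

Lemma mean_le_add (f f1 c : R -> R) (A : R) :
  bounded_meas f -> bounded_meas f1 -> integ F c ->
  (forall z, f z <= f1 z + A * c z) -> mean F f <= mean F f1 + A * mean F c.
Proof.
move=> bf bf1 ic H.
have iAc := integZ A ic.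
rewrite -meanZ// -meanD//; last exact: bounded_integ.
apply: mean_le => //; first exact: bounded_integ.
by apply: integD => //; exact: bounded_integ.
Qed.

Lemma mean2_le_add f f1 b c (A : R) : bounded2 f -> bounded2 f1 ->
  integ F b -> integ F c ->
  (forall y z, f y z <= f1 y z + A * (b y * c z)) ->
  mean F (fun y => mean F (f y)) <=
    mean F (fun y => mean F (f1 y)) + A * (mean F b * mean F c).
Proof.
move=> bf bf1 ib ic H.
rewrite [mean F b * _]mulrC mulrA; apply: mean_le_add => //.
- exact: bounded2_mean.
- exact: bounded2_mean.
move=> y; rewrite [_ * b y]mulrAC; apply: mean_le_add => //.
- exact: bounded2_at.
- exact: bounded2_at.
by move=> z; rewrite -mulrA; exact: H.
Qed.

(** The error is a product of one-variable functions that are only integrable: in the applications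
    they are powers of the weights, unbounded but with finite mean. *)
Lemma mean3_le_add f f1 a b c (A : R) : bounded3 f -> bounded3 f1 ->
  integ F a -> integ F b -> integ F c ->
  (forall x y z, f x y z <= f1 x y z + A * (a x * b y * c z)) ->
  mean3 f <= mean3 f1 + A * (mean F a * mean F b * mean F c).
Proof.
move=> bf bf1 ia ib ic H.
have -> : A * (mean F a * mean F b * mean F c) =
    (A * (mean F b * mean F c)) * mean F a by ring.
apply: mean_le_add => //.
- by apply: bounded2_mean; exact: bounded3_mean.
- by apply: bounded2_mean; exact: bounded3_mean.
move=> x; rewrite [_ * a x]mulrAC; apply: mean2_le_add => //.
- exact: bounded3_at.
- exact: bounded3_at.
move=> y z; have -> : A * a x * (b y * c z) = A * (a x * b y * c z) by ring.
exact: H.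
Qed.

Lemma bounded2_cst0 : bounded2 (fun _ _ => 0).
Proof. by split => // ; exact: bounded_meas_cst. Qed.

Lemma bounded3_cst0 : bounded3 (fun _ _ _ => 0).
Proof. by split => // ; exact: bounded_meas_cst. Qed.

Lemma mean2_le f b c (A : R) : bounded2 f -> integ F b -> integ F c ->
  (forall y z, f y z <= A * (b y * c z)) ->
  mean F (fun y => mean F (f y)) <= A * (mean F b * mean F c).
Proof.
move=> bf ib ic H.
have := mean2_le_add (A := A) bf bounded2_cst0 ib ic.
rewrite (_ : mean F (fun _ => mean F (fun _ => 0)) = 0); last first.
  by rewrite mean_cst mean_cst.
by rewrite add0r; apply => y z; rewrite add0r.
Qed.

Lemma mean3_le f a b c (A : R) : bounded3 f ->
  integ F a -> integ F b -> integ F c ->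
  (forall x y z, f x y z <= A * (a x * b y * c z)) ->
  mean3 f <= A * (mean F a * mean F b * mean F c).
Proof.
move=> bf ia ib ic H.
have := mean3_le_add (A := A) bf bounded3_cst0 ia ib ic.
rewrite (_ : mean3 (fun _ _ _ => 0) = 0); last first.
  by rewrite /mean3 !mean_cst.
by rewrite add0r; apply => x y z; rewrite add0r.
Qed.

End iterated_means.

(** * Power bounds for connection probabilities *)

Lemma powR_addr (R : realType) (a u v : R) : 0 < a ->
  a `^ u * a `^ v = a `^ (u + v).
Proof. by move=> a0; rewrite powRD// (gt_eqF a0) implybT. Qed.

Section kernel_bounds.
Context (R : realType) (s : R).
Hypothesis s_gt0 : 0 < s.

Lemma pos_powM p q (x : R) : 0 < p -> 0 < q ->
  pos_pow p x * pos_pow q x = pos_pow (p + q) x.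
Proof. by move=> p0 q0; rewrite /pos_pow powRD// gt_eqF// addr_gt0. Qed.

(** The inequality [min(r, 1) <= r^p] interpolates between the bounds 1 and [r]. The free exponent
    is tuned later so that each weight gets a power with finite moment. *)
Lemma kernel_le_pow p x y : 0 <= p <= 1 ->
  kernel s x y <= s `^ (- p) * (pos_pow p x * pos_pow p y).
Proof.
move=> /andP[p0 p1].
have r0 : 0 <= Num.max x 0 * Num.max y 0.
  by rewrite mulr_ge0// le_max lexx orbT.
rewrite /pos_pow -powRM ?le_max ?lexx ?orbT// powRN mulrC.
have powV (r : R) : 0 <= r -> r `^ p / s `^ p = (r / s) `^ p.
  move=> r0'; have <- : s^-1 `^ p = (s `^ p)^-1.
    by rewrite -[s^-1](powR_inv1 (ltW s_gt0)) -powRrM mulN1r powRN.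
  by rewrite powRM ?invr_ge0 ?(ltW s_gt0).
rewrite powV//; set r := Num.max x 0 * Num.max y 0.
rewrite /kernel -/r; have rs0 : 0 <= r / s by rewrite divr_ge0// ltW.
have [rs1|rs1] := leP (r / s) 1.
  have [->|rn0] := eqVneq (r / s) 0; first by rewrite powR_ge0.
  by apply: ger1_powR => //; rewrite rs1 lt_def rn0 rs0.
by rewrite -[leLHS](powRr0 (r / s)) ler_powR// ltW.
Qed.

Lemma tri_perm1 x y z : tri s x y z = tri s y x z.
Proof. by rewrite /tri [kernel s y x]kernelC; ring. Qed.

Lemma tri_perm2 x y z : tri s x y z = tri s x z y.
Proof. by rewrite /tri [kernel s z y]kernelC; ring. Qed.

(* One edge gets the full exponent 1 and the two edges at the centre [x] the
   exponent [p]: this is the dominant regime for a heavy vertex [x]. *)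
Lemma tri_le_center p x y z : 0 < p <= 1 ->
  tri s x y z <= s `^ (- (1 + 2 * p)) *
    (pos_pow (2 * p) x * (pos_pow (1 + p) y * pos_pow (1 + p) z)).
Proof.
move=> /andP[p0 p1].
have p01 : 0 <= p <= 1 by rewrite ltW.
have h1 := kernel_le_pow x y p01; have h3 := kernel_le_pow x z p01.
have h2 := @kernel_le_pow 1 y z; rewrite ler01 lexx in h2; have {}h2 := h2 isT.
have k0 u v : 0 <= kernel s u v by exact: kernel_ge0.
apply: (le_trans (ler_pM _ _ (ler_pM _ _ h1 h2) h3)) => //; first exact: mulr_ge0.
have -> : s `^ (- (1 + 2 * p)) = s `^ (- p) * s `^ (- 1) * s `^ (- p).
  by rewrite !powR_addr//; congr (_ `^ _); ring.
rewrite -!(@pos_powM 1 p)//.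
have -> : 2 * p = p + p by ring.
rewrite -(@pos_powM p p)//.
by rewrite le_eqVlt; apply/orP; left; apply/eqP; ring.
Qed.

(** All edges get the same exponent, hence every weight the power [2 * p]: with [2 * p] close to
    [alpha] this gives the order of [m_n], whose dominant triangles have weights of order the square
    root of [s]. *)
Lemma tri_le_pow p x y z : 0 < p <= 1 ->
  tri s x y z <= s `^ (- (3 * p)) *
    (pos_pow (2 * p) x * pos_pow (2 * p) y * pos_pow (2 * p) z).
Proof.
move=> /andP[p0 p1].
have p01 : 0 <= p <= 1 by rewrite ltW.
have h1 := kernel_le_pow x y p01; have h3 := kernel_le_pow x z p01.
have h2 := kernel_le_pow y z p01.
have k0 u v : 0 <= kernel s u v by exact: kernel_ge0.
apply: (le_trans (ler_pM _ _ (ler_pM _ _ h1 h2) h3)) => //; first exact: mulr_ge0.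
have -> : s `^ (- (3 * p)) = s `^ (- p) * s `^ (- p) * s `^ (- p).
  by rewrite !powR_addr//; congr (_ `^ _); ring.
have -> : 2 * p = p + p by ring.
rewrite -!(@pos_powM p p)//.
by rewrite le_eqVlt; apply/orP; left; apply/eqP; ring.
Qed.

Lemma cycle4_le_pow p x y z t : 0 < p <= 1 ->
  cycle4 s x y z t <= s `^ (- (4 * p)) * pos_pow (2 * p) x *
    (pos_pow (2 * p) y * pos_pow (2 * p) z * pos_pow (2 * p) t).
Proof.
move=> /andP[p0 p1].
have p01 : 0 <= p <= 1 by rewrite ltW.
have h1 := kernel_le_pow x y p01; have h2 := kernel_le_pow y z p01.
have h3 := kernel_le_pow z t p01; have h4 := kernel_le_pow t x p01.
have k0 u v : 0 <= kernel s u v by exact: kernel_ge0.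
apply: (le_trans (ler_pM _ _ (ler_pM _ _ (ler_pM _ _ h1 h2) h3) h4)) => //;
  do ?[exact: mulr_ge0]; first by apply: mulr_ge0 => //; exact: mulr_ge0.
have -> : s `^ (- (4 * p)) = s `^ (- p) * s `^ (- p) * s `^ (- p) * s `^ (- p).
  by rewrite !powR_addr//; congr (_ `^ _); ring.
have -> : 2 * p = p + p by ring.
rewrite -!(@pos_powM p p)//.
by rewrite le_eqVlt; apply/orP; left; apply/eqP; ring.
Qed.

Lemma kernel_nd x x' y : x <= x' -> kernel s x y <= kernel s x' y.
Proof.
move=> xx; rewrite /kernel le_min !ge_min lexx orbT andbT; apply/orP; left.
apply: ler_wpM2r; first by rewrite invr_ge0 ltW.
apply: ler_wpM2r; first by rewrite le_max lexx orbT.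
by rewrite ge_max le_max xx /= le_max lexx orbT.
Qed.

(** Concavity of [r -> min(r, 1)] together with its value 0 at the origin. *)
Lemma kernel_scale l x y : 0 <= l <= 1 -> l * kernel s x y <= kernel s (l * x) y.
Proof.
move=> /andP[l0 l1]; rewrite /kernel le_min; apply/andP; split; last first.
  by apply: mulr_ile1 => //; [exact: kernel_ge0 | exact: kernel_le1].
have -> : Num.max (l * x) 0 = l * Num.max x 0 by rewrite maxr_pMr// mulr0.
by rewrite -!mulrA ler_wpM2l// ge_min mulrA lexx.
Qed.

Lemma tri_nd x x' y z : x <= x' -> tri s x y z <= tri s x' y z.
Proof.
move=> xx; have k0 u v : 0 <= kernel s u v by exact: kernel_ge0.
apply: ler_pM; rewrite ?mulr_ge0 ?kernel_nd//.
by rewrite ler_wpM2r ?kernel_nd.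
Qed.

End kernel_bounds.

Definition trunc (R : realType) (b : R) : R -> R := \1_(`]-oo, b]%classic).

Section trunc.
Context (R : realType).
Implicit Types b x : R.

Lemma truncE b x : trunc b x = (x <= b)%R%:R.
Proof.
rewrite /trunc indicE; congr (nat_of_bool _)%:R; apply/idP/idP => [/set_mem|xb].
  by rewrite /= in_itv.
by apply/mem_set; rewrite /= in_itv.
Qed.

Lemma bounded_meas_trunc b : bounded_meas (trunc b).
Proof. exact: bounded_meas_indic. Qed.

Lemma trunc_ge0 b x : 0 <= trunc b x.
Proof. by rewrite truncE. Qed.

Lemma trunc_le1 b x : trunc b x <= 1.
Proof. by rewrite truncE lern1 leq_b1. Qed.

Lemma above_pos_pow b u q x : 0 < b -> 0 < u -> u <= q ->
  (1 - trunc b x) * pos_pow u x <= b `^ (u - q) * pos_pow q x.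
Proof.
move=> b0 u0 uq; rewrite truncE.
have [xb|bx] := leP x b.
  by rewrite subrr mul0r mulr_ge0 ?powR_ge0// pos_pow_ge0.
rewrite subr0 mul1r /pos_pow; have x0 : 0 < x by rewrite (lt_trans b0).
rewrite max_l ?(ltW x0)// -{1}(subrK q u) -powR_addr// ler_wpM2r ?powR_ge0//.
rewrite -(opprK (u - q)) !(powRN _ (- _)) lef_pV2 ?posrE ?powR_gt0//.
by rewrite ge0_ler_powR ?nnegrE ?(ltW x0) ?(ltW b0) ?(ltW bx)// oppr_ge0 subr_le0.
Qed.

Lemma trunc_pos_pow b u q x : 0 <= b -> 0 < q -> q < u ->
  trunc b x * pos_pow u x <= b `^ (u - q) * pos_pow q x.
Proof.
move=> b0 q0 qu; rewrite truncE.
have [xb|bx] := leP x b; last by rewrite mul0r mulr_ge0 ?powR_ge0// pos_pow_ge0.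
rewrite mul1r -{1}(subrK q u) -pos_powM ?subr_gt0// ler_wpM2r ?pos_pow_ge0//.
rewrite /pos_pow ge0_ler_powR ?nnegrE ?subr_ge0 ?(ltW qu)//.
  by rewrite le_max lexx orbT.
by rewrite ge_max xb b0.
Qed.

End trunc.

Section integrated_bounds.
Context (R : realType) (F : probability R R) (s : R).
Hypothesis s_gt0 : 0 < s.
Local Notation M p := (mean F (@pos_pow R p)).
Local Notation G := (tail F).

Lemma moment_ge0 p : 0 <= M p.
Proof. by apply: mean_ge0 => x; exact: pos_pow_ge0. Qed.

Section weights.
Variable hb : R -> R.
Hypotheses (bhb : bounded_meas hb) (hb01 : forall x, 0 <= hb x <= 1).

Let hb0 x : 0 <= hb x. Proof. by case/andP: (hb01 x). Qed.
Let hb1 x : hb x <= 1. Proof. by case/andP: (hb01 x). Qed.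

Lemma bounded2_tri x : bounded2 (fun y z => hb y * hb z * tri s x y z).
Proof.
apply: (@bounded3_at _ (fun x y z => hb y * hb z * tri s x y z)).
split; [exact: bounded_meas_hbtri | by move=> *; exact: hbtri_ge0].
Qed.

Lemma hbtri_le x y z : hb y * hb z * tri s x y z <= tri s x y z.
Proof. by apply: ler_piMl; [exact: tri_ge0 | exact: mulr_ile1]. Qed.

Lemma tri_mean_upper p x : 0 < p <= 1 -> integ F (@pos_pow R (1 + p)) ->
  tri_mean F s hb x <= s `^ (- (1 + 2 * p)) * M (1 + p) ^+ 2 * pos_pow (2 * p) x.
Proof.
move=> p01 ip.
have -> : s `^ (- (1 + 2 * p)) * M (1 + p) ^+ 2 * pos_pow (2 * p) x =
    (s `^ (- (1 + 2 * p)) * pos_pow (2 * p) x) * (M (1 + p) * M (1 + p)).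
  by rewrite expr2; ring.
apply: mean2_le => //; first exact: bounded2_tri.
move=> y z; apply: (le_trans (hbtri_le x y z)).
by rewrite -mulrA; exact: tri_le_center.
Qed.

Lemma tri_total_mean3 :
  tri_total F s hb = mean3 F (fun x y z => hb x * hb y * hb z * tri s x y z).
Proof.
apply: eq_mean => x; rewrite /tri_mean -meanZ; last first.
  by apply: bounded_integ; exact: bounded2_mean (bounded2_tri x).
apply: eq_mean => y; rewrite -meanZ; last first.
  by apply: bounded_integ; exact: bounded2_at (bounded2_tri x).
by apply: eq_mean => z; rewrite !mulrA.
Qed.

Lemma bounded3_tri :
  bounded3 (fun x y z => hb x * hb y * hb z * tri s x y z).
Proof.
split; last first.
  by move=> x y z; repeat first [exact: tri_ge0 | exact: hb0 | apply: mulr_ge0].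
by repeat bm1.
Qed.

Lemma tri_total_upper p : 0 < p <= 1 -> integ F (@pos_pow R (2 * p)) ->
  tri_total F s hb <= s `^ (- (3 * p)) * M (2 * p) ^+ 3.
Proof.
move=> p01 ip; rewrite tri_total_mean3.
have -> : M (2 * p) ^+ 3 = M (2 * p) * M (2 * p) * M (2 * p).
  by rewrite !exprS expr0 mulr1 mulrA.
apply: mean3_le => //; first exact: bounded3_tri.
move=> x y z; rewrite (le_trans _ (tri_le_pow s_gt0 x y z p01))//.
apply: ler_piMl; first exact: tri_ge0.
by apply: mulr_ile1 => //; [exact: mulr_ge0 | exact: mulr_ile1].
Qed.

Lemma tri_total_le_mean : tri_total F s hb <= mean F (tri_mean F s (fun=> 1)).
Proof.
apply: mean_le.
- by apply: bounded_integ; apply: bounded_measM => //; exact: bounded_meas_tri_mean.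
- apply: bounded_integ; apply: bounded_meas_tri_mean => //.
  exact: bounded_meas_cst.
move=> x; apply: (@le_trans _ _ (tri_mean F s hb x)).
  by apply: ler_piMl => //; exact: tri_mean_ge0.
have b1 := @bounded_meas_cst _ R R 1.
have le1 : forall x : R, 0 <= 1 :> R by [].
apply: mean_le.
- by apply: bounded_integ; exact: bounded2_mean (bounded2_tri x).
- by apply: bounded_integ; exact: (bounded_meas_fin x (bounded_meas_tri_mean1 F s_gt0 b1 le1)).
move=> y; apply: mean_le.
- by apply: bounded_integ; exact: bounded2_at (bounded2_tri x).
- by apply: bounded_integ; exact: (bounded_meas_fin (x, y) (bounded_meas_hbtri s_gt0 b1)).
by move=> z; rewrite /= !mul1r; exact: hbtri_le.
Qed.

Lemma tri_square_upper b p q : 0 < b -> 0 < p <= 1 -> 0 < q -> q < 4 * p ->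
  (forall x, hb x <= trunc b x) ->
  integ F (@pos_pow R (1 + p)) -> integ F (@pos_pow R q) ->
  mean F (fun x => hb x * tri_mean F s hb x ^+ 2) <=
    s `^ (- (2 + 4 * p)) * M (1 + p) ^+ 4 * b `^ (4 * p - q) * M q.
Proof.
move=> b0 p01 q0 qp hbb ip iq; have [p0 p1] := andP p01.
rewrite -meanZ//; apply: mean_le.
- apply: bounded_integ; apply: bounded_measM => //; apply: bounded_measM;
    exact: bounded_meas_tri_mean.
- exact: integZ.
move=> x; have D0 : 0 <= tri_mean F s hb x by exact: tri_mean_ge0.
have := tri_mean_upper x p01 ip.
set K := s `^ (- (1 + 2 * p)) * M (1 + p) ^+ 2 => DK.
have K0 : 0 <= K by rewrite mulr_ge0 ?powR_ge0// exprn_ge0// moment_ge0.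
have -> : s `^ (- (2 + 4 * p)) * M (1 + p) ^+ 4 = K ^+ 2.
  rewrite /K exprMn -exprM; congr (_ * _); rewrite expr2 powR_addr//.
  by congr (_ `^ _); ring.
rewrite -mulrA; apply: (@le_trans _ _ (trunc b x * (K * pos_pow (2 * p) x) ^+ 2)).
  apply: ler_pM => //; first exact: exprn_ge0.
  by rewrite lerXn2r ?nnegrE// mulr_ge0// pos_pow_ge0.
rewrite exprMn mulrCA ler_wpM2l ?exprn_ge0//.
rewrite expr2 pos_powM ?mulr_gt0// (_ : 2 * p + 2 * p = 4 * p); last by ring.
by apply: trunc_pos_pow => //; exact: ltW.
Qed.

End weights.

Lemma cycle4_mean_upper p x : 0 < p <= 1 -> integ F (@pos_pow R (2 * p)) ->
  cycle4_mean F s x <= s `^ (- (4 * p)) * M (2 * p) ^+ 3 * pos_pow (2 * p) x.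
Proof.
move=> p01 ip.
have -> : s `^ (- (4 * p)) * M (2 * p) ^+ 3 * pos_pow (2 * p) x =
  (s `^ (- (4 * p)) * pos_pow (2 * p) x) * (M (2 * p) * M (2 * p) * M (2 * p)).
  by rewrite !exprS expr0; ring.
apply: mean3_le => //; last by move=> y z t; exact: cycle4_le_pow.
split; last by move=> y z t; exact: cycle4_ge0.
by apply: bounded_meas_cycle4 => //; meas; exact: measurable_cst.
Qed.

(** The truncation is inserted at one vertex after the other, whence the factor 3. Each insertion
    loses triangles that have a vertex above [b], and these are bounded with that vertex as
    centre. *)
Lemma tri_total_trunc_lower b p q : 0 < b -> 0 < p <= 1 -> 2 * p <= q ->
  integ F (@pos_pow R (1 + p)) -> integ F (@pos_pow R q) ->
  tri_total F s (fun=> 1) <= tri_total F s (trunc b) +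
    3 * (s `^ (- (1 + 2 * p)) * b `^ (2 * p - q) * (M q * M (1 + p) * M (1 + p))).
Proof.
move=> b0 p01 pq ip iq; have [p0 p1] := andP p01.
have b1 := @bounded_meas_cst _ R R 1.
have le1 (x : R) : (0 : R) <= (1 : R) <= (1 : R) by rewrite ler01 lexx.
have t01 (x : R) : 0 <= trunc b x <= 1 by rewrite trunc_ge0 trunc_le1.
have bt := bounded_meas_trunc b.
rewrite (tri_total_mean3 b1 le1) (tri_total_mean3 bt t01).
set A := s `^ _ * b `^ _; set B := _ * M _ * M _.
pose f3 (x y z : R) := 1 * 1 * 1 * tri s x y z.
pose f2 (x y z : R) := trunc b x * 1 * 1 * tri s x y z.
pose f1 (x y z : R) := trunc b x * trunc b y * 1 * tri s x y z.
pose f0 (x y z : R) := trunc b x * trunc b y * trunc b z * tri s x y z.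
have bf (u v w : R -> R) : bounded_meas u -> bounded_meas v -> bounded_meas w ->
    (forall x, 0 <= u x) -> (forall x, 0 <= v x) -> (forall x, 0 <= w x) ->
    bounded3 (fun x y z => u x * v y * w z * tri s x y z).
  move=> bu bv bw u0 v0 w0; split; last first.
    by move=> x y z; repeat first
      [exact: tri_ge0 | exact: u0 | exact: v0 | exact: w0 | apply: mulr_ge0].
  apply: bounded_measM; last by apply: bounded_meas_tri; meas.
  apply: bounded_measM; [apply: bounded_measM|].
  - by apply: (@bounded_meas_comp _ _ _ _ _ (fun p => p.1.1) u) => //; meas.
  - by apply: (@bounded_meas_comp _ _ _ _ _ (fun p => p.1.2) v) => //; meas.
  - by apply: (@bounded_meas_comp _ _ _ _ _ snd w) => //; meas.
have ge1 : forall x : R, 0 <= 1 :> R by [].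
have t0 := @trunc_ge0 R b.
have bf3 : bounded3 f3 by exact: (bf _ _ _ b1 b1 b1 ge1 ge1 ge1).
have bf2 : bounded3 f2 by exact: (bf _ _ _ bt b1 b1 t0 ge1 ge1).
have bf1 : bounded3 f1 by exact: (bf _ _ _ bt bt b1 t0 t0 ge1).
have bf0 : bounded3 f0 by exact: (bf _ _ _ bt bt bt t0 t0 t0).
have u0 : 0 < 2 * p by rewrite mulr_gt0.
have key x y z : (1 - trunc b x) * tri s x y z <=
    A * (pos_pow q x * pos_pow (1 + p) y * pos_pow (1 + p) z).
  have t1 : 0 <= 1 - trunc b x by rewrite subr_ge0 trunc_le1.
  apply: (le_trans (ler_wpM2l t1 (tri_le_center s_gt0 x y z p01))).
  have := above_pos_pow x b0 u0 pq.
  set t := 1 - trunc b x; set S := s `^ _; set BB := b `^ _.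
  set X := pos_pow (2 * p) x; set Xq := pos_pow q x.
  set Y := pos_pow (1 + p) y; set Z := pos_pow (1 + p) z => H.
  have -> : t * (S * (X * (Y * Z))) = S * ((Y * Z) * (t * X)) by ring.
  have -> : A * (Xq * Y * Z) = S * ((Y * Z) * (BB * Xq)).
    by rewrite /A -/S -/BB; ring.
  by rewrite ler_wpM2l ?powR_ge0// ler_wpM2l// mulr_ge0// pos_pow_ge0.
have step3 : mean3 F f3 <= mean3 F f2 + A * B.
  apply: mean3_le_add => // x y z; rewrite -lerBlDl.
  apply: le_trans (key x y z).
  by rewrite /f3 /f2 le_eqVlt; apply/orP; left; apply/eqP; ring.
have step2 : mean3 F f2 <= mean3 F f1 + A * (M (1 + p) * M q * M (1 + p)).
  apply: mean3_le_add => // x y z; rewrite -lerBlDl.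
  have -> : pos_pow (1 + p) x * pos_pow q y * pos_pow (1 + p) z =
    pos_pow q y * pos_pow (1 + p) x * pos_pow (1 + p) z by ring.
  apply: le_trans (key y x z); rewrite -tri_perm1.
  have -> : f2 x y z - f1 x y z = trunc b x * ((1 - trunc b y) * tri s x y z).
    by rewrite /f2 /f1; ring.
  by apply: ler_piMl (trunc_le1 _ _); rewrite mulr_ge0 ?tri_ge0// subr_ge0 trunc_le1.
have step1 : mean3 F f1 <= mean3 F f0 + A * (M (1 + p) * M (1 + p) * M q).
  apply: mean3_le_add => // x y z; rewrite -lerBlDl.
  have -> : pos_pow (1 + p) x * pos_pow (1 + p) y * pos_pow q z =
    pos_pow q z * pos_pow (1 + p) x * pos_pow (1 + p) y by ring.
  apply: le_trans (key z x y).
  have -> : tri s z x y = tri s x y z by rewrite tri_perm1 tri_perm2.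
  have -> : f1 x y z - f0 x y z =
      trunc b x * trunc b y * ((1 - trunc b z) * tri s x y z).
    by rewrite /f1 /f0; ring.
  apply: ler_piMl; first by rewrite mulr_ge0 ?tri_ge0// subr_ge0 trunc_le1.
  by rewrite mulr_ile1 ?trunc_ge0 ?trunc_le1.
rewrite -/f3 -/f0.
have e2 : M (1 + p) * M q * M (1 + p) = B by rewrite /B; ring.
have e1 : M (1 + p) * M (1 + p) * M q = B by rewrite /B; ring.
rewrite e2 in step2; rewrite e1 in step1.
rewrite [3]/(1 + (1 + 1)) !mulrDl mul1r 2!addrA.
apply: (le_trans step3); rewrite lerD2r; apply: (le_trans step2).
by rewrite lerD2r; exact: step1.
Qed.

End integrated_bounds.

(** * Lower bounds on triangle means and their strict growth in the weight *)

Section lower_bounds.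
Context (R : realType) (F : probability R R).
Local Notation G := (tail F).
Local Notation above r := (\1_(`]r, +oo[%classic) : R -> R).
Local Notation D s := (tri_mean F s (fun=> 1)).

Lemma aboveE (r z : R) : above r z = (r < z)%R%:R.
Proof.
rewrite indicE; congr (nat_of_bool _)%:R; apply/idP/idP => [/set_mem|xb].
  by rewrite /= in_itv/= andbT.
by apply/mem_set; rewrite /= in_itv/= andbT.
Qed.

Lemma bounded_meas_above r : bounded_meas (above r).
Proof. exact: bounded_meas_indic. Qed.

Lemma mean_above_tail r : mean F (above r) = G r.
Proof. by rewrite mean_indic. Qed.

Section fixed_s.
Variable s : R.
Hypothesis s_gt0 : 0 < s.

Let b1 := @bounded_meas_cst _ R R 1.
Let ge1 : forall x : R, (0 : R) <= (1 : R). Proof. by []. Qed.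
Let le1 : forall x : R, (0 : R) <= (1 : R) <= (1 : R).
Proof. by move=> _; rewrite ler01 lexx. Qed.

Lemma bounded2_tri1 x : bounded2 (tri s x).
Proof.
split; last by move=> y z; exact: tri_ge0.
by apply: bounded_meas_tri => //; meas; exact: measurable_cst.
Qed.

Lemma tri_mean1E x : D s x = mean F (fun y => mean F (tri s x y)).
Proof. by apply: eq_mean => y; apply: eq_mean => z /=; rewrite !mul1r. Qed.

Lemma tri_mean_nd x x' : x <= x' -> D s x <= D s x'.
Proof.
move=> xx; rewrite !tri_mean1E; apply: mean_le.
- by apply: bounded_integ; exact: bounded2_mean (bounded2_tri1 x).
- by apply: bounded_integ; exact: bounded2_mean (bounded2_tri1 x').
move=> y; apply: mean_le.
- by apply: bounded_integ; exact: bounded2_at (bounded2_tri1 x).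
- by apply: bounded_integ; exact: bounded2_at (bounded2_tri1 x').
by move=> z; exact: tri_nd.
Qed.

Lemma mean2_ge (f : R -> R -> R) (A r : R) : bounded2 f -> 0 <= A ->
  (forall y z, r < y -> r < z -> A <= f y z) ->
  A * G r ^+ 2 <= mean F (fun y => mean F (f y)).
Proof.
move=> bf A0 H; rewrite expr2 mulrA mulrC -[X in X * _]mean_above_tail mulrC.
rewrite -meanZ; last by apply: bounded_integ; exact: bounded_meas_above.
apply: mean_le.
- by apply: integZ; apply: bounded_integ; exact: bounded_meas_above.
- by apply: bounded_integ; exact: bounded2_mean.
move=> y; rewrite aboveE; case: ltP => ry; last first.
  by rewrite mulr0; apply: mean_ge0 => z; case: bf.
rewrite mulr1 -mean_above_tail -meanZ; last first.
  by apply: bounded_integ; exact: bounded_meas_above.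
apply: mean_le.
- by apply: integZ; apply: bounded_integ; exact: bounded_meas_above.
- by apply: bounded_integ; exact: bounded2_at.
move=> z; rewrite aboveE; case: ltP => rz; first by rewrite mulr1 H.
by rewrite mulr0; case: bf.
Qed.

Lemma kernel_eq1 x y : 0 <= x -> 0 <= y -> s <= x * y -> kernel s x y = 1.
Proof. by move=> x0 y0 sxy; rewrite /kernel !max_l// min_r// ler_pdivlMr// mul1r. Qed.

(** Two weights above [s / x] are joined to [x] with probability 1 and to each other with
    probability at least [s / x ^+ 2], a number that the second hypothesis keeps at most 1. *)
Lemma tri_mean_lower x : 0 < x -> s <= x ^+ 2 ->
  s / x ^+ 2 * G (s / x) ^+ 2 <= D s x.
Proof.
move=> x0 sx; rewrite tri_mean1E; apply: mean2_ge.
- exact: bounded2_tri1.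
- by rewrite divr_ge0 ?exprn_ge0// ltW.
move=> y z yr zr; have r0 : 0 < s / x by rewrite divr_gt0.
have [y0 z0] : 0 < y /\ 0 < z by split; exact: lt_trans r0 _.
have sy : s <= x * y by rewrite mulrC -ler_pdivrMr// ltW.
have sz : s <= x * z by rewrite mulrC -ler_pdivrMr// ltW.
rewrite /tri (kernel_eq1 _ _ sy) ?(ltW x0) ?(ltW y0)//.
rewrite (kernel_eq1 _ _ sz) ?(ltW x0) ?(ltW z0)// mul1r mulr1.
rewrite /kernel le_min; apply/andP; split; last first.
  by rewrite ler_pdivrMr ?exprn_gt0// mul1r.
rewrite (max_l (ltW y0)) (max_l (ltW z0)) ler_pdivlMr//.
apply: (@le_trans _ _ ((s / x) * (s / x))).
  by rewrite le_eqVlt; apply/orP; left; apply/eqP; field; rewrite gt_eqF.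
by apply: ler_pM; rewrite ?(ltW r0) ?(ltW yr) ?(ltW zr).
Qed.

(** Three weights above the square root of [s] form a triangle with probability 1. *)
Lemma tri_total_lower r : 0 < r -> s <= r ^+ 2 ->
  G r ^+ 3 <= tri_total F s (fun=> 1).
Proof.
move=> r0 sr; rewrite exprS -[X in X * _]mean_above_tail mulrC.
rewrite -meanZ; last by apply: bounded_integ; exact: bounded_meas_above.
apply: mean_le.
- by apply: integZ; apply: bounded_integ; exact: bounded_meas_above.
- apply: bounded_integ; apply: bounded_measM => //.
  exact: bounded_meas_tri_mean.
move=> x; rewrite aboveE mul1r; case: ltP => rx; last first.
  by rewrite mulr0; exact: tri_mean_ge0.
rewrite mulr1 -[leLHS]mul1r tri_mean1E; apply: mean2_ge => //.
  exact: bounded2_tri1.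
move=> y z ry rz; rewrite /tri.
have le2 u v : r < u -> r < v -> kernel s u v = 1.
  move=> ru rv; rewrite kernel_eq1 ?(ltW (lt_trans r0 _))//.
  by rewrite (le_trans sr)// expr2 ler_pM ?ltW.
by rewrite !le2// !mulr1.
Qed.

End fixed_s.

Variable alpha : R.
Hypothesis alpha_gt1 : 1 < alpha.
Hypothesis G_gt0 : forall x : R, 0 < x -> 0 < G x.
Hypothesis G_regular : forall t : R, 0 < t ->
  G (t * x) / G x @[x --> +oo] --> t `^ (- alpha).

(* The vertices of weight at most [s / x] carry a positive fraction of the
   integral, and on them the integrand is linear in [x]. *)
Lemma tri_mean_strict l : 0 < l -> l < 1 ->
  exists e x1, [/\ 0 < e, e < 1, 1 <= x1 & forall s x, 0 < s -> 0 < x ->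
    x1 <= s / x -> D s (l * x) <= (1 - e) * D s x].
Proof.
move=> l0 l1; have alpha_gt0 : 0 < alpha by rewrite (lt_trans ltr01).
have [C [x2 [C0 x21 HC]]] := mean_above G_gt0 G_regular ltr01 alpha_gt1.
have [k [x3 [k0 x31 Hk]]] := tail_gap alpha_gt0 G_gt0 G_regular.
(* [C'] bounds the contribution of [z > s / x] relative to that of [z <= s / x]: [C] comes from the
   truncated mean above [r], [k] from the mass in []r / 2, r]], and 4 from two factors 1/2 lost
   there. The choice of [e] then follows from [DU] and [DlU]. *)
pose C' := 4 * C / k; have C'0 : 0 < C' by rewrite divr_gt0// mulr_gt0.
exists ((1 - l) / (1 + C')), (Num.max x2 x3).
have d0 : 0 < 1 + C' by rewrite addr_gt0.
split.
- by rewrite divr_gt0// subr_gt0.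
- by rewrite ltr_pdivrMr// mul1r; lra.
- by rewrite le_max x21.
move=> s x s0 x0; rewrite ge_max => /andP[x2s x3s].
set r := s / x; have r0 : 0 < r by rewrite divr_gt0.
have ker0 u v : 0 <= kernel s u v by exact: kernel_ge0.
pose U y := mean F (fun z => trunc r z * tri s x y z).
have b2U : bounded2 (fun y z => trunc r z * tri s x y z).
  split; last by move=> y z; rewrite mulr_ge0 ?trunc_ge0 ?tri_ge0.
  apply: bounded_measM; last by apply: bounded_meas_tri => //; meas; exact: measurable_cst.
  apply: (@bounded_meas_comp _ _ _ _ _ snd (trunc r)); last by meas.
  exact: bounded_meas_trunc.
have bU : bounded_meas U by exact: (bounded2_mean F b2U).
have U0 y : 0 <= U y.
  by apply: mean_ge0 => z; rewrite mulr_ge0 ?trunc_ge0 ?tri_ge0.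
have bD := bounded2_tri1 s0 x.
have fU y : mean F (tri s x y) <= (1 + C') * U y.
  pose K := kernel s x y * kernel s y r.
  have K0 : 0 <= K by exact: mulr_ge0.
  (* For [z > r] the edge from [x] to [z] is bounded by 1 and the edge from [y] to [z] by [z / r]
     times its value at [z = r], by concavity. *)
  have le1' : mean F (tri s x y) <= U y + K / r *
      mean F (fun z => pos_pow 1 z * above r z).
    apply: mean_le_add.
    - exact: (bounded2_at y bD).
    - exact: (bounded2_at y b2U).
    - exact: (integ_pos_pow_above G_gt0 G_regular _ ltr01 alpha_gt1).
    move=> z; rewrite truncE aboveE; case: (leP z r) => zr.
      by rewrite mul1r mulr0 mulr0 addr0.
    have z0 : 0 < z by rewrite (lt_trans r0).
    rewrite mul0r add0r mulr1 /pos_pow max_l ?(ltW z0)// powRr1 ?(ltW z0)//.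
    have kz : kernel s y z <= z / r * kernel s y r.
      rewrite -ler_pdivrMl ?divr_gt0// invf_div [kernel s y z]kernelC.
      rewrite [kernel s y r]kernelC (le_trans (kernel_scale s0 z y _))//.
        by rewrite divr_ge0 ?(ltW r0) ?(ltW z0)//= ler_pdivrMr// mul1r ltW.
      by rewrite divfK ?gt_eqF.
    rewrite /tri (@le_trans _ _ (kernel s x y * kernel s y z))//.
      by apply: ler_piMr (kernel_le1 _ _ _); exact: mulr_ge0.
    apply: (le_trans (ler_wpM2l (ker0 x y) kz)).
    by rewrite /K le_eqVlt; apply/orP; left; apply/eqP; field; rewrite gt_eqF.
  (* Only [z] between [r / 2] and [r] is kept. There each of the two edges at [z] has at least half
     of its value at [z = r], and the edge to [x] has the value 1 at [z = r]. *)
  have le2 : K / 4 * (G (r / 2) - G r) <= U y.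
    rewrite -!mean_above_tail -meanB; last 2 first.
    - by apply: bounded_integ; exact: bounded_meas_above.
    - by apply: bounded_integ; exact: bounded_meas_above.
    have ba : bounded_meas (fun z => above (r / 2) z - above r z).
      by apply: bounded_measB; exact: bounded_meas_above.
    rewrite -meanZ; last exact: bounded_integ.
    apply: mean_le.
    - by apply: integZ; exact: bounded_integ.
    - by apply: bounded_integ; exact: (bounded2_at y b2U).
    move=> z; rewrite !aboveE truncE.
    have [zr|rz] := leP z r; last first.
      have -> : r / 2 < z by rewrite (le_lt_trans _ rz)// ler_pdivrMr// ler_peMr ?ler1n// ltW.
      by rewrite subrr mulr0 mul0r.
    rewrite subr0 mul1r; case: ltP => z2; last by rewrite mulr0 tri_ge0.
    have z0 : 0 < z by rewrite (lt_trans _ z2)// divr_gt0.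
    have zr01 : 0 <= z / r <= 1.
      by rewrite divr_ge0 ?(ltW r0) ?(ltW z0)//= ler_pdivrMr// mul1r.
    have zr2 : 1 / 2 <= z / r by rewrite ler_pdivlMr// mulrC mul1r ltW// mulrC.
    have kz : 1 / 2 * kernel s y r <= kernel s y z.
      apply: (@le_trans _ _ (z / r * kernel s y r)); first by rewrite ler_wpM2r.
      rewrite [kernel s y r]kernelC [kernel s y z]kernelC.
      by rewrite (le_trans (kernel_scale s0 r y zr01))// divfK ?gt_eqF.
    have kxz : 1 / 2 <= kernel s x z.
      rewrite (le_trans zr2)// /kernel !max_l ?(ltW x0) ?(ltW z0)// le_min.
      rewrite (andP zr01).2 andbT /r le_eqVlt; apply/orP; left; apply/eqP.
      by field; rewrite !gt_eqF.
    rewrite mulr1 /tri -mulrA.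
    have -> : K / 4 = kernel s x y * ((1 / 2 * kernel s y r) * (1 / 2)).
      by rewrite /K; field.
    by rewrite ler_wpM2l// ler_pM// mulr_ge0.
  have le3 := Hk r x3s; have le4 := HC r x2s.
  rewrite powRr1 ?(ltW r0)// in le4.
  apply: (le_trans le1'); rewrite mulrDl mul1r lerD2l.
  apply: (@le_trans _ _ (K / r * (C * (r * G r)))).
    by rewrite ler_wpM2l// divr_ge0// ltW.
  have -> : K / r * (C * (r * G r)) = C' * (K / 4 * (k * G r)).
    by rewrite /C'; field; rewrite !gt_eqF.
  rewrite ler_wpM2l ?(ltW C'0)//; apply: le_trans le2.
  by rewrite ler_wpM2l// divr_ge0.
have DU : D s x <= (1 + C') * mean F U.
  rewrite tri_mean1E -meanZ; last exact: bounded_integ.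
  apply: mean_le => //; last by apply: integZ; exact: bounded_integ.
  by apply: bounded_integ; exact: bounded2_mean.
(* On [z <= s / x] the edge from [x] to [z] is not yet capped at 1, so scaling [x] by [l] scales it
   exactly by [l]; the other edge at [x] can only decrease. *)
have DlU : D s (l * x) <= D s x - (1 - l) * mean F U.
  rewrite !tri_mean1E -meanZ; last exact: bounded_integ.
  rewrite -meanB; last 2 first.
  - by apply: bounded_integ; exact: bounded2_mean.
  - by apply: integZ; exact: bounded_integ.
  have bl := bounded2_tri1 s0 (l * x).
  apply: mean_le.
  - by apply: bounded_integ; exact: bounded2_mean.
  - apply: bounded_integ; apply: bounded_measB; first exact: bounded2_mean.
    by apply: bounded_measM => //; exact: bounded_meas_cst.
  move=> y; rewrite -meanZ; last by apply: bounded_integ; exact: (bounded2_at y b2U).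
  rewrite -meanB; last 2 first.
  - by apply: bounded_integ; exact: (bounded2_at y bD).
  - by apply: integZ; apply: bounded_integ; exact: (bounded2_at y b2U).
  apply: mean_le.
  - by apply: bounded_integ; exact: (bounded2_at y bl).
  - apply: bounded_integ; apply: bounded_measB; first exact: (bounded2_at y bD).
    apply: bounded_measM; first exact: bounded_meas_cst.
    exact: (bounded2_at y b2U).
  move=> z; have lx : l * x <= x by rewrite ler_piMl ?ltW.
  rewrite truncE; case: (leP z r) => zr; last first.
    by rewrite mul0r mulr0 subr0; exact: tri_nd.
  have -> : tri s x y z - (1 - l) * (1 * tri s x y z) = l * tri s x y z by ring.
  have [z0|z0] := leP z 0.
    have kz0 u : kernel s u z = 0.
      by rewrite /kernel (max_r z0) mulr0 mul0r min_l.
    by rewrite /tri !kz0 !mulr0.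
  have lz : kernel s (l * x) z = l * kernel s x z.
    have xz : x * z / s <= 1.
      by move: zr; rewrite /r ler_pdivlMr// ler_pdivrMr// mul1r mulrC.
    have lx0 : 0 <= l * x by rewrite mulr_ge0 ?(ltW l0) ?(ltW x0).
    rewrite /kernel (max_l (ltW z0)) (max_l lx0) (max_l (ltW x0)).
    have xz' : l * x * z / s <= 1.
      have -> : l * x * z / s = l * (x * z / s) by rewrite -!mulrA.
      apply: mulr_ile1 => //; [exact: ltW | | exact: ltW].
      by rewrite divr_ge0 ?mulr_ge0 ?(ltW x0) ?(ltW z0) ?(ltW s0).
    by rewrite !min_l//; ring.
  rewrite /tri lz mulrCA ler_wpM2l ?(ltW l0)// ler_wpM2r// ler_wpM2r//.
  exact: kernel_nd.
have : mean F U >= D s x / (1 + C') by rewrite ler_pdivrMr// mulrC.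
move=> H; apply: (le_trans DlU).
have -> : (1 - (1 - l) / (1 + C')) * D s x =
    D s x - (1 - l) * (D s x / (1 + C')) by ring.
by rewrite lerD2l lerN2 ler_wpM2l// subr_ge0 ltW.
Qed.

End lower_bounds.

(** * Polynomial orders of magnitude *)

Section exponents.
Context (R : realType).
Implicit Types (u v : nat -> R) (e x y : R).

(* [exp_le u e] and [exp_ge u e] stand for u(n) <= n^(e + o(1)) and
   u(n) >= n^(e + o(1)). *)
Definition exp_le u e := forall eps, 0 < eps ->
  \forall n \near \oo, u n <= n%:R `^ (e + eps).

Definition exp_ge u e := forall eps, 0 < eps ->
  \forall n \near \oo, n%:R `^ (e - eps) <= u n.

Lemma near_nat_gt0 : \forall n \near \oo, 0 < n%:R :> R.
Proof. by exists 1%N => // n /= n1; rewrite ltr0n. Qed.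

Lemma near_pow_ge (M : R) e : 0 < e -> \forall n \near \oo, M <= n%:R `^ e.
Proof.
move=> e0; near=> n.
have n0 : 0 < n%:R :> R by near: n; exact: near_nat_gt0.
have M1 : 0 < Num.max M 1 by rewrite lt_max ltr01 orbT.
apply: (@le_trans _ _ (Num.max M 1)); first by rewrite le_max lexx.
have -> : Num.max M 1 = (Num.max M 1 `^ e^-1) `^ e.
  by rewrite -powRrM mulVf ?gt_eqF// powRr1// ltW.
apply: ge0_ler_powR; rewrite ?nnegrE ?powR_ge0 ?ler0n//; first exact: ltW.
near: n; exists (Num.truncn (Num.max M 1 `^ e^-1)).+1 => // k /= hk.
rewrite ltW//; have /andP[_ h] := truncn_itv (powR_ge0 (Num.max M 1) e^-1).
by rewrite (lt_le_trans h)// ler_nat.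
Unshelve. all: by end_near. Qed.

Lemma exp_le_near u v e : (\forall n \near \oo, u n <= v n) -> exp_le v e ->
  exp_le u e.
Proof.
move=> uv H eps eps0; have := H _ eps0 => {}H; near=> n.
by apply: (@le_trans _ _ (v n)); near: n.
Unshelve. all: by end_near. Qed.

Lemma exp_ge_near u v e : (\forall n \near \oo, v n <= u n) -> exp_ge v e ->
  exp_ge u e.
Proof.
move=> uv H eps eps0; have := H _ eps0 => {}H; near=> n.
by apply: (@le_trans _ _ (v n)); near: n.
Unshelve. all: by end_near. Qed.

Lemma exp_le_pow e : exp_le (fun n => n%:R `^ e) e.
Proof.
move=> eps eps0; exists 1%N => // n /= n1.
by apply: ler_powR; [rewrite ler1n | rewrite lerDl ltW].
Qed.

Lemma exp_ge_pow e : exp_ge (fun n => n%:R `^ e) e.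
Proof.
move=> eps eps0; exists 1%N => // n /= n1.
by apply: ler_powR; [rewrite ler1n | rewrite gerBl ltW].
Qed.

Lemma exp_le_cst (C : R) : exp_le (fun=> C) 0.
Proof. by move=> eps eps0; rewrite add0r; exact: near_pow_ge. Qed.

Lemma exp_ge_cst (C : R) : 0 < C -> exp_ge (fun=> C) 0.
Proof.
move=> C0 eps eps0; rewrite sub0r; near=> n.
have n0 : 0 < n%:R :> R by near: n; exact: near_nat_gt0.
rewrite powRN -[leRHS]invrK lef_pV2 ?posrE ?powR_gt0 ?invr_gt0//.
by near: n; exact: near_pow_ge.
Unshelve. all: by end_near. Qed.

Lemma exp_leM u v x y : (\forall n \near \oo, 0 <= u n) ->
  (\forall n \near \oo, 0 <= v n) -> exp_le u x -> exp_le v y ->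
  exp_le (fun n => u n * v n) (x + y).
Proof.
move=> u0 v0 Hu Hv eps eps0; have e2 : 0 < eps / 2 by rewrite divr_gt0.
have {}Hu := Hu _ e2; have {}Hv := Hv _ e2; near=> n.
have n0 : 0 < n%:R :> R by near: n; exact: near_nat_gt0.
have -> : x + y + eps = (x + eps / 2) + (y + eps / 2) by field.
by rewrite -powR_addr//; apply: ler_pM; near: n.
Unshelve. all: by end_near. Qed.

Lemma exp_geM u v x y : exp_ge u x -> exp_ge v y ->
  exp_ge (fun n => u n * v n) (x + y).
Proof.
move=> Hu Hv eps eps0; have e2 : 0 < eps / 2 by rewrite divr_gt0.
have {}Hu := Hu _ e2; have {}Hv := Hv _ e2; near=> n.
have n0 : 0 < n%:R :> R by near: n; exact: near_nat_gt0.
have -> : x + y - eps = (x - eps / 2) + (y - eps / 2) by field.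
by rewrite -powR_addr//; apply: ler_pM; rewrite ?powR_ge0//; near: n.
Unshelve. all: by end_near. Qed.

Lemma exp_leD u v x : exp_le u x -> exp_le v x -> exp_le (fun n => u n + v n) x.
Proof.
move=> Hu Hv eps eps0; have e2 : 0 < eps / 2 by rewrite divr_gt0.
have {}Hu := Hu _ e2; have {}Hv := Hv _ e2; near=> n.
have n0 : 0 < n%:R :> R by near: n; exact: near_nat_gt0.
have -> : x + eps = eps / 2 + (x + eps / 2) by field.
rewrite -powR_addr//; apply: (@le_trans _ _ (2 * n%:R `^ (x + eps / 2))).
  rewrite [2](_ : _ = 1 + 1)// mulrDl mul1r.
  by apply: lerD; near: n.
rewrite ler_wpM2r ?powR_ge0//.
by near: n; exact: near_pow_ge.
Unshelve. all: by end_near. Qed.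

Lemma exp_geV u x : exp_ge u x -> exp_le (fun n => (u n)^-1) (- x).
Proof.
move=> Hu eps eps0; have {}Hu := Hu _ eps0; near=> n.
have n0 : 0 < n%:R :> R by near: n; exact: near_nat_gt0.
have H : n%:R `^ (x - eps) <= u n by near: n.
have u0 : 0 < u n by rewrite (lt_le_trans _ H)// powR_gt0.
have -> : - x + eps = - (x - eps) by ring.
by rewrite powRN lef_pV2 ?posrE ?powR_gt0.
Unshelve. all: by end_near. Qed.

Lemma exp_le_powR u x p : 0 < p -> (\forall n \near \oo, 0 <= u n) ->
  exp_le u x -> exp_le (fun n => u n `^ p) (p * x).
Proof.
move=> p0 u0 Hu eps eps0; have e2 : 0 < eps / p by rewrite divr_gt0.
have {}Hu := Hu _ e2; near=> n.
have -> : p * x + eps = (x + eps / p) * p by field; rewrite gt_eqF.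
rewrite powRrM; apply: ge0_ler_powR; rewrite ?nnegrE ?powR_ge0 ?(ltW p0)//.
  by near: n.
by near: n.
Unshelve. all: by end_near. Qed.

Lemma exp_ge_powR u x p : 0 < p -> exp_ge u x ->
  exp_ge (fun n => u n `^ p) (p * x).
Proof.
move=> p0 Hu eps eps0; have e2 : 0 < eps / p by rewrite divr_gt0.
have {}Hu := Hu _ e2; near=> n.
have H : n%:R `^ (x - eps / p) <= u n by near: n.
have -> : p * x - eps = (x - eps / p) * p by field; rewrite gt_eqF.
rewrite powRrM; apply: ge0_ler_powR; rewrite ?nnegrE ?powR_ge0 ?(ltW p0)//.
by rewrite (le_trans _ H)// powR_ge0.
Unshelve. all: by end_near. Qed.

Lemma exp_le_powN u x p : 0 < p -> exp_ge u x ->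
  exp_le (fun n => u n `^ (- p)) (- p * x).
Proof.
move=> p0 Hu; have := exp_geV (exp_ge_powR p0 Hu); rewrite mulNr.
by apply: exp_le_near; near=> n; rewrite powRN.
Unshelve. all: by end_near. Qed.

Lemma exp_geV' u x : (\forall n \near \oo, 0 < u n) -> exp_le u x ->
  exp_ge (fun n => (u n)^-1) (- x).
Proof.
move=> u0 Hu eps eps0; have {}Hu := Hu _ eps0; near=> n.
have n0 : 0 < n%:R :> R by near: n; exact: near_nat_gt0.
rewrite -opprD powRN lef_pV2 ?posrE ?powR_gt0//; near: n; assumption.
Unshelve. all: by end_near. Qed.

Lemma exp_ge_powN u x p : 0 < p -> (\forall n \near \oo, 0 < u n) -> exp_le u x ->
  exp_ge (fun n => u n `^ (- p)) (- p * x).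
Proof.
move=> p0 u0 Hu.
have u0' : \forall n \near \oo, 0 <= u n.
  by near=> n; rewrite ltW//; near: n.
have := exp_geV' _ (exp_le_powR p0 u0' Hu); rewrite mulNr => H.
apply: (exp_ge_near _ (H _)); first by near=> n; rewrite powRN.
by near=> n; rewrite powR_gt0//; near: n.
Unshelve. all: by end_near. Qed.

Lemma exp_le_weak u x y : x <= y -> exp_le u x -> exp_le u y.
Proof.
move=> xy Hu eps eps0; have {}Hu := Hu _ eps0; near=> n.
apply: (@le_trans _ _ (n%:R `^ (x + eps))); first by near: n.
apply: ler_powR; last by rewrite lerD2r.
by rewrite ler1n -(@ltr0n R); near: n; exact: near_nat_gt0.
Unshelve. all: by end_near. Qed.

Lemma exp_ge_weak u x y : y <= x -> exp_ge u x -> exp_ge u y.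
Proof.
move=> xy Hu eps eps0; have {}Hu := Hu _ eps0; near=> n.
apply: (@le_trans _ _ (n%:R `^ (x - eps))); last by near: n.
apply: ler_powR; last by rewrite lerD2r.
by rewrite ler1n -(@ltr0n R); near: n; exact: near_nat_gt0.
Unshelve. all: by end_near. Qed.

(** Moments are used at orders strictly below [alpha], so a bound is first proved with the exponent
    off by a multiple of [eta], which then tends to 0. The factor [C] may have any sign, whence the
    maximum with 1. *)
Lemma exp_le_limit u e (C eta0 : R) : 0 < eta0 ->
  (forall eta, 0 < eta -> eta < eta0 -> exp_le u (e + C * eta)) -> exp_le u e.
Proof.
move=> eta00 H eps eps0; pose C' := Num.max C 1.
have C'1 : 1 <= C' by rewrite le_max lexx orbT.
have C'0 : 0 < C' by rewrite (lt_le_trans ltr01).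
pose eta := Num.min (eta0 / 2) (eps / (2 * C')).
have eta_gt0 : 0 < eta by rewrite lt_min !divr_gt0// mulr_gt0.
have eta_lt : eta < eta0.
  by rewrite (@le_lt_trans _ _ (eta0 / 2))// ?ge_min ?lexx// ltr_pdivrMr// ltr_pMr// ltr1n.
have Ce : C * eta <= eps / 2.
  apply: (@le_trans _ _ (C' * eta)); first by rewrite ler_wpM2r ?(ltW eta_gt0)// le_max lexx.
  apply: (@le_trans _ _ (C' * (eps / (2 * C')))).
    by rewrite ler_wpM2l ?(ltW C'0)// ge_min lexx orbT.
  by rewrite le_eqVlt; apply/orP; left; apply/eqP; field; rewrite gt_eqF.
have e2 : 0 < eps / 2 by rewrite divr_gt0.
have := exp_le_weak _ (H eta eta_gt0 eta_lt) => /(_ (e + eps / 2)).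
rewrite lerD2l => /(_ Ce) /(_ _ e2).
by have -> : e + eps / 2 + eps / 2 = e + eps by field.
Qed.

Lemma exp_ge_limit u e (C eta0 : R) : 0 < eta0 ->
  (forall eta, 0 < eta -> eta < eta0 -> exp_ge u (e - C * eta)) -> exp_ge u e.
Proof.
move=> eta00 H eps eps0; pose C' := Num.max C 1.
have C'1 : 1 <= C' by rewrite le_max lexx orbT.
have C'0 : 0 < C' by rewrite (lt_le_trans ltr01).
pose eta := Num.min (eta0 / 2) (eps / (2 * C')).
have eta_gt0 : 0 < eta by rewrite lt_min !divr_gt0// mulr_gt0.
have eta_lt : eta < eta0.
  by rewrite (@le_lt_trans _ _ (eta0 / 2))// ?ge_min ?lexx// ltr_pdivrMr// ltr_pMr// ltr1n.
have Ce : C * eta <= eps / 2.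
  apply: (@le_trans _ _ (C' * eta)); first by rewrite ler_wpM2r ?(ltW eta_gt0)// le_max lexx.
  apply: (@le_trans _ _ (C' * (eps / (2 * C')))).
    by rewrite ler_wpM2l ?(ltW C'0)// ge_min lexx orbT.
  by rewrite le_eqVlt; apply/orP; left; apply/eqP; field; rewrite gt_eqF.
have e2 : 0 < eps / 2 by rewrite divr_gt0.
have := exp_ge_weak _ (H eta eta_gt0 eta_lt) => /(_ (e - eps / 2)).
rewrite lerD2l lerN2 => /(_ Ce) /(_ _ e2).
by have -> : e - eps / 2 - eps / 2 = e - eps by field.
Qed.

(** A strict gap between exponents beats every constant and both [o(1)] terms. It reduces the
    comparisons of orders below to linear or polynomial inequalities between [alpha], [beta] and
    [gamma]. *)
Lemma exp_lt u v x y : x < y -> exp_le u x -> exp_ge v y ->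
  forall k, 0 < k -> \forall n \near \oo, u n <= k * v n.
Proof.
move=> xy Hu Hv k k0; have e0 : 0 < (y - x) / 4 by rewrite divr_gt0// subr_gt0.
have {}Hu := Hu _ e0; have {}Hv := Hv _ e0; near=> n.
have n0 : 0 < n%:R :> R by near: n; exact: near_nat_gt0.
apply: (@le_trans _ _ (n%:R `^ (x + (y - x) / 4))); first by near: n.
apply: (@le_trans _ _ (k * n%:R `^ (y - (y - x) / 4))); last first.
  by rewrite ler_wpM2l ?(ltW k0)//; near: n.
have -> : y - (y - x) / 4 = (y - x) / 2 + (x + (y - x) / 4) by field.
rewrite -[X in _ <= _ * X]powR_addr// mulrA ler_peMl ?powR_ge0//.
rewrite mulrC -ler_pdivrMr// mul1r.
by near: n; apply: near_pow_ge; rewrite divr_gt0// subr_gt0.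
Unshelve. all: by end_near. Qed.

End exponents.

(** * Orders in [n] of the triangle means *)

Lemma card_card3_setsE n : #|card3_sets n| = 'C(n, 3).
Proof. by rewrite -[in RHS](card_ord n) -card_draws; apply: eq_card => t; rewrite !inE. Qed.

(** The constant 27 is attained at [n = 3]. *)
Lemma bin3_ge n : (2 < n)%N -> (n ^ 3 <= 27 * 'C(n, 3))%N.
Proof.
case: n => [|[|[|k]]]// _.
have H : ('C(k.+3, 3) * 6 = k.+3 * (k.+2 * k.+1))%N.
  by have := bin_ffact k.+3 3; rewrite !ffactnS ffactn0 /= muln1.
rewrite -(leq_pmul2r (_ : 0 < 6)%N)// -mulnA H !expnS expn0; nia.
Qed.

Ltac nonneg_tac := repeat first
  [done | apply: mulr_ge0 | apply: powR_ge0 | apply: exprn_ge0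
  | rewrite invr_ge0 | apply: moment_ge0].

Ltac pos_tac := repeat first [done | apply: addr_gt0 | apply: mulr_gt0].

Section exponent_facts.
Context (R : realType) (F : probability R R) (alpha mu : R).
Hypothesis alpha_gt : 4 / 3 < alpha.
Hypothesis alpha_lt : alpha < 2.
Hypothesis mu_gt0 : 0 < mu.
Local Notation G := (tail F).
Hypothesis G_gt0 : forall x : R, 0 < x -> 0 < G x.
Hypothesis G_regular : forall t : R, 0 < t ->
  G (t * x) / G x @[x --> +oo] --> t `^ (- alpha).
Local Notation s n := (mu * n%:R).
Local Notation M p := (mean F (@pos_pow R p)).

(** [tri_number] turns out to be [m_n], and [star_number], at a nonnegative weight, the quantity
    compared with [a m_n] in the definition of [c_a(n)]. *)
Definition tri_number n : R := 'C(n, 3)%:R * tri_total F (s n) (fun=> 1).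
Definition star_number n (w : R) : R :=
  2^-1 * n%:R ^+ 2 * tri_mean F (s n) (fun=> 1) w.

Let alpha_gt1 : 1 < alpha.
Proof. by rewrite (lt_trans _ alpha_gt)// ltr_pdivlMr// mul1r ltr_nat. Qed.
Let alpha_gt0 : 0 < alpha. Proof. by rewrite (lt_trans ltr01). Qed.

Let b1 := @bounded_meas_cst _ R R 1.
Let le1 : forall x : R, (0 : R) <= (1 : R) <= (1 : R).
Proof. by move=> _; rewrite ler01 lexx. Qed.

Lemma scale_gt0 n : (0 < n)%N -> 0 < s n.
Proof. by move=> n0; rewrite mulr_gt0// ltr0n. Qed.

Lemma near_scale_gt0 : \forall n \near \oo, 0 < s n.
Proof. by exists 1%N => // n /= n1; exact: scale_gt0. Qed.

Lemma near_scale_ge0 : \forall n \near \oo, 0 <= s n.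
Proof. by apply: nearW => n; rewrite mulr_ge0// ltW. Qed.

Lemma exp_le_nat : exp_le (fun n => n%:R : R) 1.
Proof.
apply: (exp_le_near _ (exp_le_pow 1)).
by apply: nearW => n; rewrite powRr1.
Qed.

Lemma exp_ge_nat : exp_ge (fun n => n%:R : R) 1.
Proof.
apply: (exp_ge_near _ (exp_ge_pow 1)).
by apply: nearW => n; rewrite powRr1.
Qed.

Lemma exp_le_natX k : exp_le (fun n => n%:R ^+ k : R) k%:R.
Proof.
apply: (exp_le_near _ (exp_le_pow k%:R)).
by apply: nearW => n; rewrite powR_mulrn.
Qed.

Lemma exp_ge_natX k : exp_ge (fun n => n%:R ^+ k : R) k%:R.
Proof.
apply: (exp_ge_near _ (exp_ge_pow k%:R)).
by apply: nearW => n; rewrite powR_mulrn.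
Qed.

Lemma exp_le_scale : exp_le (fun n => s n) 1.
Proof.
rewrite -[X in exp_le _ X]add0r.
apply: exp_leM; [| | exact: exp_le_cst | exact: exp_le_nat].
  by apply: nearW => _; exact: ltW.
by apply: nearW => n; exact: ler0n.
Qed.

Lemma exp_ge_scale : exp_ge (fun n => s n) 1.
Proof.
rewrite -[X in exp_ge _ X]add0r; apply: exp_geM; [exact: exp_ge_cst | exact: exp_ge_nat].
Qed.

Lemma exp_le_scaleN p : 0 < p -> exp_le (fun n => s n `^ (- p)) (- p).
Proof. by move=> p0; rewrite -[X in exp_le _ X]mulr1; exact: exp_le_powN exp_ge_scale. Qed.

Lemma nearW_powR_ge0 (u v : nat -> R) : \forall n \near \oo, 0 <= u n `^ v n.
Proof. by apply: nearW => n; exact: powR_ge0. Qed.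

Lemma exp_le_truncation beta e : exp_le (fun n => (n%:R `^ beta : R) `^ e) (beta * e).
Proof.
move=> eps eps0; have := exp_le_pow (beta * e) eps0.
by apply: filterS => n; rewrite powRrM.
Qed.

Lemma moment_finite p : 0 < p -> p < alpha -> integ F (@pos_pow R p).
Proof. exact: (integ_pos_pow G_gt0 G_regular). Qed.

(** The symmetric bound with [2 * p] just below [alpha]. The weight function may depend on [n], so
    the truncated mean is covered as well. *)
Lemma tri_total_weight_le (hb : nat -> R -> R) :
  (forall n, bounded_meas (hb n)) -> (forall n x, 0 <= hb n x <= 1) ->
  exp_le (fun n => n%:R ^+ 3 * tri_total F (s n) (hb n)) (3 - 3 / 2 * alpha).
Proof.
move=> bhb hb01; apply: (@exp_le_limit _ _ _ (3 / 2) 1) => // eta eta0 eta1.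
pose p := (alpha - eta) / 2.
have p0 : 0 < p by rewrite divr_gt0// subr_gt0 (lt_trans eta1).
have p1 : p <= 1 by rewrite /p; move: alpha_lt eta0; lra.
have p2 : 2 * p = alpha - eta by rewrite /p; field.
have i2 : integ F (@pos_pow R (2 * p)).
  by apply: moment_finite; rewrite p2; move: alpha_gt1 eta0 eta1; lra.
have -> : 3 - 3 / 2 * alpha + 3 / 2 * eta = 3%:R + (- (3 * p) + 0) by rewrite /p; field.
apply: (@exp_le_near _ _ (fun n => n%:R ^+ 3 * (s n `^ (- (3 * p)) * M (2 * p) ^+ 3))).
  near=> n; rewrite ler_wpM2l ?exprn_ge0//; apply: tri_total_upper => //.
    by near: n; exact: near_scale_gt0.
  by rewrite p0.
apply: exp_leM; [| | exact: exp_le_natX | apply: exp_leM].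
- by apply: nearW => n; rewrite exprn_ge0.
- by apply: nearW => n; rewrite mulr_ge0 ?powR_ge0// exprn_ge0// moment_ge0.
- exact: nearW_powR_ge0.
- by apply: nearW => n; rewrite exprn_ge0// moment_ge0.
- by apply: exp_le_scaleN; rewrite mulr_gt0.
- exact: exp_le_cst.
Unshelve. all: by end_near. Qed.

Lemma tri_number_le : exp_le tri_number (3 - 3 / 2 * alpha).
Proof.
apply: (exp_le_near _ (@tri_total_weight_le (fun _ _ => 1) _ _)) => //.
near=> n; rewrite /tri_number; apply: ler_wpM2r.
  apply: mean_ge0 => x; rewrite mul1r; apply: tri_mean_ge0 => //.
  by near: n; exact: near_scale_gt0.
by rewrite -card_card3_setsE -natrX ler_nat card_card3_sets.
Unshelve. all: by end_near. Qed.

Lemma tail_exp_ge (w : nat -> R) x : 0 <= x -> (\forall n \near \oo, 1 <= w n) ->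
  exp_le w x -> exp_ge (fun n => G (w n)) (- alpha * x).
Proof.
move=> x0 w1 Hw; apply: (@exp_ge_limit _ _ _ x 1) => // eta eta0 eta1.
have ap : alpha < alpha + eta by rewrite ltrDl.
have [k k0 H] := tail_ge_power alpha_gt0 G_gt0 G_regular ap.
have -> : - alpha * x - x * eta = 0 + (- (alpha + eta) * x) by ring.
apply: (@exp_ge_near _ _ (fun n => k * w n `^ (- (alpha + eta)))).
  by near=> n; apply: H; near: n.
apply: exp_geM; first exact: exp_ge_cst.
apply: exp_ge_powN => //; first by rewrite addr_gt0.
by near=> n; rewrite (lt_le_trans ltr01)//; near: n.
Unshelve. all: by end_near. Qed.

Lemma tail_exp_le (w : nat -> R) x : (\forall n \near \oo, 0 < w n) ->
  exp_ge w x -> exp_le (fun n => G (w n)) (- alpha * x).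
Proof.
move=> w1 Hw; apply: (@exp_le_limit _ _ _ x 1) => // eta eta0 eta1.
have p0 : 0 < alpha - eta by rewrite subr_gt0 (lt_trans eta1).
have pa : alpha - eta < alpha by rewrite gtrBl.
have -> : - alpha * x + x * eta = 0 + (- (alpha - eta) * x) by ring.
apply: (@exp_le_near _ _ (fun n => M (alpha - eta) * w n `^ (- (alpha - eta)))).
  by near=> n; apply: (tail_le_power G_gt0 G_regular) => //; near: n.
apply: exp_leM; [| | exact: exp_le_cst | exact: exp_le_powN].
- by apply: nearW => n; exact: moment_ge0.
- exact: nearW_powR_ge0.
Unshelve. all: by end_near. Qed.

Lemma near_ge_pow_of_exp_ge (u : nat -> R) x (k : R) : 0 < x -> exp_ge u x ->
  \forall n \near \oo, k <= u n.
Proof.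
move=> x0 Hu; have x2 : 0 < x / 2 by rewrite divr_gt0.
have {}Hu := Hu _ x2; near=> n; apply: (@le_trans _ _ (n%:R `^ (x - x / 2))).
  near: n; apply: near_pow_ge; rewrite (_ : x - x / 2 = x / 2)//; by field.
by near: n.
Unshelve. all: by end_near. Qed.

(** The triangles among vertices above the square root of [s] alone already reach the order of the
    upper bound. *)
Lemma tri_number_ge : exp_ge tri_number (3 - 3 / 2 * alpha).
Proof.
have tm (n : nat) : (2 < n)%N -> 27^-1 * n%:R ^+ 3 <= 'C(n, 3)%:R :> R.
  move=> n2; rewrite ler_pdivrMl// -natrX -natrM ler_nat.
  exact: bin3_ge.
pose r n : R := s n `^ (2^-1).
have rs n : r n ^+ 2 = s n.
  rewrite /r -powR_mulrn ?powR_ge0// -powRrM mulVf// powRr1// mulr_ge0//.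
  exact: ltW.
have r_le : exp_le r 2^-1.
  rewrite -[2^-1]mulr1; apply: exp_le_powR; rewrite ?invr_gt0//.
    exact: near_scale_ge0.
  exact: exp_le_scale.
have r_ge : exp_ge r 2^-1.
  rewrite -[2^-1]mulr1; apply: exp_ge_powR; rewrite ?invr_gt0//.
  exact: exp_ge_scale.
have Gr : exp_ge (fun n => G (r n)) (- alpha * 2^-1).
  apply: tail_exp_ge; rewrite ?invr_ge0//.
  by apply: near_ge_pow_of_exp_ge r_ge; rewrite invr_gt0.
have -> : 3 - 3 / 2 * alpha = (0 + 3%:R) +
  (- alpha * 2^-1 + (- alpha * 2^-1 + - alpha * 2^-1)) by field.
apply: (@exp_ge_near _ _ (fun n => (27^-1 * n%:R ^+ 3) *
  (G (r n) * (G (r n) * G (r n))))).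
  near=> n; rewrite /tri_number; apply: ler_pM.
  - by rewrite mulr_ge0 ?exprn_ge0// invr_ge0.
  - by rewrite !mulr_ge0 ?tail_ge0.
  - by apply: tm; near: n; exists 3%N.
  - have -> : G (r n) * (G (r n) * G (r n)) = G (r n) ^+ 3 by rewrite !exprS expr0 mulr1.
    apply: tri_total_lower; rewrite ?rs//.
    + by near: n; exact: near_scale_gt0.
    + by rewrite powR_gt0//; near: n; exact: near_scale_gt0.
apply: exp_geM; apply: exp_geM => //; first by apply: exp_ge_cst; rewrite invr_gt0.
  exact: exp_ge_natX.
exact: (exp_geM Gr Gr).
Unshelve. all: by end_near. Qed.

Ltac exp_le_tac := repeat match goal with
  | |- exp_le (fun n => ?c) _ => exact: exp_le_cst
  | |- exp_le (fun n => @GRing.mul _ _ _) _ => apply: exp_leM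
  | |- exp_le (fun n => @GRing.exp _ _ _) _ =>
      first [exact: exp_le_natX | exact: exp_le_cst]
  | |- exp_le (fun n => powR (powR _ _) _) _ => exact: exp_le_truncation
  | |- exp_le (fun n => powR _ _) _ =>
      first [by apply: exp_le_scaleN; pos_tac
        | by apply: exp_le_powR => //; pos_tac]
  | |- exp_le _ _ => exact: exp_le_cst
  | |- _ => by apply: nearW => ?; nonneg_tac
  end.

Lemma star_number_le (w : nat -> R) x : (\forall n \near \oo, 0 <= w n) ->
  exp_le w x ->
  exp_le (fun n => star_number n (w n)) (3 - 2 * alpha + (2 * alpha - 2) * x).
Proof.
move=> w0 Hw; apply: (@exp_le_limit _ _ _ (2 - 2 * x) ((alpha - 1) / 2)).
  by rewrite divr_gt0// subr_gt0.
(* The two neighbours get the power [1 + p], which must stay below [alpha]. *)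
move=> eta eta0 eta1; pose p := alpha - 1 - eta.
have p0 : 0 < p.
  rewrite subr_gt0 (lt_trans eta1)// ltr_pdivrMr// ltr_pMr ?subr_gt0//.
  by rewrite ltr1n.
have p1 : p <= 1 by rewrite /p; move: alpha_lt eta0; lra.
have i1 : integ F (@pos_pow R (1 + p)).
  by apply: moment_finite; [exact: addr_gt0 | rewrite /p; move: eta0; lra].
have -> : 3 - 2 * alpha + (2 * alpha - 2) * x + (2 - 2 * x) * eta =
  (0 + 2%:R) + (- (1 + 2 * p) + 0 + (2 * p) * x) by rewrite /p; ring.
apply: (@exp_le_near _ _ (fun n => (2^-1 * n%:R ^+ 2) *
  (s n `^ (- (1 + 2 * p)) * M (1 + p) ^+ 2 * w n `^ (2 * p)))).
  near=> n; rewrite /star_number ler_wpM2l ?mulr_ge0 ?invr_ge0 ?exprn_ge0//.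
  have -> : w n `^ (2 * p) = pos_pow (2 * p) (w n).
    by rewrite /pos_pow max_l//; near: n.
  apply: tri_mean_upper => //; last by rewrite p0.
  by near: n; exact: near_scale_gt0.
by exp_le_tac.
Unshelve. all: by end_near. Qed.

(** The range of [x] is that of [tri_mean_lower]: beyond 1/2 the scale [s n] is below the squared
    weight, and below 1 the quotient of [s n] by the weight tends to infinity, so the tail bounds
    apply to it. *)
Lemma star_number_pow_ge x : 1 / 2 < x -> x < 1 ->
  exp_ge (fun n => star_number n (n%:R `^ x)) (3 - 2 * alpha + (2 * alpha - 2) * x).
Proof.
move=> x12 x1; have x0 : 0 < x by rewrite (lt_trans _ x12)// divr_gt0.
pose w n : R := n%:R `^ x.
have w_gt0 : \forall n \near \oo, 0 < w n.
  by near=> n; rewrite powR_gt0//; near: n; exact: near_nat_gt0.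
have wle : exp_le w x by exact: exp_le_pow.
have wge : exp_ge w x by exact: exp_ge_pow.
have wi_le : exp_le (fun n => (w n)^-1) (- x) by exact: exp_geV.
have wi_ge : exp_ge (fun n => (w n)^-1) (- x) by exact: exp_geV'.
have r_le : exp_le (fun n => s n / w n) (1 - x).
  apply: exp_leM => //; [exact: near_scale_ge0 | | exact: exp_le_scale].
  by apply: nearW => n; rewrite invr_ge0 powR_ge0.
have r_ge : exp_ge (fun n => s n / w n) (1 - x).
  by apply: exp_geM => //; exact: exp_ge_scale.
have Gr : exp_ge (fun n => G (s n / w n)) (- alpha * (1 - x)).
  apply: tail_exp_ge => //; first by rewrite subr_ge0 ltW.
  by apply: near_ge_pow_of_exp_ge r_ge; rewrite subr_gt0.
have -> : 3 - 2 * alpha + (2 * alpha - 2) * x = (0 + 2%:R) +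
  ((1 + (- x + - x)) + (- alpha * (1 - x) + - alpha * (1 - x))) by ring.
have sw : \forall n \near \oo, s n <= 1 * (w n * w n).
  apply: (exp_lt _ exp_le_scale (exp_geM wge wge) ltr01).
  by move: x12; lra.
apply: (@exp_ge_near _ _ (fun n => (2^-1 * n%:R ^+ 2) *
  ((s n * ((w n)^-1 * (w n)^-1)) * (G (s n / w n) * G (s n / w n))))).
  near=> n; rewrite /star_number ler_wpM2l ?mulr_ge0 ?invr_ge0 ?exprn_ge0//.
  rewrite -/(w n).
  have -> : s n * ((w n)^-1 * (w n)^-1) * (G (s n / w n) * G (s n / w n)) =
      s n / w n ^+ 2 * G (s n / w n) ^+ 2 by rewrite !expr2 invfM.
  apply: tri_mean_lower.
  - by near: n; exact: near_scale_gt0.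
  - by near: n.
  - by rewrite expr2 -[leRHS]mul1r; near: n.
apply: exp_geM; first by apply: exp_geM; [apply: exp_ge_cst; rewrite invr_gt0|exact: exp_ge_natX].
apply: exp_geM; last exact: (exp_geM Gr Gr).
by apply: exp_geM; [exact: exp_ge_scale | exact: (exp_geM wi_ge wi_ge)].
Unshelve. all: by end_near. Qed.

Lemma cycle4_mean_nd n x y : (0 < n)%N -> x <= y ->
  cycle4_mean F (s n) x <= cycle4_mean F (s n) y.
Proof.
move=> n0 xy; have s0 := scale_gt0 n0.
have b3 x' : bounded3 (cycle4 (s n) x').
  split; last by move=> *; exact: cycle4_ge0.
  by apply: bounded_meas_cycle4 => //; meas; exact: measurable_cst.
apply: mean_le.
- by apply: bounded_integ; exact: bounded2_mean (bounded3_mean F (b3 x)).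
- by apply: bounded_integ; exact: bounded2_mean (bounded3_mean F (b3 y)).
move=> z; apply: mean_le.
- by apply: bounded_integ; exact: bounded2_at (bounded3_mean F (b3 x)).
- by apply: bounded_integ; exact: bounded2_at (bounded3_mean F (b3 y)).
move=> t; apply: mean_le.
- by apply: bounded_integ; exact: bounded2_at (bounded3_at z (b3 x)).
- by apply: bounded_integ; exact: bounded2_at (bounded3_at z (b3 y)).
move=> u; rewrite /cycle4; have k0 v v' : 0 <= kernel (s n) v v' by exact: kernel_ge0.
apply: ler_pM; rewrite ?mulr_ge0//; last first.
  by rewrite kernelC [leRHS]kernelC kernel_nd.
by rewrite ler_wpM2r// ler_wpM2r// kernel_nd.
Qed.

Lemma cycle4_mean_le (w : nat -> R) x : (\forall n \near \oo, 0 <= w n) ->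
  exp_le w x ->
  exp_le (fun n => n%:R ^+ 3 * cycle4_mean F (s n) (w n)) (3 - 2 * alpha + alpha * x).
Proof.
move=> w0 Hw; apply: (@exp_le_limit _ _ _ (2 - x) 1) => // eta eta0 eta1.
pose p := (alpha - eta) / 2.
have p0 : 0 < p by rewrite divr_gt0// subr_gt0 (lt_trans eta1).
have p1 : p <= 1 by rewrite /p; move: alpha_lt eta0; lra.
have p2 : 2 * p = alpha - eta by rewrite /p; field.
have i2 : integ F (@pos_pow R (2 * p)).
  by apply: moment_finite; rewrite p2; move: alpha_gt1 eta0 eta1; lra.
have -> : 3 - 2 * alpha + alpha * x + (2 - x) * eta =
   3%:R + (- (4 * p) + 0 + (2 * p) * x) by rewrite /p; field.
apply: (@exp_le_near _ _ (fun n => n%:R ^+ 3 *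
  (s n `^ (- (4 * p)) * M (2 * p) ^+ 3 * w n `^ (2 * p)))).
  near=> n; rewrite ler_wpM2l ?exprn_ge0//.
  have -> : w n `^ (2 * p) = pos_pow (2 * p) (w n).
    by rewrite /pos_pow max_l//; near: n.
  apply: cycle4_mean_upper => //; last by rewrite p0.
  by near: n; exact: near_scale_gt0.
by exp_le_tac.
Unshelve. all: by end_near. Qed.

Lemma mean_cycle4_le :
  exp_le (fun n => n%:R ^+ 4 * mean F (cycle4_mean F (s n))) (4 - 2 * alpha).
Proof.
apply: (@exp_le_limit _ _ _ 2 1) => // eta eta0 eta1.
pose p := (alpha - eta) / 2.
have p0 : 0 < p by rewrite divr_gt0// subr_gt0 (lt_trans eta1).
have p1 : p <= 1 by rewrite /p; move: alpha_lt eta0; lra.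
have p2 : 2 * p = alpha - eta by rewrite /p; field.
have i2 : integ F (@pos_pow R (2 * p)).
  by apply: moment_finite; rewrite p2; move: alpha_gt1 eta0 eta1; lra.
have -> : 4 - 2 * alpha + 2 * eta = 4%:R + (- (4 * p) + 0) by rewrite /p; field.
apply: (@exp_le_near _ _ (fun n => n%:R ^+ 4 *
  (s n `^ (- (4 * p)) * (M (2 * p) ^+ 3 * M (2 * p))))).
  near=> n; rewrite ler_wpM2l ?exprn_ge0//.
  have sn : 0 < s n by near: n; exact: near_scale_gt0.
  rewrite mulrA -meanZ//; apply: mean_le.
  - by apply: bounded_integ; exact: bounded_meas_cycle4_mean.
  - exact: integZ.
  by move=> x; apply: cycle4_mean_upper => //; rewrite p0.
by exp_le_tac.
Unshelve. all: by end_near. Qed.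

Variable beta : R.
Local Notation b n := (n%:R `^ beta).

Let b_gt0 : \forall n \near \oo, 0 < b n :> R.
Proof.
by near=> n; rewrite powR_gt0//; near: n; exact: near_nat_gt0.
Unshelve. all: by end_near. Qed.

Lemma square_trunc_le :
  exp_le (fun n => n%:R ^+ 5 * mean F (fun x => trunc (b n) x *
      tri_mean F (s n) (trunc (b n)) x ^+ 2))
    (7 - 4 * alpha + beta * (3 * alpha - 4)).
Proof.
(* This range of [eta] keeps [q < 4 * p] below; it is nonempty because [alpha] exceeds 4/3. *)
apply: (@exp_le_limit _ _ _ (4 - 3 * beta) ((3 * alpha - 4) / 6)).
  by rewrite divr_gt0//; move: alpha_gt; lra.
move=> eta eta0 eta1; pose p := alpha - 1 - eta; pose q := alpha - eta.
have p0 : 0 < p by rewrite /p; move: alpha_gt alpha_lt eta0 eta1; lra.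
have p1 : p <= 1 by rewrite /p; move: alpha_lt eta0; lra.
have q0 : 0 < q by rewrite /q; move: alpha_gt alpha_lt eta0 eta1; lra.
have qp : q < 4 * p by rewrite /q /p; move: alpha_gt alpha_lt eta0 eta1; lra.
have i1 : integ F (@pos_pow R (1 + p)).
  by apply: moment_finite; [exact: addr_gt0 | rewrite /p; move: eta0; lra].
have iq : integ F (@pos_pow R q) by apply: moment_finite => //; rewrite /q; move: eta0; lra.
have -> : 7 - 4 * alpha + beta * (3 * alpha - 4) + (4 - 3 * beta) * eta =
  5%:R + (- (2 + 4 * p) + 0 + beta * (4 * p - q) + 0) by rewrite /p /q; ring.
apply: (@exp_le_near _ _ (fun n => n%:R ^+ 5 * (s n `^ (- (2 + 4 * p)) *
  M (1 + p) ^+ 4 * b n `^ (4 * p - q) * M q))).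
  near=> n; rewrite ler_wpM2l ?exprn_ge0//; apply: tri_square_upper => //.
  - by near: n; exact: near_scale_gt0.
  - exact: bounded_meas_trunc.
  - by move=> x; rewrite trunc_ge0 trunc_le1.
  - by near: n.
  - by rewrite p0.
by exp_le_tac.
Unshelve. all: by end_near. Qed.

Lemma trunc_loss_le :
  exp_le (fun n => n%:R ^+ 3 *
      (tri_total F (s n) (fun=> 1) - tri_total F (s n) (trunc (b n))))
    (4 - 2 * alpha + beta * (alpha - 2)).
Proof.
apply: (@exp_le_limit _ _ _ (2 - beta) ((alpha - 1) / 2)).
  by rewrite divr_gt0// subr_gt0.
move=> eta eta0 eta1; pose p := alpha - 1 - eta; pose q := alpha - eta.
have p0 : 0 < p by rewrite /p; move: alpha_gt alpha_lt eta0 eta1; lra.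
have p1 : p <= 1 by rewrite /p; move: alpha_lt eta0; lra.
have q0 : 0 < q by rewrite /q; move: alpha_gt alpha_lt eta0 eta1; lra.
have qp : 2 * p <= q by rewrite /q /p; move: alpha_gt alpha_lt eta0 eta1; lra.
have i1 : integ F (@pos_pow R (1 + p)).
  by apply: moment_finite; [exact: addr_gt0 | rewrite /p; move: eta0; lra].
have iq : integ F (@pos_pow R q) by apply: moment_finite => //; rewrite /q; move: eta0; lra.
have -> : 4 - 2 * alpha + beta * (alpha - 2) + (2 - beta) * eta =
  3%:R + (0 + (- (1 + 2 * p) + beta * (2 * p - q) + 0)) by rewrite /p /q; ring.
apply: (@exp_le_near _ _ (fun n => n%:R ^+ 3 * (3 * (s n `^ (- (1 + 2 * p)) *
  b n `^ (2 * p - q) * (M q * M (1 + p) * M (1 + p)))))).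
  near=> n; rewrite ler_wpM2l ?exprn_ge0// lerBlDl.
  apply: tri_total_trunc_lower => //.
  - by near: n; exact: near_scale_gt0.
  - by near: n.
  - by rewrite p0.
by exp_le_tac.
Unshelve. all: by end_near. Qed.

End exponent_facts.

(** * The order of the threshold *)

Section threshold_exponent.
Context (R : realType) (F : probability R R) (alpha mu : R).
Hypothesis alpha_gt : 4 / 3 < alpha.
Hypothesis alpha_lt : alpha < 2.
Hypothesis mu_gt0 : 0 < mu.
Local Notation G := (tail F).
Hypothesis G_gt0 : forall x : R, 0 < x -> 0 < G x.
Hypothesis G_regular : forall t : R, 0 < t ->
  G (t * x) / G x @[x --> +oo] --> t `^ (- alpha).
Local Notation s n := (mu * n%:R).
Local Notation m := (tri_number F mu).
Local Notation D := (star_number F mu).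

(* c_a(n) = n^(gamma + o(1)): the order 3 - 2 alpha + (2 alpha - 2) x of the mean
   number of triangles at a vertex of weight n^x reaches the order
   3 - 3 alpha / 2 of m_n at x = gamma. *)
Variable gamma : R.
Hypothesis gammaE : 4 * gamma * (alpha - 1) = alpha.

Lemma alpha_gammaE : alpha * gamma = gamma + alpha / 4.
Proof. by rewrite -[in RHS]gammaE; field. Qed.

(** With denominators cleared, the third bound is [0 < (2 - alpha) ^+ 2] and the fourth
    [0 < (2 - alpha) * (5 * alpha - 6)]. The third makes the expected number of vertices above the
    threshold tend to 0; the fourth is needed for the pairs of triangles with a common edge. *)
Lemma gamma_bounds : [/\ 1 / 2 < gamma, gamma < 1, 1 < alpha * gamma &
  alpha * gamma < 3 - alpha].
Proof.
have a1 : 0 < alpha - 1 by rewrite subr_gt0 (lt_trans _ alpha_gt)// ltr_pdivlMr// mul1r ltr_nat.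
have gE : gamma = alpha / (4 * (alpha - 1)).
  apply: (canRL (mulfK _)); first by rewrite gt_eqF// mulr_gt0.
  by rewrite -[RHS]gammaE; ring.
have d0 : 0 < 4 * (alpha - 1) by rewrite mulr_gt0.
split.
- by rewrite gE ltr_pdivlMr//; move: alpha_lt; lra.
- by rewrite gE ltr_pdivrMr//; move: alpha_gt; lra.
- rewrite gE mulrA ltr_pdivlMr//.
  have : 0 < (2 - alpha) ^+ 2 by rewrite exprn_gt0// subr_gt0.
  by move: alpha_gt alpha_lt; nra.
- rewrite gE mulrA ltr_pdivrMr//.
  have : 0 < (2 - alpha) * (5 * alpha - 6).
    by rewrite mulr_gt0// subr_gt0//; move: alpha_gt; lra.
  by move: alpha_gt alpha_lt; nra.
Qed.

(** Apart from [beta < gamma], all the inequalities are strict at [beta = gamma]. The four entries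
    of the minimum [d] are fractions of their slacks, and [alpha < 2] bounds [alpha * d] by
    [2 * d]. *)
Lemma beta_exists : exists beta, [/\ beta < gamma, 1 / 2 < beta,
  2 * (1 - alpha * beta) < 1 - alpha * gamma,
  alpha * gamma - alpha * beta < 3 - alpha - alpha * gamma &
  alpha * gamma - alpha * beta < 3 - 3 / 2 * alpha].
Proof.
have [g1 g2 g3 g4] := gamma_bounds.
pose d := Num.min (Num.min ((alpha * gamma - 1) / 8) ((gamma - 1 / 2) / 2))
  (Num.min ((3 - alpha - alpha * gamma) / 4) ((2 - alpha) / 4)).
have d0 : 0 < d.
  by rewrite !lt_min !divr_gt0//; move: g1 g3 g4 alpha_lt; lra.
have [d1 d2 d3 d4] : [/\ d <= (alpha * gamma - 1) / 8, d <= (gamma - 1 / 2) / 2,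
  d <= (3 - alpha - alpha * gamma) / 4 & d <= (2 - alpha) / 4].
  by rewrite /d !ge_min !lexx !orbT.
clearbody d; have ad : alpha * d < 2 * d by rewrite ltr_pM2r.
exists (gamma - d); rewrite [alpha * (_ - _)]mulrBr; move: alpha_lt g1 g3 g4 d0 d1 d2 d3 d4 ad.
move: (alpha * d) (alpha * gamma) => ad ag.
by move=> *; split; lra.
Qed.

Variable a : R.
Hypothesis a_gt0 : 0 < a.

Lemma tri_number_gt0 : \forall n \near \oo, 0 < m n.
Proof.
have := tri_number_ge alpha_gt mu_gt0 G_gt0 G_regular.
move=> /(_ _ ltr01) H; near=> n.
have n0 : 0 < n%:R :> R by near: n; exact: near_nat_gt0.
by rewrite (@lt_le_trans _ _ (n%:R `^ (3 - 3 / 2 * alpha - 1)))// ?powR_gt0//; near: n.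
Unshelve. all: by end_near. Qed.

(** The exponents of the two sides differ by [2 * (alpha - 1) * (x - gamma)]. *)
Lemma star_number_above x : gamma < x -> x < 1 ->
  \forall n \near \oo, a * m n <= D n (n%:R `^ x).
Proof.
move=> gx x1; have [g1 g2 g3 g4] := gamma_bounds.
have a1 : 0 < alpha - 1 by rewrite subr_gt0 (lt_trans _ alpha_gt)// ltr_pdivlMr// mul1r ltr_nat.
have H : 3 - 3 / 2 * alpha < 3 - 2 * alpha + (2 * alpha - 2) * x.
  have : 0 < (alpha - 1) * (x - gamma) by rewrite mulr_gt0// subr_gt0.
  by move: alpha_gammaE; nra.
have x12 : 1 / 2 < x by rewrite (lt_trans g1).
have ai : 0 < a^-1 by rewrite invr_gt0.
have := exp_lt H (tri_number_le alpha_gt alpha_lt mu_gt0 G_gt0 G_regular)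
  (star_number_pow_ge alpha_gt mu_gt0 G_gt0 G_regular x12 x1) ai.
by apply: filterS => n; rewrite ler_pdivlMl.
Qed.

Lemma star_number_below x : 0 < x -> x < gamma ->
  \forall n \near \oo, D n (n%:R `^ x) < a * m n.
Proof.
move=> x0 gx.
have a1 : 0 < alpha - 1 by rewrite subr_gt0 (lt_trans _ alpha_gt)// ltr_pdivlMr// mul1r ltr_nat.
have H : 3 - 2 * alpha + (2 * alpha - 2) * x < 3 - 3 / 2 * alpha.
  have : 0 < (alpha - 1) * (gamma - x) by rewrite mulr_gt0// subr_gt0.
  by move: alpha_gammaE; nra.
have a2 : 0 < a / 2 by rewrite divr_gt0.
have w0 : \forall n \near \oo, 0 <= n%:R `^ x :> R.
  by apply: nearW => n; exact: powR_ge0.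
have h := exp_lt H (star_number_le alpha_gt alpha_lt mu_gt0 G_gt0 G_regular w0
  (@exp_le_pow R x)) (tri_number_ge alpha_gt mu_gt0 G_gt0 G_regular) a2.
near=> n; apply: (@le_lt_trans _ _ (a / 2 * m n)); first by near: n.
have m0 : 0 < m n by near: n; exact: tri_number_gt0.
by rewrite ltr_pM2r// ltr_pdivrMr// ltr_pMr// ltr1n.
Unshelve. all: by end_near. Qed.

Variable c : nat -> R.
Hypothesis c_below : \forall n \near \oo, forall w, 0 <= w -> w < c n ->
  D n w < a * m n.
Hypothesis c_above : \forall n \near \oo, forall w, c n < w -> a * m n <= D n w.

(** Were [c n] larger than [n^x] for some [x] slightly above [gamma], the star mean at [n^x] would
    still be below [a * m n], against [star_number_above]. The test exponent is kept below 1, where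
    that lemma applies. *)
Lemma threshold_le : exp_le c gamma.
Proof.
have [g1 g2 g3 g4] := gamma_bounds.
move=> eps eps0; pose x := gamma + Num.min eps ((1 - gamma) / 2).
have gx : gamma < x by rewrite ltrDl lt_min eps0 divr_gt0// subr_gt0.
have xe : x <= gamma + eps by rewrite lerD2l ge_min lexx.
have x1 : x < 1.
  have : Num.min eps ((1 - gamma) / 2) <= (1 - gamma) / 2 by rewrite ge_min lexx orbT.
  by rewrite /x; move: (Num.min _ _) => y; move: g2; lra.
have A := star_number_above gx x1; near=> n.
have n1 : 1 <= n%:R :> R.
  by rewrite ler1n -(@ltr0n R); near: n; exact: near_nat_gt0.
apply: (@le_trans _ _ (n%:R `^ x)); last exact: ler_powR.
rewrite leNgt; apply/negP => xc.
have : D n (n%:R `^ x) < a * m n.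
  have H : forall w, 0 <= w -> w < c n -> D n w < a * m n by near: n.
  by apply: H; first exact: powR_ge0.
by rewrite ltNge => /negP; apply; near: n.
Unshelve. all: by end_near. Qed.

Lemma threshold_ge : exp_ge c gamma.
Proof.
have [g1 g2 g3 g4] := gamma_bounds.
move=> eps eps0; pose x := gamma - Num.min eps (1 / 4).
have gx : x < gamma by rewrite gtrBl lt_min eps0 divr_gt0.
have xe : gamma - eps <= x by rewrite lerD2l lerN2 ge_min lexx.
have x0 : 0 < x.
  have : Num.min eps (1 / 4) <= 1 / 4 by rewrite ge_min lexx orbT.
  by rewrite /x; move: g1; move: (Num.min _ _) => y; lra.
have A := star_number_below x0 gx; near=> n.
have n1 : 1 <= n%:R :> R.
  by rewrite ler1n -(@ltr0n R); near: n; exact: near_nat_gt0.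
apply: (@le_trans _ _ (n%:R `^ x)); first exact: ler_powR.
rewrite leNgt; apply/negP => xc.
have : a * m n <= D n (n%:R `^ x).
  have H : forall w, c n < w -> a * m n <= D n w by near: n.
  exact: H.
by rewrite leNgt => /negP; apply; near: n.
Unshelve. all: by end_near. Qed.

Lemma threshold_large k : \forall n \near \oo, k <= c n.
Proof.
have [g1 _ _ _] := gamma_bounds.
by apply: near_ge_pow_of_exp_ge threshold_ge; rewrite (lt_trans _ g1)// divr_gt0.
Qed.

Lemma near_threshold_gt0 : \forall n \near \oo, 0 < c n.
Proof. by apply: filterS (threshold_large 1) => n; exact: lt_le_trans. Qed.

(** Because [gamma < 1]. This is what makes [tri_mean_strict] applicable at weights comparable to
    the threshold. *)
Lemma scale_over_threshold k : \forall n \near \oo, k <= s n / c n.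
Proof.
have [_ g2 _ _] := gamma_bounds.
have H : exp_ge (fun n => s n / c n) (1 - gamma).
  apply: exp_geM; first exact: exp_ge_scale.
  by apply: exp_geV' threshold_le; exact: near_threshold_gt0.
by apply: near_ge_pow_of_exp_ge H; rewrite subr_gt0.
Qed.

Lemma tail_threshold_ge : exp_ge (fun n => G (c n)) (- alpha * gamma).
Proof.
have [g1 _ _ _] := gamma_bounds.
apply: (tail_exp_ge alpha_gt G_gt0 G_regular).
- by rewrite ltW// (lt_trans _ g1)// divr_gt0.
- exact: threshold_large.
- exact: threshold_le.
Qed.

Variable beta : R.
Hypothesis beta_lt : beta < gamma.
Hypothesis beta_gt : 1 / 2 < beta.
Hypothesis beta_two : 2 * (1 - alpha * beta) < 1 - alpha * gamma.
Hypothesis beta_star : alpha * gamma - alpha * beta < 3 - alpha - alpha * gamma.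
Hypothesis beta_star' : alpha * gamma - alpha * beta < 3 - 3 / 2 * alpha.
Local Notation b n := (n%:R `^ beta).

Definition variance_bound n : R :=
  n%:R ^+ 5 * mean F (fun x => trunc (b n) x * tri_mean F (s n) (trunc (b n)) x ^+ 2) +
  n%:R ^+ 4 * mean F (cycle4_mean F (s n)) + n%:R ^+ 3 * tri_total F (s n) (trunc (b n)).

Lemma truncation_lt (l : R) : 0 < l -> \forall n \near \oo, b n <= l * c n.
Proof. by move=> l0; apply: (exp_lt beta_lt (@exp_le_pow R beta) threshold_ge l0). Qed.

Lemma tail_truncation_le : exp_le (fun n => G (b n)) (- alpha * beta).
Proof.
apply: (tail_exp_le alpha_gt G_gt0 G_regular); last exact: exp_ge_pow.
by near=> n; rewrite powR_gt0//; near: n; exact: near_nat_gt0.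
Unshelve. all: by end_near. Qed.

Lemma tri_square_ge : exp_ge (fun n => m n * m n) (6 - 3 * alpha).
Proof.
have H := tri_number_ge alpha_gt mu_gt0 G_gt0 G_regular.
have -> : 6 - 3 * alpha = (3 - 3 / 2 * alpha) + (3 - 3 / 2 * alpha) by field.
exact: (exp_geM H H).
Qed.

(** [e] is the exponent of [n%:R * G (c n) * (m n * m n)], the size that Chebyshev's inequality can
    afford. The three terms of the variance are compared with it separately. *)
Lemma variance_exponent e : 6 - 3 * alpha + 1 - alpha * gamma = e ->
  exists2 x, x < e & exp_le variance_bound x.
Proof.
move=> <-; have [g1 g2 g3 g4] := gamma_bounds.
have H1 := square_trunc_le alpha_gt alpha_lt mu_gt0 G_gt0 G_regular beta.
have H2 := mean_cycle4_le alpha_gt alpha_lt mu_gt0 G_gt0 G_regular.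
have H3 := tri_total_weight_le alpha_gt alpha_lt mu_gt0 G_gt0 G_regular
  (hb := fun n => trunc (b n)) (fun n => bounded_meas_trunc _).
have {}H3 := H3 (fun n x => introT andP (conj (trunc_ge0 _ x) (trunc_le1 _ x))).
pose x := Num.max (Num.max (7 - 4 * alpha + beta * (3 * alpha - 4)) (4 - 2 * alpha))
  (3 - 3 / 2 * alpha).
exists x; last first.
  apply: exp_leD; first apply: exp_leD.
  - by apply: exp_le_weak H1; rewrite !le_max lexx.
  - by apply: exp_le_weak H2; rewrite !le_max lexx orbT.
  - by apply: exp_le_weak H3; rewrite !le_max lexx !orbT.
(* The tight term: with [gamma] in place of [beta] its exponent would equal [e], by [gammaE], so
   strictness comes from [beta < gamma] alone. *)
have b3 : beta * (3 * alpha - 4) < gamma * (3 * alpha - 4).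
  by rewrite ltr_pM2r// subr_gt0; move: alpha_gt; lra.
have gg : gamma * (3 * alpha - 4) = 3 * (alpha * gamma) - 4 * gamma by ring.
have agE := alpha_gammaE.
rewrite /x !gt_max; move: b3 gg agE g1 g2 g3 g4 alpha_gt alpha_lt.
move: (gamma * (3 * alpha - 4)) (beta * (3 * alpha - 4)) (alpha * gamma) => u v w.
by move=> *; apply/andP; split; first (apply/andP; split); lra.
Qed.

Lemma variance_small k : 0 < k ->
  \forall n \near \oo, variance_bound n <= k * (n%:R * G (c n) * (m n * m n)).
Proof.
have [x xe H] := variance_exponent erefl; apply: (exp_lt xe H).
have -> : 6 - 3 * alpha + 1 - alpha * gamma =
  (1 + - alpha * gamma) + (6 - 3 * alpha) by ring.
apply: exp_geM; last exact: tri_square_ge.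
by apply: exp_geM; [exact: exp_ge_nat | exact: tail_threshold_ge].
Qed.

Lemma near_variance_ge0 : \forall n \near \oo, 0 <= variance_bound n.
Proof.
near=> n; have sn : 0 < s n by near: n; exact: (near_scale_gt0 mu_gt0).
have D0 x : 0 <= tri_mean F (s n) (trunc (b n)) x.
  by apply: tri_mean_ge0 => //; exact: trunc_ge0.
rewrite !addr_ge0//; apply: mulr_ge0; rewrite ?exprn_ge0//; apply: mean_ge0 => x.
- by rewrite mulr_ge0 ?trunc_ge0 ?exprn_ge0.
- exact: cycle4_mean_ge0.
- by rewrite mulr_ge0 ?trunc_ge0.
Unshelve. all: by end_near. Qed.

(** Given the bound on the variance itself, it is enough that [n * G (b n)] tends to 0, that is
    [1 < alpha * beta]; this follows from [beta_two] and [1 < alpha * gamma]. *)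
Lemma tail_variance_small k : 0 < k ->
  \forall n \near \oo, G (b n) * variance_bound n <= k * (G (c n) * (m n * m n)).
Proof.
have [x xe H] := variance_exponent erefl.
have Y : exp_ge (fun n => G (c n) * (m n * m n)) (- alpha * gamma + (6 - 3 * alpha)).
  by apply: exp_geM; [exact: tail_threshold_ge | exact: tri_square_ge].
have X : exp_le (fun n => G (b n) * variance_bound n) (- alpha * beta + x).
  apply: exp_leM => //; last exact: tail_truncation_le.
  - by apply: nearW => n; exact: tail_ge0.
  - exact: near_variance_ge0.
apply: (exp_lt _ X Y).
have [_ _ g3 _] := gamma_bounds.
move: xe beta_two g3; rewrite !mulNr.
move: (alpha * gamma) (alpha * beta) => u v *; lra.
Qed.

Lemma two_large_small k : 0 < k ->
  \forall n \near \oo, n%:R ^+ 2 * (G (b n) * G (b n)) <= k * (n%:R * G (c n)).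
Proof.
have H := tail_truncation_le.
have G0 : \forall n \near \oo, 0 <= G (b n) by apply: nearW => n; exact: tail_ge0.
have X : exp_le (fun n => n%:R ^+ 2 * (G (b n) * G (b n)))
    (2%:R + (- alpha * beta + - alpha * beta)).
  apply: exp_leM; [| | exact: exp_le_natX | exact: (exp_leM G0 G0 H H)].
  - by apply: nearW => n; rewrite exprn_ge0.
  - by apply: nearW => n; rewrite mulr_ge0// tail_ge0.
have Y : exp_ge (fun n => n%:R * G (c n)) (1 + - alpha * gamma).
  by apply: exp_geM; [exact: exp_ge_nat | exact: tail_threshold_ge].
apply: (exp_lt _ X Y); move: beta_two; rewrite !mulNr.
move: (alpha * gamma) (alpha * beta) => u v *; lra.
Qed.

(** The 4-cycle term needs exactly [beta_star], and the term from single triangles exactly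
    [beta_star'] once [gammaE] is inserted. *)
Lemma star_variance_small K k : 0 < K -> 0 < k ->
  \forall n \near \oo, G (b n) * (n%:R ^+ 3 * cycle4_mean F (s n) (K * c n) +
    n%:R ^+ 2 * tri_mean F (s n) (fun=> 1) (K * c n)) <= k * (G (c n) * (m n * m n)).
Proof.
move=> K0; have [g1 _ g3 g4] := gamma_bounds.
have Kc0 : \forall n \near \oo, 0 <= K * c n.
  by near=> n; rewrite mulr_ge0 ?(ltW K0)// ltW//; near: n; exact: near_threshold_gt0.
have Kc : exp_le (fun n => K * c n) gamma.
  rewrite -[gamma]add0r; apply: exp_leM; [| | exact: exp_le_cst | exact: threshold_le].
    by apply: nearW => _; exact: ltW.
  by near=> n; rewrite ltW//; near: n; exact: near_threshold_gt0.
have H1 := cycle4_mean_le alpha_gt alpha_lt mu_gt0 G_gt0 G_regular Kc0 Kc.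
have H2 : exp_le (fun n => n%:R ^+ 2 * tri_mean F (s n) (fun=> 1) (K * c n))
    (0 + (3 - 2 * alpha + (2 * alpha - 2) * gamma)).
  apply: (@exp_le_near _ _ (fun n => 2 * D n (K * c n))).
    by apply: nearW => n; rewrite /star_number !mulrA divff// mul1r.
  apply: exp_leM; [| | exact: exp_le_cst |].
  - by apply: nearW.
  - near=> n; rewrite !mulr_ge0 ?invr_ge0 ?exprn_ge0//.
    by apply: tri_mean_ge0 => //; near: n; exact: (near_scale_gt0 mu_gt0).
  - exact: (star_number_le alpha_gt alpha_lt mu_gt0 G_gt0 G_regular Kc0 Kc).
pose x := Num.max (3 - 2 * alpha + alpha * gamma)
  (0 + (3 - 2 * alpha + (2 * alpha - 2) * gamma)).
have H : exp_le (fun n => n%:R ^+ 3 * cycle4_mean F (s n) (K * c n) +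
    n%:R ^+ 2 * tri_mean F (s n) (fun=> 1) (K * c n)) x.
  apply: exp_leD.
    by apply: exp_le_weak H1; rewrite !le_max lexx.
  by apply: exp_le_weak H2; rewrite !le_max lexx orbT.
have Y : exp_ge (fun n => G (c n) * (m n * m n)) (- alpha * gamma + (6 - 3 * alpha)).
  by apply: exp_geM; [exact: tail_threshold_ge | exact: tri_square_ge].
have X : exp_le (fun n => G (b n) * (n%:R ^+ 3 * cycle4_mean F (s n) (K * c n) +
    n%:R ^+ 2 * tri_mean F (s n) (fun=> 1) (K * c n))) (- alpha * beta + x).
  apply: exp_leM => //; last exact: tail_truncation_le.
  - by apply: nearW => n; exact: tail_ge0.
  - near=> n; have sn : 0 < s n by near: n; exact: (near_scale_gt0 mu_gt0).
    apply: addr_ge0; apply: mulr_ge0; [exact: exprn_ge0| |exact: exprn_ge0|].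
      exact: cycle4_mean_ge0.
    by apply: tri_mean_ge0 => //.
apply: (exp_lt _ X Y).
rewrite -ltrBrDl /x gt_max; move: beta_star beta_star' alpha_gammaE.
have -> : (2 * alpha - 2) * gamma = 2 * (alpha * gamma) - 2 * gamma by ring.
rewrite !mulNr; move: (alpha * gamma) (alpha * beta) => u v *.
by apply/andP; split; lra.
Unshelve. all: by end_near. Qed.

(** The exponents differ by [(2 - alpha) * (beta - 1 / 2)]: a cut above the typical weight [n^(1/2)]
    of a triangle loses a negligible part of the mean. *)
Lemma trunc_loss_small k : 0 < k ->
  \forall n \near \oo, n%:R ^+ 3 *
      (tri_total F (s n) (fun=> 1) - tri_total F (s n) (trunc (b n))) <= k * m n.
Proof.
apply: (exp_lt _ (trunc_loss_le alpha_gt alpha_lt mu_gt0 G_gt0 G_regular beta)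
  (tri_number_ge alpha_gt mu_gt0 G_gt0 G_regular)).
have : 0 < (2 - alpha) * (beta - 1 / 2) by rewrite mulr_gt0// subr_gt0.
by nra.
Qed.

End threshold_exponent.

Section threshold_asymptotics.
Context (R : realType) (F : probability R R) (alpha mu a : R).
Hypothesis alpha_gt : 4 / 3 < alpha.
Hypothesis alpha_lt : alpha < 2.
Hypothesis mu_gt0 : 0 < mu.
Local Notation G := (tail F).
Hypothesis G_gt0 : forall x : R, 0 < x -> 0 < G x.
Hypothesis G_regular : forall t : R, 0 < t ->
  G (t * x) / G x @[x --> +oo] --> t `^ (- alpha).
Hypothesis a_gt0 : 0 < a.
Local Notation s n := (mu * n%:R).
Local Notation m := (tri_number F mu).
Local Notation D := (star_number F mu).

Let gammaE : 4 * (alpha / (4 * (alpha - 1))) * (alpha - 1) = alpha.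
Proof. by field; rewrite gt_eqF// subr_gt0; move: alpha_gt; lra. Qed.

(** The witness is [n^x] with [x] halfway between [gamma] and 1. It shows that the set whose infimum
    is the threshold is nonempty for large [n]. *)
Lemma star_number_exceeds : \forall n \near \oo, exists2 w, 0 <= w & a * m n <= D n w.
Proof.
have [g1 g2 _ _] := gamma_bounds alpha_gt alpha_lt gammaE.
have gx := midf_lt g2; have := star_number_above alpha_gt alpha_lt mu_gt0 G_gt0 G_regular
  gammaE a_gt0 gx.1 gx.2.
by apply: filterS => n H; exists (n%:R `^ ((alpha / (4 * (alpha - 1)) + 1) / 2)) => //; exact: powR_ge0.
Qed.

Variable c : nat -> R.
Hypothesis c_below : \forall n \near \oo, forall w, 0 <= w -> w < c n ->
  D n w < a * m n.
Hypothesis c_above : \forall n \near \oo, forall w, c n < w -> a * m n <= D n w.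

Lemma threshold_cvg k : \forall n \near \oo, k <= c n.
Proof.
exact: (threshold_large alpha_gt alpha_lt mu_gt0 G_gt0 G_regular gammaE a_gt0).
Qed.

Lemma threshold_small k : \forall n \near \oo, k <= s n / c n.
Proof.
exact: (scale_over_threshold alpha_gt alpha_lt mu_gt0 G_gt0 G_regular gammaE a_gt0).
Qed.

(** Everything after this point knows [beta] only through these five estimates; [gamma] and the
    arithmetic of exponents disappear. *)
Lemma truncation_exponent : exists beta,
  [/\ forall l, 0 < l -> \forall n \near \oo, n%:R `^ beta <= l * c n,
      forall k, 0 < k -> \forall n \near \oo,
        variance_bound F mu beta n <= k * (n%:R * G (c n) * (m n * m n)),
      forall k, 0 < k -> \forall n \near \oo,
        n%:R ^+ 2 * (G (n%:R `^ beta) * G (n%:R `^ beta)) <= k * (n%:R * G (c n)),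
      forall k, 0 < k -> \forall n \near \oo, n%:R ^+ 3 *
        (tri_total F (s n) (fun=> 1) - tri_total F (s n) (trunc (n%:R `^ beta))) <= k * m n
    & forall K k, 0 < K -> 0 < k -> \forall n \near \oo,
        G (n%:R `^ beta) * (n%:R ^+ 3 * cycle4_mean F (s n) (K * c n) +
          n%:R ^+ 2 * tri_mean F (s n) (fun=> 1) (K * c n)) +
        G (n%:R `^ beta) * variance_bound F mu beta n <= k * (G (c n) * (m n * m n))].
Proof.
have [beta [b1 b2 b3 b4 b5]] := beta_exists alpha_gt alpha_lt gammaE.
exists beta; split.
- move=> l l0.
  exact: (truncation_lt alpha_gt alpha_lt mu_gt0 G_gt0 G_regular gammaE a_gt0).
- move=> k k0.
  exact: (variance_small alpha_gt alpha_lt mu_gt0 G_gt0 G_regular gammaE a_gt0).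
- move=> k k0.
  exact: (two_large_small alpha_gt alpha_lt mu_gt0 G_gt0 G_regular gammaE a_gt0).
- move=> k k0.
  exact: (trunc_loss_small alpha_gt alpha_lt mu_gt0 G_gt0 G_regular).
move=> K k K0 k0; have k2 : 0 < k / 2 by rewrite divr_gt0.
have H1 := star_variance_small alpha_gt alpha_lt mu_gt0 G_gt0 G_regular gammaE a_gt0
  c_below c_above.
have H2 := tail_variance_small alpha_gt alpha_lt mu_gt0 G_gt0 G_regular gammaE a_gt0
  c_below c_above.
near=> n; rewrite [k](splitr k) mulrDl; apply: lerD.
  by near: n; apply: H1.
by near: n; apply: H2.
Unshelve. all: by end_near. Qed.

Lemma tail_ratio_lt t k : 0 < t -> t `^ (- alpha) < k ->
  \forall n \near \oo, G (t * c n) <= k * G (c n).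
Proof.
move=> t0 tk; have [M [_ HM]] := cvgr_lt _ (G_regular t0) _ tk.
have cM := threshold_cvg (Num.max (M + 1) 1).
near=> n; have : Num.max (M + 1) 1 <= c n by near: n.
rewrite ge_max => /andP[Mc c1].
have c0 : 0 < c n by exact: lt_le_trans c1.
rewrite -ler_pdivrMr ?G_gt0// ltW//; apply: HM.
by rewrite (lt_le_trans _ Mc)// ltrDl.
Unshelve. all: by end_near. Qed.

Lemma tail_ratio_gt t k : 0 < t -> k < t `^ (- alpha) ->
  \forall n \near \oo, k * G (c n) <= G (t * c n).
Proof.
move=> t0 tk; have [M [_ HM]] := cvgr_gt _ (G_regular t0) _ tk.
have cM := threshold_cvg (Num.max (M + 1) 1).
near=> n; have : Num.max (M + 1) 1 <= c n by near: n.
rewrite ge_max => /andP[Mc c1].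
have c0 : 0 < c n by exact: lt_le_trans c1.
rewrite -ler_pdivlMr ?G_gt0// ltW//; apply: HM.
by rewrite (lt_le_trans _ Mc)// ltrDl.
Unshelve. all: by end_near. Qed.

End threshold_asymptotics.

(** * Bounds for a fixed number of vertices *)

Lemma card_triples_in n (U : {set 'I_n}) : #|triples_in U| = 'C(#|U|, 3).
Proof. by rewrite -cards_draws; apply: eq_card => t; rewrite !inE andbC. Qed.

Lemma sum_triples_split (V : nmodType) n (u : 'I_n) (f : {set 'I_n} -> V) :
  \sum_(t in card3_sets n) f t =
  \sum_(t in triples_at u) f t + \sum_(t in triples_in (~: [set u])%SET) f t.
Proof.
rewrite (bigID (fun t : {set 'I_n} => u \in t)) /=; congr (_ + _).
  by apply: eq_bigl => t; rewrite !inE.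
by apply: eq_bigl => t; rewrite !inE finset.subsetC finset.sub1set inE.
Qed.

Lemma card_triples_out n (u : 'I_n) : #|triples_in (~: [set u])%SET| = 'C(n.-1, 3).
Proof. by rewrite card_triples_in cardsC1 card_ord. Qed.

(** Pascal's rule, read off the split of all triples according to [u]. *)
Lemma card_triples_at n (u : 'I_n) : #|triples_at u| = 'C(n.-1, 2).
Proof.
have := sum_triples_split u (fun=> 1%N); rewrite !sum_nat_const !muln1.
rewrite card_card3_setsE card_triples_out.
have n0 : (0 < n)%N := leq_ltn_trans (leq0n u) (ltn_ord u).
by rewrite -[in X in X = _ -> _](prednK n0) binS addnC => /addIn.
Qed.

Section events.
Context d (T : measurableType d) (R : realType) (P : probability T R).

Lemma bounded_meas_sum_in (I : finType) (K : {set I}) (X : I -> T -> R) :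
  (forall t, t \in K -> bounded_meas (X t)) ->
  bounded_meas (fun w => \sum_(t in K) X t w).
Proof.
move=> bX.
rewrite (_ : (fun w => _) = fun w => \sum_t (if t \in K then X t w else 0)).
  apply: bounded_meas_sum => t; case tK : (t \in K); first exact: bX.
  exact: (@bounded_meas_cst _ T R 0).
by apply/funext => w; rewrite [LHS]big_mkcond.
Qed.

Lemma measurable_ge_set (f : T -> R) r : measurable_fun setT f ->
  measurable [set w | r <= f w].
Proof.
move=> mf; rewrite (_ : mkset _ = f @^-1` `[r, +oo[%classic).
  by rewrite -[X in measurable X]setTI; exact: mf.
by apply/seteqP; split => w /=; rewrite in_itv/= andbT.
Qed.

Lemma measurable_gt_set (f : T -> R) r : measurable_fun setT f ->
  measurable [set w | r < f w].
Proof.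
move=> mf; rewrite (_ : mkset _ = f @^-1` `]r, +oo[%classic).
  by rewrite -[X in measurable X]setTI; exact: mf.
by apply/seteqP; split => w /=; rewrite in_itv/= andbT.
Qed.

(** Chebyshev's inequality under the weight [g]: with the indicator of a heavy vertex as [g], the
    small probability of that vertex is kept in the bound. *)
Lemma prob_deviation (A : set T) (g X : T -> R) (t : R) :
  measurable A -> bounded_meas g -> bounded_meas X -> 0 < t ->
  (forall w, 0 <= g w) -> (forall w, A w -> 1 <= g w /\ t <= `|X w|) ->
  fine (P A) <= mean P (fun w => g w * X w ^+ 2) / t ^+ 2.
Proof.
move=> mA bg bX t0 g0 AX; apply: mean_markov => //.
- by apply: bounded_measM => //; exact: bounded_measM.
- by rewrite exprn_gt0.
- by move=> w; rewrite mulr_ge0// sqr_ge0.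
move=> w /AX[g1 tX]; rewrite -[leLHS]mul1r ler_pM// ?sqr_ge0//.
by rewrite -[X in _ <= X]real_normK ?num_real// lerXn2r// nnegrE ltW.
Qed.

(** A Bonferroni inequality by induction on the list; adding one event to [k] others costs at most
    [k * q], and [k ^+ 2 + k <= k.+1 ^+ 2]. *)
Lemma prob_bigU_ge (I : choiceType) (l : seq I) (B : I -> set T) (q : R) :
  uniq l -> 0 <= q -> (forall i, measurable (B i)) ->
  (forall i j, i \in l -> j \in l -> i != j -> fine (P (B i `&` B j)) <= q) ->
  \sum_(i <- l) fine (P (B i)) - (size l)%:R ^+ 2 * q <=
    fine (P (\big[setU/set0]_(i <- l) B i)).
Proof.
move=> ul q0 mB; elim: l ul => [|i l IH] ul Bq.
  by rewrite !big_nil measure0 /= expr0n /= mul0r subr0.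
move: ul => /= /andP[il ul].
have sub j : j \in l -> j \in i :: l by rewrite inE => ->; rewrite orbT.
have {}IH := IH ul (fun j k jl kl => Bq j k (sub j jl) (sub k kl)).
rewrite !big_cons; set U := \big[setU/set0]_(_ <- l) _ in IH *.
have mU : measurable U by exact: bigsetU_measurable.
have PU : fine (P (B i `|` U)) = fine (P (B i)) + fine (P U) - fine (P (B i `&` U)).
  apply/EFin_inj; rewrite EFinB EFinD !fine_probK//; [|exact: measurableI|exact: measurableU].
  rewrite measureUfinr//.
    by rewrite -ge0_fin_numE// fin_num_measure.
have PI : fine (P (B i `&` U)) <= (size l)%:R * q.
  rewrite /U -classical_sets.bigcup_seq setI_bigcupr classical_sets.bigcup_seq.
  apply: (le_trans (fine_prob_bigU _ _ _)) => [j|]; first exact: measurableI.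
  rewrite mulr_natl -(count_predT l) -iter_addr_0 -big_const_seq big_seq [leRHS]big_seq.
  apply: ler_sum => j jl; apply: Bq; rewrite ?mem_head ?inE ?jl ?orbT//.
  by apply: contraNneq il => ->.
rewrite PU; move: IH PI q0; rewrite -natr1.
move: (fine _) (fine _) (fine _) (\sum_(_ <- _) _) (size l)%:R (ler0n R (size l)) => x y z S k k0.
by nra.
Qed.

End events.

Section inequalities.
Context d (T : measurableType d) (R : realType) (P : probability T R).
Variables (W : nat -> {RV P >-> R}) (n : nat) (E : T -> rel 'I_n).
Hypothesis W_iid : iid W.
Hypothesis W_ge0 : forall k w, 0 <= W k w.
Hypothesis E_graph : weighted_random_graph W E.
Local Notation s := (mean_weight W * n%:R).
Hypothesis s_gt0 : 0 < s.
Local Notation F := (distribution P (W 0%N) : probability R R).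
Local Notation G := (tail F).

Variables b m zeta : R.
Hypotheses (m_gt0 : 0 < m) (zeta_gt0 : 0 < zeta).

(** Light triangles have all three weights at most [b], whereas the star at [u] collects every
    triangle through [u]. Accordingly [light_mean] is a number and [star_mean] a function of the
    weight of the centre. *)
Definition light_sum (U : {set 'I_n}) w : R :=
  \sum_(t in triples_in U) tri_wt W E (trunc b) t w.
Definition light_mean (U : {set 'I_n}) : R :=
  #|triples_in U|%:R * tri_total F s (trunc b).
Definition star_sum (u : 'I_n) w : R :=
  \sum_(t in triples_at u) tri_wt W E (fun=> 1) t w.
Definition star_mean (x : R) : R := 'C(n.-1, 2)%:R * tri_mean F s (fun=> 1) x.

Definition light_variance : R :=
  n%:R ^+ 5 * mean F (fun x => trunc b x * tri_mean F s (trunc b) x ^+ 2) +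
  n%:R ^+ 4 * mean F (cycle4_mean F s) + n%:R ^+ 3 * tri_total F s (trunc b).
Definition star_variance (r : R) : R :=
  n%:R ^+ 3 * cycle4_mean F s r + n%:R ^+ 2 * tri_mean F s (fun=> 1) r.

Lemma weight_prob k B : measurable B -> fine (P (W k @^-1` B)) = fine (F B).
Proof. by move=> mB; have [_ /(_ k B mB)] := W_iid; rewrite /distribution /pushforward => ->. Qed.

Lemma weight_tail k r : fine (P [set w | r < W k w]) = G r.
Proof.
rewrite /tail -(weight_prob k)//; congr (fine (P _)).
by apply/seteqP; split => w /=; rewrite in_itv/= andbT.
Qed.

Lemma measurable_weight_gt k r : measurable [set w | r < W k w].
Proof. by apply: measurable_gt_set; exact: measurable_weight. Qed.

Lemma two_weights_tail i j r : i != j ->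
  fine (P ([set w | r < W i w] `&` [set w | r < W j w])) = G r * G r.
Proof.
move=> ij; have [mi _] := W_iid.
have uij : uniq [:: i; j] by rewrite /= inE ij.
have := mi [:: i; j] (fun=> `]r, +oo[%classic) uij (fun=> measurable_itv _).
rewrite big_cons big_cons big_nil mulr1 !weight_prob// -/(tail F r) => H.
apply/EFin_inj; rewrite -H fine_probK; last first.
  by apply: measurableI; exact: measurable_weight_gt.
congr (P _); apply/seteqP; split => w /=.
  move=> [wi wj] k kij /=; rewrite in_itv/= andbT; move: kij.
  by rewrite /= !inE => /orP[]/eqP ->.
move=> H'; have Hk k : k \in [:: i; j] -> r < W k w.
  by move=> kij; have := H' k kij; rewrite /= in_itv/= andbT.
by split; apply: Hk; rewrite !inE eqxx ?orbT.
Qed.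

Lemma bounded_meas_light_sum U : bounded_meas (light_sum U).
Proof.
apply: bounded_meas_sum_in => t; rewrite !inE => /andP[/eqP t3 _].
exact: (bounded_meas_tri_wt _ (bounded_meas_trunc b)).
Qed.

Lemma bounded_meas_star_sum u : bounded_meas (star_sum u).
Proof.
apply: bounded_meas_sum_in => t; rewrite !inE => /andP[/eqP t3 _].
exact: (bounded_meas_tri_wt _ (@bounded_meas_cst _ R R 1)).
Qed.

Lemma triangles_light w : (forall i : 'I_n, W i.+1 w <= b) ->
  (triangles (E w))%:R = light_sum [set: 'I_n]%SET w.
Proof.
move=> Wb; rewrite triangles_sum; apply: eq_big => [t|t _].
  by rewrite !inE finset.subsetT andbT.
by rewrite /tri_wt big1 ?mulr1// => i _; rewrite truncE Wb.
Qed.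

Lemma triangles_star_ge u w :
  star_sum u w + light_sum (~: [set u])%SET w <= (triangles (E w))%:R.
Proof.
rewrite triangles_sum (sum_triples_split u); apply: lerD; apply: ler_sum => t _.
  by rewrite /tri_wt big1 ?mulr1.
by rewrite ler_piMr// prodr_ile1// => i _; rewrite trunc_ge0 trunc_le1.
Qed.

Lemma triangles_star u w : (forall i : 'I_n, i != u -> W i.+1 w <= b) ->
  (triangles (E w))%:R = star_sum u w + light_sum (~: [set u])%SET w.
Proof.
move=> Wb; rewrite triangles_sum (sum_triples_split u); congr (_ + _).
  by apply: eq_bigr => t _; rewrite /tri_wt big1 ?mulr1.
apply: eq_bigr => t; rewrite !inE => /andP[_ /fintype.subsetP tu].
rewrite /tri_wt big1 ?mulr1// => i /tu; rewrite !inE => iu.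
by rewrite truncE Wb.
Qed.

Lemma light_deviation t : 0 < t ->
  fine (P [set w | t <= `|light_sum [set: 'I_n]%SET w - light_mean [set: 'I_n]%SET|]) <=
  light_variance / t ^+ 2.
Proof.
move=> t0; have b1 := @bounded_meas_cst _ R R 1.
have bX : bounded_meas (fun w => light_sum [set: 'I_n]%SET w - light_mean [set: 'I_n]%SET).
  apply: bounded_measB; first exact: bounded_meas_light_sum.
  exact: bounded_meas_cst.
apply: (le_trans (@prob_deviation _ _ _ P _ (fun=> 1) _ t _ _ bX _ _ _)) => //.
- apply: measurable_ge_set; apply: measurableT_comp => //; exact: bX.1.
- exact: bounded_meas_cst.
rewrite ler_wpM2r ?invr_ge0 ?sqr_ge0//.
have H := variance_le (h := fun=> 1) (j := 0%N) (U := [set: 'I_n]%SET) W_iid W_ge0 E_graph s_gt0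
  b1 (fun=> ler01) (bounded_meas_trunc b) (fun x => introT andP (conj (trunc_ge0 b x) (trunc_le1 b x))).
have vm : vertex_measurable W n (fun=> 1 : R) by exact: vertex_measurable_cst.
have {}H := H vm (fun i _ => isT).
by rewrite mean_cst [X in _ <= X]mul1r in H.
Qed.

Definition rest_event (u : 'I_n) : set T :=
  [set w | b < W u.+1 w] `&`
  [set w | zeta * m <= `|light_sum (~: [set u])%SET w - light_mean (~: [set u])%SET|].

Lemma measurable_rest_event u : measurable (rest_event u).
Proof.
apply: measurableI; first exact: measurable_weight_gt.
apply: measurable_ge_set; apply: measurableT_comp => //.
apply: measurable_funB => //; exact: (bounded_meas_light_sum _).1.
Qed.

Local Notation above r := (\1_(`]r, +oo[%classic) : R -> R).

(** The triangles that avoid [u] do not involve its weight, so [u] can serve as the outside vertex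
    of [variance_le]. The resulting factor [G b] compensates for the later union over [n]
    vertices. *)
Lemma rest_deviation u :
  fine (P (rest_event u)) <= G b * light_variance / (zeta * m) ^+ 2.
Proof.
have ba := bounded_meas_above b.
have bX : bounded_meas (fun w => light_sum (~: [set u])%SET w - light_mean (~: [set u])%SET).
  apply: bounded_measB; first exact: bounded_meas_light_sum.
  exact: bounded_meas_cst.
have baW : bounded_meas (fun w => above b (W u.+1 w)).
  exact: (bounded_meas_weight _ u.+1 ba).
apply: (le_trans (@prob_deviation _ _ _ P _ _ _ (zeta * m) (measurable_rest_event u) baW bX _ _ _)).
- exact: mulr_gt0.
- by move=> w; rewrite aboveE.
- by move=> w [/= bW tX]; rewrite aboveE bW.
rewrite ler_wpM2r ?invr_ge0 ?sqr_ge0//.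
rewrite -mean_above_tail.
apply: (variance_le W_iid W_ge0 E_graph s_gt0 ba _ (bounded_meas_trunc b)).
- by move=> x; rewrite aboveE.
- by move=> x; rewrite trunc_ge0 trunc_le1.
- by apply: vertex_measurable_weight; have [] := ba.
- by move=> i; rewrite !inE; apply: contraNneq => -[] /ord_inj ->.
Qed.

Lemma bounded_meas_star_mean (u : 'I_n) : bounded_meas (fun w => star_mean (W u.+1 w)).
Proof.
apply: bounded_measM; first exact: bounded_meas_cst.
exact: (bounded_meas_weight _ u.+1
  (bounded_meas_tri_mean F s_gt0 (@bounded_meas_cst _ R R 1) (fun=> ler01))).
Qed.

Lemma star_mean_nd x y : x <= y -> star_mean x <= star_mean y.
Proof. by move=> xy; apply: ler_wpM2l; [exact: ler0n | exact: tri_mean_nd]. Qed.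

Definition star_event r (u : 'I_n) : set T :=
  [set w | b < W u.+1 w] `&` [set w | W u.+1 w <= r] `&`
  [set w | zeta * m <= `|star_sum u w - star_mean (W u.+1 w)|].

Lemma measurable_star_event r u : measurable (star_event r u).
Proof.
apply: measurableI.
  apply: measurableI; first exact: measurable_weight_gt.
  rewrite (_ : mkset _ = W u.+1 @^-1` `]-oo, r]%classic).
    exact: measurable_weight_preimage.
  by apply/seteqP; split => w /=; rewrite in_itv.
apply: measurable_ge_set; apply: measurableT_comp => //.
by apply: measurable_funB; [exact: (bounded_meas_star_sum _).1 | exact: (bounded_meas_star_mean _).1].
Qed.

Lemma star_deviation r u : (0 < n)%N ->
  fine (P (star_event r u)) <= G b * star_variance r / (zeta * m) ^+ 2.
Proof.
move=> n0; pose g x := above b x * trunc r x.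
have mean_weight_gt0 : 0 < mean_weight W.
  by move: s_gt0; rewrite pmulr_lgt0// ltr0n.
have ba := bounded_meas_above b; have bt := bounded_meas_trunc r.
have bg : bounded_meas g by exact: bounded_measM.
have g0 x : 0 <= g x by rewrite /g aboveE truncE mulr_ge0.
have ga x : g x <= above b x by rewrite /g aboveE ler_piMr// trunc_le1.
have bX : bounded_meas (fun w => star_sum u w - star_mean (W u.+1 w)).
  apply: bounded_measB; first exact: bounded_meas_star_sum.
  exact: bounded_meas_star_mean.
have bgW : bounded_meas (fun w => g (W u.+1 w)).
  exact: (bounded_meas_weight _ u.+1 bg).
apply: (le_trans (@prob_deviation _ _ _ P _ _ _ (zeta * m) (measurable_star_event r u) bgW bX _ _ _)).
- exact: mulr_gt0.
- by move=> w; exact: g0.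
- by move=> w [[/= bW Wr] tX]; rewrite /g aboveE truncE bW Wr mulr1.
rewrite ler_wpM2r ?invr_ge0 ?sqr_ge0//.
have H := variance_at_le W_iid W_ge0 E_graph s_gt0 u bg g0.
rewrite card_triples_at in H.
apply: (le_trans H); rewrite -mean_above_tail mulrDr.
have key (f : R -> R) : bounded_meas f -> (forall x, 0 <= f x) ->
    (forall x y, x <= y -> f x <= f y) -> mean F (fun x => g x * f x) <= mean F (above b) * f r.
  move=> bf f0 fnd; rewrite mulrC -meanZ; last exact: bounded_integ.
  apply: mean_le.
  - by apply: bounded_integ; exact: bounded_measM.
  - by apply: bounded_integ; apply: bounded_measM => //; exact: bounded_meas_cst.
  move=> x; rewrite mulrC [g x]/g truncE; have [xr|_] := leP x r.
    by rewrite mulr1 ler_wpM2r ?aboveE// fnd.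
  by rewrite mulr0 mulr0 mulr_ge0// aboveE.
rewrite [X in _ <= X + _]mulrCA [X in _ <= _ + X]mulrCA.
apply: lerD; rewrite ler_wpM2l ?exprn_ge0//; apply: key.
- exact: bounded_meas_cycle4_mean.
- by move=> x; exact: cycle4_mean_ge0.
- by move=> x y xy; exact: (cycle4_mean_nd F mean_weight_gt0 n0 xy).
- by apply: bounded_meas_tri_mean => //; exact: bounded_meas_cst.
- by move=> x; apply: tri_mean_ge0.
- by move=> x y; exact: tri_mean_nd.
Qed.

Local Notation Delta w := ((triangles (E w))%:R : R).
Local Notation "'large' l" := [set w | l < Delta w] (at level 10).

Lemma measurable_triangles : measurable_fun setT (fun w => Delta w).
Proof.
rewrite (_ : (fun w => _) = fun w => \sum_(t in card3_sets n) tri_wt W E (fun=> 1) t w).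
  apply: (bounded_meas_sum_in _).1 => t; rewrite inE => /eqP t3.
  exact: (bounded_meas_tri_wt _ (@bounded_meas_cst _ R R 1)).
apply/funext => w; rewrite triangles_sum; apply: eq_bigr => t _.
by rewrite /tri_wt big1 ?mulr1.
Qed.

Definition pair_event (p : 'I_n * 'I_n) : set T :=
  if p.1 == p.2 then set0
  else [set w | b < W p.1.+1 w] `&` [set w | b < W p.2.+1 w].

Lemma measurable_pair_event p : measurable (pair_event p).
Proof.
rewrite /pair_event; case: ifP => _ //.
by apply: measurableI; exact: measurable_weight_gt.
Qed.

Lemma pair_event_le p : fine (P (pair_event p)) <= G b * G b.
Proof.
rewrite /pair_event; case: eqVneq => [_|ij]; first by rewrite measure0 mulr_ge0// tail_ge0.
by rewrite two_weights_tail// eqSS val_eqE.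
Qed.

Lemma triangles_upper_tail (a e lc : R) : (0 < n)%N -> 0 < a ->
  2 * zeta = e * a ->
  (forall x, x <= lc -> star_mean x <= (1 - e) * a * m) ->
  (forall U, light_mean U <= m) ->
  fine (P [set w | (1 + a) * m < Delta w]) <=
  n%:R * (G lc + (G b * star_variance lc + G b * light_variance) / (zeta * m) ^+ 2) +
  n%:R ^+ 2 * (G b * G b) + light_variance / (a * m) ^+ 2.
Proof.
move=> n0 a0 ze star_le light_le; have am0 : 0 < a * m by exact: mulr_gt0.
pose Si (i : 'I_n) := [set w | lc < W i.+1 w] `|` (star_event lc i `|` rest_event i).
pose S3 := [set w | a * m <= `|light_sum [set: 'I_n]%SET w - light_mean [set: 'I_n]%SET|].
have mSi i : measurable (Si i).
  apply: measurableU; first exact: measurable_weight_gt.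
  by apply: measurableU; [exact: measurable_star_event | exact: measurable_rest_event].
have mS3 : measurable S3.
  apply: measurable_ge_set; apply: measurableT_comp => //.
  by apply: measurable_funB => //; exact: (bounded_meas_light_sum _).1.
have m1 : measurable (\big[setU/set0]_(i : 'I_n) Si i) by exact: bigsetU_measurable.
have m2 : measurable (\big[setU/set0]_(p : 'I_n * 'I_n) pair_event p).
  by apply: bigsetU_measurable => p _; exact: measurable_pair_event.
(* Outside the right-hand side, either all weights are light and the count is below [m + a * m], or
   a single vertex is heavy with weight at most [lc], and the count is below
   [(1 - e) * a * m + m + 2 * (zeta * m)], which is [(1 + a) * m] by the relation between [zeta] and
   [e]. *)
have cover : [set w | (1 + a) * m < Delta w] `<=`
    \big[setU/set0]_(i : 'I_n) Si i `|` \big[setU/set0]_(p : 'I_n * 'I_n) pair_event p `|` S3.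
  move=> w /= Dw; rewrite -!classical_sets.bigcup_seq.
  apply: contrapT => /not_orP[/not_orP[nS nP] nS3].
  have {}nS i : ~ Si i w by move=> Sw; apply: nS; exists i => //=; rewrite mem_index_enum.
  have {}nP p : ~ pair_event p w by move=> Sw; apply: nP; exists p => //=; rewrite mem_index_enum.
  have [/existsP[u bu]|/existsPn light] := boolP [exists i : 'I_n, b < W i.+1 w]; last first.
    apply: nS3; rewrite /S3 /= (le_trans _ (ler_norm _))//.
    rewrite -triangles_light => [|i]; last by rewrite leNgt.
    have := light_le [set: 'I_n]%SET; move: Dw; lra.
  have only i : i != u -> W i.+1 w <= b.
    move=> iu; rewrite leNgt; apply/negP => bi; apply: (nP (i, u)).
    by rewrite /pair_event/= (negbTE iu).
  move: Dw; rewrite (triangles_star only).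
  have /not_orP[/negP Wl /not_orP[nstar nrest]] := nS u.
  rewrite -leNgt in Wl.
  have A : star_sum u w < star_mean (W u.+1 w) + zeta * m.
    rewrite ltNge; apply/negP => H; apply: nstar; split => //=.
    by rewrite (le_trans _ (ler_norm _))// lerBrDl.
  have B : light_sum (~: [set u])%SET w < light_mean (~: [set u])%SET + zeta * m.
    rewrite ltNge; apply/negP => H; apply: nrest; split => //=.
    by rewrite (le_trans _ (ler_norm _))// lerBrDl.
  have C := star_le _ Wl; have D := light_le (~: [set u])%SET.
  have zm : 2 * (zeta * m) = e * a * m by rewrite mulrA ze.
  move: A B C D zm.
  have -> : (1 - e) * a * m = a * m - e * a * m by ring.
  have -> : (1 + a) * m = m + a * m by ring.
  move: (star_sum _ _) (star_mean _) (light_sum _ _) (light_mean _) => x1 x2 x3 x4.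
  by move: (zeta * m) (e * a * m) (a * m) => y1 y2 y3 *; lra.
apply: (le_trans (fine_prob_le _ _ _ cover)).
- exact: measurable_gt_set measurable_triangles.
- by apply: measurableU => //; exact: measurableU.
apply: (le_trans (fine_probU _ _ _)) => //; first exact: measurableU.
apply: lerD; last exact: light_deviation.
apply: (le_trans (fine_probU _ _ _)) => //; apply: lerD.
  apply: (le_trans (fine_prob_bigU _ _ mSi)).
  rewrite mulr_natl -[n in _ *+ n]card_ord -sumr_const; apply: ler_sum => i _.
  have ms := measurable_star_event lc i; have mr := measurable_rest_event i.
  apply: (le_trans (fine_probU _ _ _)) => //; [exact: measurable_weight_gt|exact: measurableU|].
  rewrite weight_tail lerD2l mulrDl (le_trans (fine_probU _ _ _))//.
  by apply: lerD; [exact: star_deviation | exact: rest_deviation].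
apply: (le_trans (fine_prob_bigU _ _ measurable_pair_event)).
rewrite -natrX mulr_natl -[X in _ *+ X](_ : #|{: 'I_n * 'I_n}| = _); last first.
  by rewrite card_prod card_ord.
by rewrite -sumr_const; apply: ler_sum => p _; exact: pair_event_le.
Qed.

(** A vertex with weight in []r1, r2]] and no deviation produces the excess by itself. Two such
    vertices are both above [b], so the pairwise term of the Bonferroni inequality is at most
    [G b * G b]. The cap [r2] is there because [star_event] controls only bounded weights. *)
Lemma triangles_lower_tail (a r1 r2 : R) : (0 < n)%N -> b <= r1 -> r1 <= r2 ->
  (forall u : 'I_n, (1 + a) * m + 2 * (zeta * m) <=
    star_mean r1 + light_mean (~: [set u])%SET) ->
  n%:R * (G r1 - G r2 - (G b * star_variance r2 + G b * light_variance) / (zeta * m) ^+ 2) -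
  n%:R ^+ 2 * (G b * G b) <= fine (P [set w | (1 + a) * m < Delta w]).
Proof.
move=> n0 br1 r12 H.
pose A := [set w | (1 + a) * m < Delta w].
pose J (i : 'I_n) := [set w | r1 < W i.+1 w] `\` [set w | r2 < W i.+1 w].
have mA : measurable A by exact: measurable_gt_set measurable_triangles.
have mJ i : measurable (J i) by apply: measurableD; exact: measurable_weight_gt.
have mJA i : measurable (J i `&` A) by exact: measurableI.
have PJ i : fine (P (J i)) = G r1 - G r2.
  have sub : [set w | r2 < W i.+1 w] `<=` [set w | r1 < W i.+1 w].
    by move=> w /=; exact: le_lt_trans.
  rewrite /J measureD; [|exact: measurable_weight_gt|exact: measurable_weight_gt|]; last first.
    by rewrite -ge0_fin_numE// fin_num_measure//; exact: measurable_weight_gt.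
  rewrite (setIidr sub) fineB ?fin_num_measure ?weight_tail//; exact: measurable_weight_gt.
have PJA i : G r1 - G r2 - (G b * star_variance r2 + G b * light_variance) / (zeta * m) ^+ 2
    <= fine (P (J i `&` A)).
  have ms := measurable_star_event r2 i; have mr := measurable_rest_event i.
  rewrite lerBlDr -(PJ i) mulrDl.
  apply: (@le_trans _ _ (fine (P (J i `&` A)) +
      (fine (P (star_event r2 i)) + fine (P (rest_event i))))); last first.
    by rewrite lerD2l lerD ?star_deviation ?rest_deviation.
  apply: (@le_trans _ _ (fine (P (J i `&` A `|` (star_event r2 i `|` rest_event i))))).
    apply: fine_prob_le => //; first by apply: measurableU => //; exact: measurableU.
    move=> w Jw; have [/= r1W r2W] := Jw.
    have bW : b < W i.+1 w by exact: le_lt_trans br1 r1W.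
    have Wr : W i.+1 w <= r2 by rewrite leNgt; apply/negP.
    apply: contrapT => /not_orP[nA /not_orP[nstar nrest]]; apply: nA; split => //.
    rewrite /A /=; apply: (lt_le_trans _ (triangles_star_ge i w)).
    have B1 : `|star_sum i w - star_mean (W i.+1 w)| < zeta * m.
      by rewrite ltNge; apply/negP => H'; apply: nstar.
    have B2 : `|light_sum (~: [set i])%SET w - light_mean (~: [set i])%SET| < zeta * m.
      by rewrite ltNge; apply/negP => H'; apply: nrest.
    move: B1 B2; rewrite !ltr_norml => /andP[B1 _] /andP[B2 _].
    have := H i; have := star_mean_nd (ltW r1W); move: B1 B2.
    move: (star_sum _ _) (star_mean _) (star_mean _) (light_sum _ _) (light_mean _) => x1 x2 x3 x4 x5.
    by move: (zeta * m) ((1 + a) * m) => y1 y2 *; lra.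
  apply: (le_trans (fine_probU _ _ _)) => //; first exact: measurableU.
  by rewrite lerD2l; exact: fine_probU.
have mU : measurable (\big[setU/set0]_(i : 'I_n) (J i `&` A)).
  exact: bigsetU_measurable.
apply: (@le_trans _ _ (fine (P (\big[setU/set0]_(i : 'I_n) (J i `&` A))))); last first.
  apply: fine_prob_le => // w; rewrite -classical_sets.bigcup_seq.
  by move=> [i _ []].
have BF := @prob_bigU_ge _ T R P _ (index_enum 'I_n) (fun i => J i `&` A) (G b * G b)
  (index_enum_uniq _) (mulr_ge0 (tail_ge0 _ _) (tail_ge0 _ _)) mJA.
apply: le_trans (BF _); last first.
  move=> i j _ _ ij; rewrite -(@two_weights_tail i.+1 j.+1 b) ?eqSS ?val_eqE//.
  apply: fine_prob_le; [exact: measurableI | |].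
    by apply: measurableI; exact: measurable_weight_gt.
  by move=> w [[[/= i1 _] _] [[/= j1 _] _]]; split => /=; exact: le_lt_trans br1 _.
have -> : size (index_enum 'I_n) = n by rewrite -[RHS]card_ord cardE enumT.
rewrite lerD2r mulr_natl -[n in _ *+ n]card_ord -sumr_const.
by apply: ler_sum => i _.
Qed.

End inequalities.

(** * Asymptotic tail probabilities *)

Lemma bin2_pred_le (R : realType) n : 'C(n.-1, 2)%:R <= 2^-1 * n%:R ^+ 2 :> R.
Proof.
have H : ('C(n.-1, 2) * 2 <= n ^ 2)%N.
  case: n => [|[|n]]//=.
  by have := bin_ffact n.+1 2; rewrite !ffactnS ffactn0 /= => ->; rewrite !expnS expn0; nia.
by rewrite ler_pdivlMl// mulrC -natrM -natrX ler_nat.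
Qed.

Lemma bin2_pred_ge (R : realType) n : (0 < n)%N ->
  (1 - 3 / n%:R) * (2^-1 * n%:R ^+ 2) <= 'C(n.-1, 2)%:R :> R.
Proof.
move=> n0; have n0' : 0 < n%:R :> R by rewrite ltr0n.
have -> : (1 - 3 / n%:R) * (2^-1 * n%:R ^+ 2) = 2^-1 * (n%:R ^+ 2 - 3 * n%:R) :> R.
  by field; rewrite gt_eqF.
rewrite ler_pdivrMl// lerBlDr mulrC -natrM -natrX -!natrM -natrD ler_nat.
case: n n0 {n0'} => [|[|n]]//= _.
by have := bin_ffact n.+1 2; rewrite !ffactnS ffactn0 /= => ->; rewrite !expnS expn0; nia.
Qed.

Lemma bin3_pred (R : realType) n : (0 < n)%N ->
  (1 - 3 / n%:R) * 'C(n, 3)%:R = 'C(n.-1, 3)%:R :> R.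
Proof.
move=> n0; have n0' : n%:R != 0 :> R by rewrite pnatr_eq0 -lt0n.
have [n3|n3] := ltnP n 3; first by rewrite !bin_small ?mulr0// (leq_ltn_trans (leq_pred n)).
apply: (mulfI n0'); rewrite -natrM mul_bin_down natrM natrB//.
by rewrite mulrA mulrBr mulr1 mulrCA divff// mulr1.
Qed.

Lemma near_one_powR (R : realType) (alpha delta : R) : 0 < alpha -> 0 < delta ->
  exists l, [/\ 0 < l, l < 1, (l * l) `^ (- alpha) < 1 + delta &
    1 - delta < (l * l)^-1 `^ (- alpha)].
Proof.
move=> a0 d0; have d1 : 1 < 1 + delta by rewrite ltrDl.
have d00 : 0 < 1 + delta by rewrite addr_gt0.
pose l := (1 + delta) `^ (- (4 * alpha)^-1).
have l0 : 0 < l by rewrite powR_gt0.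
have ll : l * l = (1 + delta) `^ (- (2 * alpha)^-1).
  rewrite -powRD; last by apply/implyP => _; rewrite gt_eqF.
  by congr (_ `^ _); field; rewrite gt_eqF.
have llV : (l * l)^-1 = (1 + delta) `^ ((2 * alpha)^-1).
  by rewrite ll powRN invrK.
exists l; split => //.
- rewrite -[ltRHS](powRr0 (1 + delta)); apply: gt1_ltr_powR => //.
  by rewrite oppr_lt0 invr_gt0 mulr_gt0.
- rewrite ll -powRrM -[ltRHS]powRr1 ?ltW//; apply: gt1_ltr_powR => //.
  have -> : - (2 * alpha)^-1 * - alpha = 2^-1 by field; rewrite gt_eqF.
  by rewrite invf_lt1// ltr1n.
- rewrite llV -powRrM; apply: (@lt_trans _ _ ((1 + delta) `^ (-1))).
    rewrite powRN powRr1 ?ltW// -[ltRHS]div1r ltr_pdivlMr//.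
    have : 0 < delta * delta by exact: mulr_gt0.
    by move=> h; rewrite mulrDr mulr1 mulrBl mul1r; move: h; lra.
  apply: gt1_ltr_powR => //.
  have -> : (2 * alpha)^-1 * - alpha = - 2^-1 by field; rewrite gt_eqF.
  by rewrite ltrN2 invf_lt1// ltr1n.
Qed.

Lemma large_powR_lt (R : realType) (alpha delta t : R) : 0 < alpha -> 0 < delta ->
  exists K, [/\ 0 < K, t <= K & K `^ (- alpha) < delta].
Proof.
move=> a0 d0; pose y := (delta / 2) `^ (- alpha^-1).
have y0 : 0 < y by rewrite powR_gt0// divr_gt0.
exists (Num.max t y); split; first by rewrite lt_max y0 orbT.
  by rewrite le_max lexx.
have yK : y <= Num.max t y by rewrite le_max lexx orbT.
have yE : y `^ alpha = (delta / 2)^-1.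
  rewrite -powRrM mulNr mulVf ?gt_eqF// powRN powRr1//.
  by rewrite divr_ge0// ltW.
apply: (@le_lt_trans _ _ (delta / 2)); last first.
  by rewrite ltr_pdivrMr// ltr_pMr// ltr1n.
have K0 : 0 < Num.max t y by rewrite lt_max y0 orbT.
rewrite powRN -[leRHS]invrK -yE.
rewrite lef_pV2; [|by rewrite posrE powR_gt0|by rewrite posrE powR_gt0].
by apply: ge0_ler_powR; rewrite ?nnegrE ?(ltW a0) ?(ltW y0) ?(ltW K0).
Qed.

Section error_sums.
Context (R : realType) (n g gb V m zeta delta : R).
Hypotheses (n_ge0 : 0 <= n) (m_gt0 : 0 < m) (zeta_gt0 : 0 < zeta).

Let deviation_le x : x <= delta * zeta ^+ 2 * (g * (m * m)) ->
  x / (zeta * m) ^+ 2 <= delta * g.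
Proof.
move=> xV; rewrite ler_pdivrMr ?exprn_gt0 ?mulr_gt0//; apply: (le_trans xV).
by rewrite le_eqVlt; apply/orP; left; apply/eqP; ring.
Qed.

(** The 6 is made of 3 from the tail at [l * l * c n], and 1 each from the deviations at a heavy
    vertex, from pairs of heavy vertices, and from the light triangles. *)
Lemma upper_error_sum a gl S : 0 < a ->
  V <= delta * a ^+ 2 * (n * g * (m * m)) ->
  n ^+ 2 * (gb * gb) <= delta * (n * g) ->
  gb * S + gb * V <= delta * zeta ^+ 2 * (g * (m * m)) ->
  gl <= (1 + 3 * delta) * g ->
  n * (gl + (gb * S + gb * V) / (zeta * m) ^+ 2) + n ^+ 2 * (gb * gb) +
    V / (a * m) ^+ 2 <= (1 + 6 * delta) * (n * g).
Proof.
move=> a0 HV H2 /deviation_le HS Hl.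
have -> : (1 + 6 * delta) * (n * g) = n * ((1 + 3 * delta) * g + delta * g) +
  delta * (n * g) + delta * (n * g) by ring.
apply: lerD; first by rewrite lerD// ler_wpM2l// lerD.
rewrite ler_pdivrMr ?exprn_gt0 ?mulr_gt0//; apply: (le_trans HV).
by rewrite le_eqVlt; apply/orP; left; apply/eqP; ring.
Qed.

Lemma lower_error_sum g1 g2 S :
  n ^+ 2 * (gb * gb) <= delta * (n * g) ->
  gb * S + gb * V <= delta * zeta ^+ 2 * (g * (m * m)) ->
  (1 - delta) * g <= g1 -> g2 <= delta * g ->
  (1 - 4 * delta) * (n * g) <=
  n * (g1 - g2 - (gb * S + gb * V) / (zeta * m) ^+ 2) - n ^+ 2 * (gb * gb).
Proof.
move=> H2 /deviation_le HS H1' H2'.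
have -> : (1 - 4 * delta) * (n * g) =
  n * ((1 - delta) * g - delta * g - delta * g) - delta * (n * g) by ring.
by rewrite lerB// ler_wpM2l// lerB// lerB.
Qed.

End error_sums.

(** The surplus [e * a * m] of the star is spent in quarters: one on the loss [q] in the binomial
    coefficients, one on the truncation, and two on the deviations of the star and of the remaining
    triangles. *)
Lemma lower_mean_sum (R : realType) (q e a m x y : R) : 0 <= m ->
  q * (1 + (1 + e) * a) <= e * a / 4 -> (1 - q) * ((1 + e) * (a * m)) <= x ->
  (1 - q) * m - e * a / 4 * m <= y ->
  (1 + a) * m + 2 * (e * a / 4 * m) <= x + y.
Proof.
move=> m0 /(ler_wpM2r m0) qm xm ym.
have zE : e * a / 4 * m = e * a * m / 4 by field.
by move: qm xm ym; rewrite zE; lra.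
Qed.

Section tail_probability.
Context d (T : measurableType d) (R : realType) (P : probability T R).
Variables (W : nat -> {RV P >-> R}) (E : forall n : nat, T -> rel 'I_n).
Local Arguments E : clear implicits.
Hypothesis W_iid : iid W.
Hypothesis W_ge0 : forall k w, 0 <= W k w.
Hypothesis E_graph : forall n, weighted_random_graph W (E n).
Local Notation mu := (mean_weight W).
Local Notation F := (distribution P (W 0%N) : probability R R).
Local Notation G := (tail F).
Variables alpha a : R.
Hypothesis alpha_gt : 4 / 3 < alpha.
Hypothesis alpha_lt : alpha < 2.
Hypothesis mu_gt0 : 0 < mu.
Hypothesis G_gt0 : forall x : R, 0 < x -> 0 < G x.
Hypothesis G_regular : forall t : R, 0 < t ->
  G (t * x) / G x @[x --> +oo] --> t `^ (- alpha).
Hypothesis a_gt0 : 0 < a.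
Local Notation s n := (mu * n%:R).
Local Notation m := (tri_number F mu).
Local Notation D := (star_number F mu).

Variable c : nat -> R.
Hypothesis c_below : \forall n \near \oo, forall w, 0 <= w -> w < c n ->
  D n w < a * m n.
Hypothesis c_above : \forall n \near \oo, forall w, c n < w -> a * m n <= D n w.

Let alpha_gt1 : 1 < alpha.
Proof. by rewrite (lt_trans _ alpha_gt)// ltr_pdivlMr// mul1r ltr_nat. Qed.
Let alpha_gt0 : 0 < alpha. Proof. by rewrite (lt_trans ltr01). Qed.
Let D_ge0 n x : 0 < s n -> 0 <= D n x.
Proof. by move=> s0; rewrite !mulr_ge0 ?invr_ge0 ?exprn_ge0//; exact: tri_mean_ge0. Qed.

Lemma star_number_scale n x y k :
  tri_mean F (s n) (fun=> 1) x <= k * tri_mean F (s n) (fun=> 1) y ->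
  D n x <= k * D n y.
Proof.
by move=> H; rewrite /star_number [leRHS]mulrCA ler_wpM2l// mulr_ge0 ?invr_ge0.
Qed.

Lemma star_mean_le n x : 0 < s n -> star_mean W n x <= D n x.
Proof. by move=> s0; rewrite ler_wpM2r ?tri_mean_ge0 ?bin2_pred_le. Qed.

Lemma star_mean_ge n x : (0 < n)%N -> (1 - 3 / n%:R) * D n x <= star_mean W n x.
Proof.
move=> n0; have s0 : 0 < s n by rewrite mulr_gt0// ltr0n.
by rewrite /star_number mulrA ler_wpM2r ?tri_mean_ge0 ?bin2_pred_ge.
Qed.

Lemma tri_total_trunc_le n b : 0 < s n ->
  tri_total F (s n) (trunc b) <= tri_total F (s n) (fun=> 1).
Proof.
move=> s0; apply: (le_trans (tri_total_le_mean F s0 (bounded_meas_trunc b) _)) => [x|].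
  by rewrite trunc_ge0 trunc_le1.
by rewrite le_eqVlt; apply/orP; left; apply/eqP/eq_mean => x; rewrite [RHS]mul1r.
Qed.

Lemma light_mean_le n b (U : {set 'I_n}) : 0 < s n -> light_mean W b U <= m n.
Proof.
move=> s0; rewrite /light_mean card_triples_in /tri_number.
apply: ler_pM; [exact: ler0n| | |].
- apply: mean_ge0 => x; apply: mulr_ge0; first exact: trunc_ge0.
  by apply: tri_mean_ge0 => // y; exact: trunc_ge0.
- by rewrite ler_nat leq_bin2l// -[leqRHS]card_ord max_card.
- exact: tri_total_trunc_le.
Qed.

Lemma light_mean_out_ge n b (u : 'I_n) k : 0 < s n -> 0 <= 1 - 3 / n%:R :> R ->
  n%:R ^+ 3 * (tri_total F (s n) (fun=> 1) - tri_total F (s n) (trunc b)) <= k ->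
  (1 - 3 / n%:R) * m n - k <= light_mean W b (~: [set u])%SET.
Proof.
move=> s0 n3; have n0 : (0 < n)%N := leq_ltn_trans (leq0n u) (ltn_ord u).
have := tri_total_trunc_le b s0; rewrite /light_mean /tri_number card_triples_out.
move: (tri_total _ _ _) (tri_total _ _ _) => t' t tt H.
rewrite -bin3_pred// -mulrA lerBlDr -lerBlDl -mulrBr -mulrBr (le_trans _ H)// mulrA.
rewrite ler_wpM2r ?subr_ge0//; apply: (@le_trans _ _ 'C(n, 3)%:R).
  by rewrite ler_piMl// gerBl divr_ge0.
by rewrite -natrX ler_nat -card_card3_setsE card_card3_sets.
Qed.

Lemma tail_prob_upper delta : 0 < delta -> \forall n \near \oo,
  fine (P [set w | (1 + a) * m n < (triangles (E n w))%:R]) <=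
  (1 + 6 * delta) * (n%:R * G (c n)).
Proof.
move=> d0; have d3 : 0 < 3 * delta by rewrite mulr_gt0.
have [l [l0 l1 lp _]] := near_one_powR alpha_gt0 d3.
have [e [x1 [e0 e1 x11 strict]]] := tri_mean_strict alpha_gt1 G_gt0 G_regular l0 l1.
have [beta [_ V1 V2 _ V3]] := truncation_exponent alpha_gt alpha_lt mu_gt0 G_gt0
  G_regular a_gt0 c_below c_above.
pose zeta := e * a / 2.
have z0 : 0 < zeta by rewrite divr_gt0// mulr_gt0.
have H1 := V1 (delta * a ^+ 2) (mulr_gt0 d0 (exprn_gt0 2 a_gt0)).
have H2 := V2 _ d0.
have H3 := V3 (l * l) (delta * zeta ^+ 2) (mulr_gt0 l0 l0) (mulr_gt0 d0 (exprn_gt0 2 z0)).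
have H4 := tail_ratio_lt alpha_gt alpha_lt mu_gt0 G_gt0 G_regular a_gt0
  c_above (mulr_gt0 l0 l0) lp.
have H5 := threshold_small alpha_gt alpha_lt mu_gt0 G_gt0 G_regular a_gt0
  c_below c_above x1.
have H6 := threshold_cvg alpha_gt alpha_lt mu_gt0 G_gt0 G_regular a_gt0
  c_above 1.
have H7 := tri_number_gt0 alpha_gt mu_gt0 G_gt0 G_regular.
near=> n.
have n0 : (0 < n)%N by rewrite -(@ltr0n R); near: n; exact: near_nat_gt0.
have s0 : 0 < s n by rewrite mulr_gt0// ltr0n.
have m0 : 0 < m n by near: n.
have c0 : 0 < c n by apply: (@lt_le_trans _ _ 1) => //; near: n.
have sc : x1 <= s n / c n by near: n.
have below w : 0 <= w -> w < c n -> D n w < a * m n by move: w; near: n.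
(* One factor [l] brings the weight strictly below [c n], where the star mean is less than
   [a * m n]; the second one gains [1 - e] through [strict]. *)
have star_le x : x <= l * l * c n -> star_mean W n x <= (1 - e) * a * m n.
  move=> xl; apply: (@le_trans _ _ (star_mean W n (l * l * c n))); first exact: star_mean_nd.
  apply: (le_trans (star_mean_le _ s0)).
  have lc : 0 < l * c n by exact: mulr_gt0.
  have lcc : l * c n < c n by rewrite gtr_pMl.
  apply: (@le_trans _ _ ((1 - e) * D n (l * c n))).
    rewrite -mulrA; apply: star_number_scale; apply: strict => //; apply: (le_trans sc).
    by rewrite ler_wpM2l ?(ltW s0)// lef_pV2 ?posrE// ltW.
  by rewrite -mulrA ler_wpM2l ?subr_ge0 ?(ltW e1)// ltW// below// (ltW lc).
have ze : 2 * zeta = e * a by rewrite /zeta; field.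
have := @triangles_upper_tail _ _ _ _ W n (E n) W_iid W_ge0 (E_graph n) s0
  (n%:R `^ beta) (m n) zeta m0 z0 a e (l * l * c n) n0 a_gt0 ze star_le
  (fun U => light_mean_le _ U s0).
move=> /le_trans; apply.
have B1 : light_variance W n (n%:R `^ beta) <= delta * a ^+ 2 * (n%:R * G (c n) * (m n * m n)).
  by near: n; exact: H1.
have B2 : n%:R ^+ 2 * (G (n%:R `^ beta) * G (n%:R `^ beta)) <= delta * (n%:R * G (c n)).
  by near: n.
have B3 : G (n%:R `^ beta) * star_variance W n (l * l * c n) +
    G (n%:R `^ beta) * light_variance W n (n%:R `^ beta) <=
    delta * zeta ^+ 2 * (G (c n) * (m n * m n)).
  by near: n; exact: H3.
have B4 : G (l * l * c n) <= (1 + 3 * delta) * G (c n) by near: n.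
exact: (upper_error_sum (ler0n R n) m0 z0 a_gt0 B1 B2 B3 B4).
Unshelve. all: by end_near. Qed.

Lemma tail_prob_lower delta : 0 < delta -> \forall n \near \oo,
  (1 - 4 * delta) * (n%:R * G (c n)) <=
  fine (P [set w | (1 + a) * m n < (triangles (E n w))%:R]).
Proof.
move=> d0; have [l [l0 l1 _ lp]] := near_one_powR alpha_gt0 d0.
have ll0 : 0 < l * l by exact: mulr_gt0.
pose t1 := (l * l)^-1; have t10 : 0 < t1 by rewrite invr_gt0.
(* Weights above [K * c n] are given up: their tail is at most [delta] times the tail at [c n]. *)
have [K [K0 tK Kp]] := large_powR_lt t1 alpha_gt0 d0.
have [e [x1 [e0 e1 x11 strict]]] := tri_mean_strict alpha_gt1 G_gt0 G_regular l0 l1.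
have [beta [B V1 V2 V3 V4]] := truncation_exponent alpha_gt alpha_lt mu_gt0 G_gt0
  G_regular a_gt0 c_below c_above.
pose zeta := e * a / 4.
have z0 : 0 < zeta by rewrite divr_gt0// mulr_gt0.
have H1 := V3 zeta z0.
have H2 := V2 _ d0.
have H3 := V4 K (delta * zeta ^+ 2) K0 (mulr_gt0 d0 (exprn_gt0 2 z0)).
have H4 := tail_ratio_gt alpha_gt alpha_lt mu_gt0 G_gt0 G_regular a_gt0
  c_above t10 lp.
have H4' := tail_ratio_lt alpha_gt alpha_lt mu_gt0 G_gt0 G_regular a_gt0
  c_above K0 Kp.
have H5 := threshold_small alpha_gt alpha_lt mu_gt0 G_gt0 G_regular a_gt0
  c_below c_above (t1 * x1).
have H6 := threshold_cvg alpha_gt alpha_lt mu_gt0 G_gt0 G_regular a_gt0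
  c_above 1.
have H7 := tri_number_gt0 alpha_gt mu_gt0 G_gt0 G_regular.
(* For such [n] the relative loss [3 / n] in the binomial coefficients costs at most [zeta]. *)
have H8 := near_ge_pow_of_exp_ge (3 * (1 + (1 + e) * a) / zeta) ltr01 (@exp_ge_nat R).
have H9 := B _ t10.
have H10 := near_ge_pow_of_exp_ge 3 ltr01 (@exp_ge_nat R).
near=> n.
have n0 : (0 < n)%N by rewrite -(@ltr0n R); near: n; exact: near_nat_gt0.
have nR : 0 < n%:R :> R by rewrite ltr0n.
have s0 : 0 < s n by rewrite mulr_gt0.
have m0 : 0 < m n by near: n.
have c0 : 0 < c n by apply: (@lt_le_trans _ _ 1) => //; near: n.
have sc : t1 * x1 <= s n / c n by near: n.
have above w : c n < w -> a * m n <= D n w by move: w; near: n.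
have r10 : 0 < t1 * c n by exact: mulr_gt0.
(* The weight [c n / l] lies beyond the threshold, so its star mean is at least [a * m n]; enlarging
   it once more by [1 / l] multiplies the mean by at least [1 / (1 - e)], which exceeds [1 + e]. *)
have D1 : (1 + e) * (a * m n) <= D n (t1 * c n).
  have cl : c n < l * (t1 * c n).
    rewrite /t1 invfM mulrA mulrA divff ?gt_eqF// mul1r.
    by rewrite -[ltLHS]mul1r ltr_pM2r// invf_gt1.
  have A1 : D n (l * (t1 * c n)) <= (1 - e) * D n (t1 * c n).
    by apply: star_number_scale; apply: strict => //; rewrite invfM mulrCA ler_pdivlMl//.
  have := le_trans (above _ cl) A1; have := D_ge0 (t1 * c n) s0; move: e0 e1.
  move: (D n _) (a * m n) => y z e0 e1 y0 zy.
  apply: (@le_trans _ _ ((1 + e) * ((1 - e) * y))); first by rewrite ler_wpM2l// addr_ge0// ltW.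
  have -> : (1 + e) * ((1 - e) * y) = y - e ^+ 2 * y by ring.
  by rewrite gerBl mulr_ge0// sqr_ge0.
have n3 : 3 / n%:R * (1 + (1 + e) * a) <= zeta.
  have : 3 * (1 + (1 + e) * a) / zeta <= n%:R by near: n.
  rewrite ler_pdivrMr// => h.
  by rewrite mulrAC ler_pdivrMr// [leRHS]mulrC.
have hyp (u : 'I_n) : (1 + a) * m n + 2 * (zeta * m n) <=
    star_mean W n (t1 * c n) + light_mean W (n%:R `^ beta) (~: [set u])%SET.
  have S1 := star_mean_ge (t1 * c n) n0.
  have n3' : 0 <= 1 - 3 / n%:R :> R.
    by rewrite subr_ge0 ler_pdivrMr// mul1r; near: n.
  have S2 : (1 - 3 / n%:R) * m n - zeta * m n <=
      light_mean W (n%:R `^ beta) (~: [set u])%SET.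
    by apply: light_mean_out_ge => //; near: n.
  have S3 : (1 - 3 / n%:R) * ((1 + e) * (a * m n)) <= star_mean W n (t1 * c n).
    by apply: (le_trans _ S1); rewrite ler_wpM2l.
  exact: lower_mean_sum (ltW m0) n3 S3 S2.
have := @triangles_lower_tail _ _ _ _ W n (E n) W_iid W_ge0 (E_graph n) s0
  (n%:R `^ beta) (m n) zeta m0 z0 a (t1 * c n) (K * c n) n0.
move=> /(_ _ _ hyp) H; apply: (le_trans _ (H _ _)); last 2 first.
- by near: n.
- by rewrite ler_wpM2r// ltW.
have B2 : n%:R ^+ 2 * (G (n%:R `^ beta) * G (n%:R `^ beta)) <= delta * (n%:R * G (c n)).
  by near: n.
have B3 : G (n%:R `^ beta) * star_variance W n (K * c n) +
    G (n%:R `^ beta) * light_variance W n (n%:R `^ beta) <=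
    delta * zeta ^+ 2 * (G (c n) * (m n * m n)).
  by near: n; exact: H3.
have B4 : (1 - delta) * G (c n) <= G (t1 * c n) by near: n.
have B4' : G (K * c n) <= delta * G (c n) by near: n.
exact: (lower_error_sum (ler0n R n) m0 z0 B2 B3 B4 B4').
Unshelve. all: by end_near. Qed.

End tail_probability.

(** * The threshold of the model *)

Section model.
Context d (T : measurableType d) (R : realType) (P : probability T R).
Variable W : nat -> {RV P >-> R}.
Hypothesis W_iid : iid W.
Hypothesis W_ge0 : forall k w, 0 <= W k w.
Local Notation mu := (mean_weight W).
Local Notation F := (distribution P (W 0%N) : probability R R).
Local Notation G := (tail F).

(** [mean_weight] is a [fine], hence 0 if the expectation were infinite; the first moment excludes
    this. Positivity follows from [y] dominating the indicator of the weights above 1. *)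
Lemma mean_weight_gt0 : integ F (@pos_pow R 1) -> 0 < G 1 -> 0 < mu.
Proof.
move=> F1 G1; have -> : mu = mean F (@pos_pow R 1).
  rewrite /mean_weight unlock /mean /Rintegral; congr fine.
  rewrite (@ge0_integral_distribution _ _ _ _ _ _ (W 0%N) (EFin \o @pos_pow R 1)).
  - by apply: eq_integral => w _; rewrite /= /pos_pow max_l// powRr1.
  - by apply/measurable_EFinP; exact: measurable_pos_pow.
  - by move=> y; rewrite lee_fin pos_pow_ge0.
apply: (lt_le_trans G1); rewrite -mean_above_tail; apply: mean_le => //.
  exact/bounded_integ/bounded_meas_above.
move=> y; rewrite aboveE /pos_pow; case: (ltP 1 y) => y1; last exact: powR_ge0.
by rewrite powRr1; rewrite le_max ?lexx ?orbT// ltW.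
Qed.

Section graph.
Variables (n : nat) (E : T -> rel 'I_n).
Hypothesis E_graph : weighted_random_graph W E.
Local Notation s := (mu * n%:R).
Hypothesis s_gt0 : 0 < s.

Lemma mean_trianglesE : mean_triangles P E = (tri_number F mu n)%:E.
Proof.
have b1 := @bounded_meas_cst _ R R 1.
have bt t : t \in card3_sets n -> bounded_meas (tri_wt W E (fun=> 1) t).
  rewrite inE => /eqP t3; exact: (bounded_meas_tri_wt _ b1).
have DE w : (triangles (E w))%:R = \sum_(t in card3_sets n) tri_wt W E (fun=> 1) t w :> R.
  rewrite triangles_sum; apply: eq_bigr => t _.
  by rewrite /tri_wt big1 ?mulr1.
rewrite /mean_triangles unlock.
under eq_integral do rewrite DE.
rewrite mean_EFin; last exact/bounded_integ/bounded_meas_sum_in.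
congr EFin; pose X t := if t \in card3_sets n then tri_wt W E (fun=> 1) t else fun=> 0.
have bX t : bounded_meas (X t).
  by rewrite /X; case tK : (t \in _); [exact: bt | exact: bounded_meas_cst].
rewrite (_ : (fun w => _) = fun w => \sum_(t in card3_sets n) X t w); last first.
  by apply/funext => w; apply: eq_bigr => t tK; rewrite /X tK.
rewrite mean_sum// (eq_bigr (fun=> tri_total F s (fun=> 1))) => [|t tK].
  by rewrite /tri_number sumr_const card_card3_setsE [RHS]mulr_natl.
rewrite /X tK; have t3 : #|t| = 3%N by move: tK; rewrite inE => /eqP.
have /card_gt0P[u ut] : (0 < #|t|)%N by rewrite t3.
have vm : vertex_measurable W n (fun=> 1 : R) by exact: vertex_measurable_cst.
have H := mean_tri_wt W_iid W_ge0 E_graph s_gt0 (h := fun=> 1) (g := fun=> 1) (hb := fun=> 1)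
  (j := 0%N) b1 (fun=> ler01) b1 (fun=> ler01) b1 (fun=> ler01) vm t3 ut (fun i _ => isT).
transitivity (mean P (fun w => 1 * 1 * tri_wt W E (fun=> 1) t w)).
  by apply: eq_mean => w; rewrite !mul1r.
rewrite [LHS]H mean_cst [LHS]mul1r.
by apply: eq_mean => x; rewrite [1 * 1]mul1r.
Qed.

Lemma triangle_fnE x y c : 0 <= x -> 0 <= y -> 0 <= c ->
  triangle_fn mu n x y c = tri s c y x.
Proof.
move=> x0 y0 c0.
have kE u v : 0 <= u -> 0 <= v -> connection mu n u v = kernel s u v.
  by move=> u0 v0; rewrite /kernel !max_l.
rewrite /triangle_fn /tri !kE// (kernelC _ y c) (kernelC _ x y) (kernelC _ x c).
by ring.
Qed.

Lemma tri_neg c y x : (y < 0) || (x < 0) -> tri s c y x = 0.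
Proof.
have k0 u v : v <= 0 -> kernel s u v = 0.
  by move=> v0; rewrite /kernel (max_r v0) mulr0 mul0r min_l.
case/orP => /ltW h; rewrite /tri ?(k0 _ _ h); last by rewrite mulr0.
by rewrite !mul0r.
Qed.

(** Since [kernel] vanishes at negative weights, the integrals over the half-line extend to the
    whole line without change. *)
Lemma star_integralE c : 0 <= c ->
  (\int[F]_(y in `[0%R, +oo[) \int[F]_(x in `[0%R, +oo[)
     (triangle_fn mu n x y c)%:E = (tri_mean F s (fun=> 1) c)%:E)%E.
Proof.
move=> c0; have b2 := bounded2_tri1 s_gt0 c.
rewrite integral_mkcond tri_mean1E -mean_EFin; last first.
  exact/bounded_integ/bounded2_mean.
apply: eq_integral => y _; rewrite /patch; case: ifPn => [|yn].
  rewrite inE /= in_itv/= andbT => y0.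
  rewrite integral_mkcond -mean_EFin; last exact/bounded_integ/bounded2_at.
  apply: eq_integral => x _; rewrite /patch; case: ifPn => [|xn].
    by rewrite inE /= in_itv/= andbT => x0; rewrite triangle_fnE.
  rewrite tri_neg//; apply/orP; right; rewrite ltNge; apply: contra xn => x0.
  by rewrite inE /= in_itv/= andbT.
rewrite (@eq_mean _ _ _ _ _ (fun=> 0)) ?mean_cst// => x.
rewrite tri_neg//; apply/orP; left; rewrite ltNge; apply: contra yn => y0.
by rewrite inE /= in_itv/= andbT.
Qed.

Lemma weight_thresholdE a : weight_threshold W E a =
  ereal_inf [set c%:E | c in [set c : R | 0 <= c /\
    a * tri_number F mu n <= star_number F mu n c]].
Proof.
rewrite /weight_threshold mean_trianglesE; congr ereal_inf; congr image.
apply/seteqP; split => c /= [c0].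
  by rewrite star_integralE// -!EFinM lee_fin => H; split.
by move=> H; split => //; rewrite star_integralE// -!EFinM lee_fin.
Qed.

Variable a : R.
Hypothesis exceeds : exists2 w, 0 <= w & a * tri_number F mu n <= star_number F mu n w.
Local Notation c := (fine (weight_threshold W E a)).

Lemma weight_threshold_fin : weight_threshold W E a = c%:E.
Proof.
have [w w0 Hw] := exceeds; rewrite fineK// fin_numE weight_thresholdE; apply/andP; split.
  rewrite gt_eqF// (@lt_le_trans _ _ 0%:E) ?ltNyr//.
  by apply: le_ereal_inf_tmp => _ [x [x0 _] <-]; rewrite lee_fin.
rewrite lt_eqF// (@le_lt_trans _ _ w%:E) ?ltry//.
by apply: ereal_inf_lbound; exists w.
Qed.

Lemma below_threshold w : 0 <= w -> w < c ->
  star_number F mu n w < a * tri_number F mu n.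
Proof.
move=> w0; rewrite -lte_fin -weight_threshold_fin weight_thresholdE => wc.
rewrite ltNge; apply/negP => H; move: wc; rewrite ltNge => /negP; apply.
by apply: ereal_inf_lbound; exists w.
Qed.

(** Some admissible weight lies below [w], and the star mean is nondecreasing; the infimum itself
    does not have to be attained. *)
Lemma above_threshold w : c < w -> a * tri_number F mu n <= star_number F mu n w.
Proof.
rewrite -lte_fin -weight_threshold_fin weight_thresholdE => /ereal_inf_lt[_ [x [x0 H] <-]].
rewrite lte_fin => xw; apply: (le_trans H).
apply: ler_wpM2l; first by rewrite mulr_ge0 ?invr_ge0 ?exprn_ge0.
by apply: tri_mean_nd => //; exact: ltW.
Qed.

End graph.
End model.

Lemma tail_ccdf d (T : measurableType d) (R : realType) (P : probability T R)
    (W : nat -> {RV P >-> R}) (alpha : R) (L : R -> R) :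
  (forall x, 0 < x -> ccdf (W 0%N) x = (x `^ (- alpha) * L x)%:E) ->
  forall x, 0 < x -> tail (distribution P (W 0%N)) x = x `^ (- alpha) * L x.
Proof. by move=> tailE x x0; rewrite /tail -[LHS]/(fine (ccdf (W 0%N) x)) tailE. Qed.

Lemma regular_tail (R : realType) (G L : R -> R) (alpha : R) :
  slowly_varying L -> (forall x, 0 < x -> G x = x `^ (- alpha) * L x) ->
  forall t, 0 < t -> G (t * x) / G x @[x --> +oo] --> t `^ (- alpha).
Proof.
move=> [_ L0 sv] GE t t0; rewrite -[X in _ --> X]mulr1.
have H : t `^ (- alpha) * (L (t * x) / L x) @[x --> +oo] --> t `^ (- alpha) * 1.
  by apply: cvgM; [exact: cvg_cst | exact: sv].
have EH : \forall x \near +oo, t `^ (- alpha) * (L (t * x) / L x) = G (t * x) / G x.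
  near=> x.
  have x0 : 0 < x by near: x; apply: nbhs_pinfty_gt; exact: num_real.
  have xa : 0 < x `^ (- alpha) by exact: powR_gt0.
  rewrite !GE ?mulr_gt0// powRM ?ltW//.
  by field; rewrite !gt_eqF// L0.
by apply: cvg_trans H; apply: (near_eq_cvg EH).
Unshelve. all: by end_near. Qed.

Lemma ratio_cvg (R : realType) (p q : nat -> R) :
  (\forall n \near \oo, 0 < q n) ->
  (forall delta, 0 < delta -> \forall n \near \oo, p n <= (1 + 6 * delta) * q n) ->
  (forall delta, 0 < delta -> \forall n \near \oo, (1 - 4 * delta) * q n <= p n) ->
  p n / q n - 1 @[n --> \oo] --> 0.
Proof.
move=> q0 up lo; apply/cvgr0Pnorm_le => e e0.
have e6 : 0 < e / 6 by rewrite divr_gt0.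
have Hu := up _ e6; have Hl := lo _ e6; near=> n.
have qn : 0 < q n by near: n.
rewrite ler_norml lerBrDr lerBlDr ler_pdivrMr// ler_pdivlMr//; apply/andP; split.
  apply: (@le_trans _ _ ((1 - 4 * (e / 6)) * q n)); last by near: n.
  by rewrite ler_pM2r//; move: e0; lra.
apply: (@le_trans _ _ ((1 + 6 * (e / 6)) * q n)); first by near: n.
by rewrite ler_pM2r//; lra.
Unshelve. all: by end_near. Qed.

Unset Implicit Arguments.
Set Strict Implicit.
Set Printing Implicit Defensive.

Theorem theorem1p3 (R : realType) (d : measure_display) (T : measurableType d)
    (P : probability T R) (W : nat -> {RV P >-> R}) (alpha : R) (L : R -> R)
    (E : forall n : nat, T -> rel 'I_n) (a : R)
    (W_iid : iid W)
    (W_ge0 : forall (k : nat) (w : T), 0 <= W k w)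
    (F_continuous : continuous (cdf (W 0%N)))
    (L_slow : slowly_varying L)
    (W_tail : forall x : R, 0 < x ->
      ccdf (W 0%N) x = (x `^ (- alpha) * L x)%:E)
    (E_graph : forall n : nat, weighted_random_graph W (E n))
    (alpha_gt : 4 / 3 < alpha) (alpha_lt : alpha < 2)
    (a_gt0 : 0 < a) :
  exists eps : nat -> R, eps @ \oo --> (0 : R) /\
    \forall n \near \oo,
      (P [set w | (1 + a)%R%:E * mean_triangles P (E n)
                    < (triangles (E n w))%:R%:E] =
       ((1 + eps n) * n%:R)%R%:E *
         P [set w | weight_threshold W (E n) a < (W 0%N w)%:E])%E.
Proof.
pose F : probability R R := distribution P (W 0%N).
have GE := tail_ccdf W_tail.
have L0 : forall x, 0 < x -> 0 < L x by case: L_slow.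
have G_gt0 x : 0 < x -> 0 < tail F x by move=> x0; rewrite GE// mulr_gt0 ?powR_gt0 ?L0.
have G_regular := regular_tail L_slow GE.
have alpha_gt1 : 1 < alpha by rewrite (lt_trans _ alpha_gt)// ltr_pdivlMr// mul1r ltr_nat.
have mu_gt0 : 0 < mean_weight W.
  by apply: mean_weight_gt0 => //; [exact: (moment_finite G_gt0 G_regular) | exact: G_gt0].
(* For the finitely many [n] with an infinite threshold, [fine] returns 0; all later statements
   concern large [n], where the threshold is finite. *)
pose c n := fine (weight_threshold W (E n) a).
have exceeds := star_number_exceeds alpha_gt alpha_lt mu_gt0 G_gt0 G_regular a_gt0.
have s0 : \forall n \near \oo, 0 < mean_weight W * n%:R by exact: near_scale_gt0.
have c_below : \forall n \near \oo, forall w, 0 <= w -> w < c n ->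
    star_number F (mean_weight W) n w < a * tri_number F (mean_weight W) n.
  by near=> n; apply: below_threshold => //; near: n.
have c_above : \forall n \near \oo, forall w, c n < w ->
    a * tri_number F (mean_weight W) n <= star_number F (mean_weight W) n w.
  by near=> n; apply: above_threshold => //; near: n.
have c_gt0 : \forall n \near \oo, 0 < c n.
  have := threshold_cvg alpha_gt alpha_lt mu_gt0 G_gt0 G_regular a_gt0 c_above 1.
  by apply: filterS => n; exact: lt_le_trans.
pose p n := fine (P [set w | (1 + a) * tri_number F (mean_weight W) n <
  (triangles (E n w))%:R]).
pose q n := n%:R * tail F (c n).
have q_gt0 : \forall n \near \oo, 0 < q n.
  near=> n; rewrite mulr_gt0 ?G_gt0//; first by near: n; exact: near_nat_gt0.
  by near: n.
(* The identity forces this error term wherever [q n] is nonzero, so the content is its convergence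
   to 0, which the two one-sided bounds give. *)
exists (fun n => p n / q n - 1); split.
  apply: ratio_cvg => // delta delta_gt0.
    exact: (tail_prob_upper W_iid W_ge0 E_graph alpha_gt alpha_lt mu_gt0 G_gt0 G_regular
      a_gt0 c_below c_above).
  exact: (tail_prob_lower W_iid W_ge0 E_graph alpha_gt alpha_lt mu_gt0 G_gt0 G_regular
    a_gt0 c_below c_above).
near=> n.
have sn : 0 < mean_weight W * n%:R by near: n.
have qn : q n != 0 by rewrite gt_eqF//; near: n.
have ex : exists2 w, 0 <= w &
    a * tri_number F (mean_weight W) n <= star_number F (mean_weight W) n w by near: n.
rewrite (mean_trianglesE W_iid W_ge0 (E_graph n) sn).
rewrite (weight_threshold_fin W_iid W_ge0 (E_graph n) sn ex).
transitivity (p n)%:E.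
  rewrite /p fine_probK; last exact/measurable_gt_set/(measurable_triangles (E_graph n)).
  by congr (P _); apply/seteqP; split => w /=; rewrite -EFinM lte_fin.
have -> : [set w | ((c n)%:E < (W 0%N w)%:E)%E] = [set w | c n < W 0%N w].
  by apply/seteqP; split => w /=; rewrite lte_fin.
rewrite -fine_probK; last exact: measurable_weight_gt.
rewrite (weight_tail W_iid) -EFinM -mulrA -/(q n) subrKC.
by rewrite divfK.
Unshelve. all: by end_near. Qed.
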